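(* Let $\mu\in\mathbb{C}$ be such that $\mu\ne2n-1$ for any $n\in\mathbb{N}_0$, and let the constants $\eta_*,c_0,c_1,c_2\in\mathbb{C}$ be arbitrary with $(c_1,c_2)\ne(0,0)$. Then the function $$\Upsilon(\eta)=c_0(\mu-\eta^2)+c_1\Upsilon_{\mu,\eta_*,1}(\eta)+c_2\Upsilon_{\mu,\eta_*,2}(\eta)$$ satisfies the following asymptotics: $$\lim_{\substack{\eta\to\infty\\|\arg(\eta)|<\frac\pi4}}\left|\frac{\Upsilon(\eta)}{\mu-\eta^2}\right|=+\infty\qquad\text{or}\qquad \lim_{\substack{\eta\to\infty\\|\arg(-\eta)|<\frac\pi4}}\left|\frac{\Upsilon(\eta)}{\mu-\eta^2}\right|=+\infty.$$ In the case $\mu=-1$ (with $\Upsilon$ of the same form and the same constants $\eta_*,c_0,c_1,c_2\in\mathbb{C}$, $(c_1,c_2)\ne(0,0)$), it holds $$\lim_{\substack{\eta\to\infty\\|\arg(\eta)|<\frac\pi4}}\left|\frac{\Upsilon(\eta)}{\mu-\eta^2}\right|\ne0\qquad\text{or}\qquad \lim_{\substack{\eta\to\infty\\|\arg(-\eta)|<\frac\pi4}}\left|\frac{\Upsilon(\eta)}{\mu-\eta^2}\right|\ne0.$$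
   Context: $\mathbb{N}_0=\{0,1,2,\dots\}$; $\eta\in\mathbb{C}$ and $\arg$ is the principal argument. $\mathcal{M}(\mathrm{a},\mathrm{c},\zeta)=\sum_{n\ge0}\frac{(\mathrm{a})_n}{(\mathrm{c})_n}\frac{\zeta^n}{n!}$ is Kummer's function, with $(\cdot)_n$ the (rising) Pochhammer symbol. For $\mu\in\mathbb{C}$ set $$\psi_{\mu,1}(\eta)=\mathcal{M}\Big(-\frac{1+\mu}{4},\frac12,\eta^2\Big)e^{-\frac{\eta^2}{2}},\qquad\psi_{\mu,2}(\eta)=\eta\,\mathcal{M}\Big(\frac{1-\mu}{4},\frac32,\eta^2\Big)e^{-\frac{\eta^2}{2}},$$ and for $\mu\ne1$ (the value $\mu=1$ does not occur in the claim), $\eta_*\in\mathbb{C}$, $i\in\{1,2\}$, $$\Upsilon_{\mu,\eta_*,i}(\eta)=\int_{\eta_*}^\eta\Big(1+\frac{\eta^2-\xi^2}{2}\Big)\psi_{\mu,i}(\xi)\,d\xi-\frac{\psi_{\mu,i}'(\eta_* )}{2},$$ the integrals being along any path in $\mathbb{C}$.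
   Formalization: The limits as η→∞ with |arg(±η)|<π/4 are taken uniformly on each closed subsector |arg(±η)|≤α, α<π/4; over the whole open sector the first claim fails, e.g. for μ=0, η_*=c_0=c_2=0, c_1=1 along Re(η²)=1. *)

(* Defs.v *)
From Stdlib Require Import Reals Lra Factorial.
From Coquelicot Require Import Coquelicot.

Open Scope C_scope.

Definition Cexp (z : C) : C :=
  ((exp (Re z) * cos (Im z))%R, (exp (Re z) * sin (Im z))%R).

(* Principal argument, with values in (-PI, PI]; the value at 0 is junk. *)
Definition Carg (z : C) : R :=
  if Rle_dec 0 (Im z) then acos (Re z / Cmod z) else (- acos (Re z / Cmod z))%R.

Lemma Carg_spec (z : C) : z <> 0 ->
  (- PI < Carg z <= PI)%R /\ z = Cmod z * (cos (Carg z), sin (Carg z)).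
Proof.
intros Hz; destruct z as [x y]; unfold Carg; simpl.
assert (Hr : (0 < Cmod (x, y))%R) by now apply Cmod_gt_0.
assert (H2 : (Cmod (x, y) ^ 2 = x ^ 2 + y ^ 2)%R) by apply (Cmod2_alt (x, y)).
set (r := Cmod (x, y)) in *.
assert (Hq : (- 1 <= x / r <= 1)%R).
{ assert (Hx : (Rabs x <= r)%R) by apply (re_le_Cmod (x, y)).
  apply Rabs_le_between in Hx; split.
  - apply Rmult_le_reg_r with r; [lra|].
    replace (x / r * r)%R with x by (field; lra); lra.
  - apply Rmult_le_reg_r with r; [lra|].
    replace (x / r * r)%R with x by (field; lra); lra. }
assert (Hs : sqrt (1 - (x / r)²) = (Rabs y / r)%R).
{ replace (1 - (x / r)²)%R with ((y / r)²)%R.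
  - rewrite sqrt_Rsqr_abs; unfold Rdiv.
    rewrite Rabs_mult, (Rabs_pos_eq (/ r)); [easy|].
    now apply Rlt_le, Rinv_0_lt_compat.
  - unfold Rsqr; replace (y / r * (y / r))%R with (y ^ 2 / r ^ 2)%R by (field; lra).
    replace (y ^ 2)%R with (r ^ 2 - x ^ 2)%R by lra; field; lra. }
pose proof (acos_bound (x / r)) as Hb.
destruct (Rle_dec 0 y) as [Hy | Hy].
- split; [pose proof PI_RGT_0; lra|].
  rewrite cos_acos, sin_acos, Hs, Rabs_pos_eq by lra.
  unfold Cmult, RtoC; simpl; f_equal; field; lra.
- split.
  + split; [|pose proof PI_RGT_0; lra].
    destruct (Req_dec (acos (x / r)) PI) as [E | E]; [|lra].
    exfalso; pose proof (sin_acos (x / r) Hq) as F.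
    rewrite E, sin_PI, Hs, Rabs_left in F by lra.
    assert (0 < - y / r)%R by (apply Rdiv_lt_0_compat; lra); lra.
  + rewrite cos_neg, sin_neg, cos_acos, sin_acos, Hs, Rabs_left by lra.
    unfold Cmult, RtoC; simpl; f_equal; field; lra.
Qed.

Fixpoint pochhammer (a : C) (n : nat) : C :=
  match n with
  | O => 1
  | S m => pochhammer a m * (a + INR m)
  end.

Definition Cseries (a : nat -> C) : C :=
  (Series (fun n => Re (a n)), Series (fun n => Im (a n))).

Definition kummer (a c z : C) : C :=
  Cseries (fun n => pochhammer a n / pochhammer c n * (z ^ n / INR (fact n))).

Definition psi1 (mu eta : C) : C :=
  kummer (- ((1 + mu) / 4)) (1 / 2) (eta ^ 2) * Cexp (- (eta ^ 2 / 2)).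

Definition psi2 (mu eta : C) : C :=
  eta * kummer ((1 - mu) / 4) (3 / 2) (eta ^ 2) * Cexp (- (eta ^ 2 / 2)).

Definition velocity (gamma : R -> C) (t : R) : C :=
  (Derive (fun s => Re (gamma s)) t, Derive (fun s => Im (gamma s)) t).

(* The velocity may vanish, so this covers every piecewise C^1 path up to
   reparametrisation.  Differentiability at the endpoints is two-sided, which
   is no restriction since a C^1 path on [0, 1] extends affinely. *)
Definition C1_path (a b : C) (gamma : R -> C) : Prop :=
  gamma 0%R = a /\ gamma 1%R = b /\
  forall t : R, (0 <= t <= 1)%R ->
    ex_derive (V := C_R_NormedModule) gamma t /\
    continuous (U := C_R_NormedModule) (velocity gamma) t.

Definition path_integral (f : C -> C) (gamma : R -> C) : C :=
  RInt (V := C_R_CompleteNormedModule)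
    (fun t => f (gamma t) * velocity gamma t) 0 1.

(* [gamma eta] is the path from [eta_star] to [eta]. *)
Definition Upsilon_of (psi : C -> C) (eta_star : C) (gamma : C -> R -> C)
    (eta : C) : C :=
  path_integral (fun xi => (1 + (eta ^ 2 - xi ^ 2) / 2) * psi xi) (gamma eta)
  - C_derive psi eta_star / 2.

Definition Upsilon (mu eta_star c0 c1 c2 : C) (gamma1 gamma2 : C -> R -> C)
    (eta : C) : C :=
  c0 * (mu - eta ^ 2)
  + c1 * Upsilon_of (psi1 mu) eta_star gamma1 eta
  + c2 * Upsilon_of (psi2 mu) eta_star gamma2 eta.

Definition ratio (mu eta_star c0 c1 c2 : C) (gamma1 gamma2 : C -> R -> C)
    (eta : C) : R :=
  Cmod (Upsilon mu eta_star c0 c1 c2 gamma1 gamma2 eta / (mu - eta ^ 2)).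

Definition C_infty (P : C -> Prop) : Prop :=
  exists M : R, forall z : C, (M < Cmod z)%R -> P z.

(* Limits as eta -> oo with |arg eta| < PI/4 (resp. |arg (- eta)| < PI/4) are
   taken in the usual sense for asymptotics in an open sector: uniformly on
   each closed subsector |arg eta| <= alpha, alpha < PI/4.  Uniformity up to
   the boundary rays would be false: on the curve Re (eta^2) = 1 the function
   Upsilon / (mu - eta^2) stays bounded, e.g., for mu = 0 and c0 = c2 = 0. *)
Definition is_lim_right (f : C -> R) (l : Rbar) : Prop :=
  forall alpha : R, (alpha < PI / 4)%R ->
    filterlim f (within (fun eta => (Rabs (Carg eta) <= alpha)%R) C_infty)
      (Rbar_locally l).

Definition is_lim_left (f : C -> R) (l : Rbar) : Prop :=
  forall alpha : R, (alpha < PI / 4)%R ->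
    filterlim f (within (fun eta => (Rabs (Carg (- eta)) <= alpha)%R) C_infty)
      (Rbar_locally l).

(* Main.v *)
(** Each [psi] solves Weber's equation [psi'' = (z^2 - 2 - mu) psi].  If [F] is a
    primitive of [psi], then [Upsilon_i = ((z^2 - mu) (F - F(eta_star)) - psi') / 2],
    so up to the factor [-1/2] the quotient in question is
    [B = E - psi' / (z^2 - mu)] with [E] a primitive of [psi = c1 psi1 + c2 psi2].

    The ladder functions [P = psi' + z psi] and [Q = psi' - z psi] satisfy
    [P' = z P + O(1/z)(P, Q)] and [Q' = - z Q + O(1/z)(P, Q)].  Along every ray
    [x + s w] with [|arg w| < pi/4] the cone [|Q| < |P|] is therefore invariant, and [|P|]
    grows faster than any power in it; as [B' ~ 2 z P / (z^2 - mu)^2], one gets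
    [B ~ 2 P / (z^2 - mu)^2].  The rays issued from a single large real [x] fill
    the sector near infinity, so the growth is uniform there.

    Otherwise [|P| <= |Q|] eventually on both real half-lines, and [psi] decays rapidly
    on the real line.  Applying [psi |-> P] repeatedly lowers [mu] by [2] and keeps the
    decay; once [Re mu < -2], convexity of [|psi|^2] forces the function to vanish, and
    one climbs back to [psi = 0] unless [mu = 2n - 1].

    For [mu = -1] the remaining case is [psi = c1 exp (- z^2 / 2)], where [B] has finite
    limits in the two sectors, which differ because the Gaussian integral is nonzero. *)

(* The integrals in [Upsilon_of] are never estimated. Weber's equation turns them into boundary
   terms as soon as [psi] has an entire primitive. To find one, [psi], which is given as a Kummer
   series times an exponential, is identified with the power series solution with the same Cauchy
   data at 0, and that series is integrated termwise. These data are [(c1, c2)] for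
   [c1 psi1 + c2 psi2], while [eta_star] and [c0] only shift the primitive by a constant; so the
   theorem is about solutions with nonzero data, whatever the other constants are.

   The obstacle is uniformity in the sector, with no asymptotics of Kummer's function at hand.
   Growth and decay are derived from monotone real functions along rays: dominance is tested at one
   real point [x], and the constants found from there do not depend on the direction. To integrate
   [B'] without losing its leading term, [2 P / (z^2 - mu)^2] is subtracted first; the rest has
   derivative [O(P / z^5)], and the growth of [P] keeps its integral below the subtracted term of
   size [P / z^4]. *)
Require Import Defs.
From Stdlib Require Import Reals Lra Lia Psatz Classical Factorial.
From Coquelicot Require Import Coquelicot.

Local Open Scope C_scope.

(** * Complex derivatives *)

Notation is_Cderive f z l :=
  (is_derive (K := C_AbsRing) (V := AbsRing_NormedModule C_AbsRing) f z l).
Notation is_path_derive p t v :=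
  (is_derive (K := R_AbsRing) (V := C_R_NormedModule) p t v).

Lemma is_Cderive_mult (f g : C -> C) (z df dg : C) :
  is_Cderive f z df -> is_Cderive g z dg ->
  is_Cderive (fun x => f x * g x) z (df * g z + f z * dg).
Proof.
intros Hf Hg; apply (is_derive_mult (K := C_AbsRing) f g z df dg Hf Hg).
exact Cmult_comm.
Qed.

Lemma is_Cderive_plus (f g : C -> C) (z df dg : C) :
  is_Cderive f z df -> is_Cderive g z dg ->
  is_Cderive (fun x => f x + g x) z (df + dg).
Proof. exact (is_derive_plus (K := C_AbsRing) (V := AbsRing_NormedModule C_AbsRing) f g z df dg). Qed.

Lemma is_Cderive_comp (f g : C -> C) (z df dg : C) :
  is_Cderive f (g z) df -> is_Cderive g z dg ->
  is_Cderive (fun x => f (g x)) z (dg * df).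
Proof. exact (is_derive_comp (K := C_AbsRing) (V := AbsRing_NormedModule C_AbsRing) f g z df dg). Qed.

Lemma is_Cderive_id (z : C) : is_Cderive (fun x : C => x) z (1:C).
Proof. exact (is_derive_id (K := C_AbsRing) z). Qed.

Lemma is_Cderive_const (c z : C) : is_Cderive (fun _ : C => c) z (0:C).
Proof. exact (is_derive_const (K := C_AbsRing) (V := AbsRing_NormedModule C_AbsRing) c z). Qed.

Lemma sub_Cplus_cancel (x y : C) : x + (y - x) = y.
Proof. ring. Qed.

Lemma is_Cderive_spec (f : C -> C) (z l : C) :
  is_Cderive f z l <->
  forall eps : posreal, exists delta : posreal, forall h : C, (Cmod h < delta)%R ->
    (Cmod (f (z + h)%C - f z - h * l) <= eps * Cmod h)%R.
Proof.
split.
- intros [_ Hf] eps.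
  destruct (Hf z (fun P H => H) eps) as [delta H].
  exists delta; intros h Hh.
  assert (E : z + h - z = h) by ring.
  specialize (H (z + h)).
  change ((Cmod ((z + h) - z) < delta)%R -> (Cmod ((f (z + h)%C - f z) - (z + h - z) * l) <= eps * Cmod (z + h - z))%R) in H.
  rewrite E in H. auto.
- intros H; split.
  + apply (is_linear_scal_l (K := C_AbsRing)).
  + intros x Hx eps.
    apply (is_filter_lim_locally_unique (K := C_AbsRing) (V := AbsRing_NormedModule C_AbsRing)) in Hx.
    subst x. destruct (H eps) as [delta Hd]. exists delta.
    intros y Hy. change (Cmod (y - z) < delta)%R in Hy.
    specialize (Hd _ Hy). rewrite sub_Cplus_cancel in Hd. exact Hd.
Qed.

(** Multiplication by [l] is also linear over the reals, and the estimate of [is_Cderive_spec] reads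
    the same over both fields. This is the passage from holomorphic functions to real paths. *)
Lemma is_path_derive_comp (f : C -> C) (p : R -> C) (t : R) (l v : C) :
  is_Cderive f (p t) l -> is_path_derive p t v ->
  is_path_derive (fun s => f (p s)) t (l * v).
Proof.
intros Hf Hp. rewrite is_Cderive_spec in Hf.
assert (HfR : filterdiff (K := R_AbsRing) (U := C_R_NormedModule) (V := C_R_NormedModule)
  f (locally (p t)) (fun y : C => (y * l))).
{ split.
  - split; [| |exists (Cmod l + 1)%R; split].
    + intros x y. apply Cmult_plus_distr_r.
    + intros k x. rewrite !scal_R_Cmult. symmetry. apply Cmult_assoc.
    + pose proof (Cmod_ge_0 l); lra.
    + intros x. rewrite <- !Cmod_norm, Cmod_mult.
      pose proof (Cmod_ge_0 x); pose proof (Cmod_ge_0 l); nra.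
  - intros x Hx eps.
    apply (is_filter_lim_locally_unique (V := C_R_NormedModule)) in Hx. subst x.
    destruct (Hf eps) as [delta Hd].
    rewrite locally_C. exists delta. intros y Hy.
    change (Cmod (y - p t) < delta)%R in Hy.
    specialize (Hd _ Hy). rewrite sub_Cplus_cancel in Hd.
    rewrite <- !Cmod_norm. exact Hd. }
pose proof (filterdiff_comp' (K := R_AbsRing) (U := R_NormedModule) (V := C_R_NormedModule) (W := C_R_NormedModule) _ _ t _ _ Hp HfR) as H.
eapply filterdiff_ext_lin. exact H.
intros y. simpl. rewrite !scal_R_Cmult. ring.
Qed.

Lemma is_Cderive_C_derive (f : C -> C) (z l : C) :
  is_Cderive f z l -> C_derive f z = l.
Proof.
intros Hf. rewrite is_Cderive_spec in Hf.
apply is_C_derive_unique. split.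
- apply (is_linear_scal_l (K := C_AbsRing)(V := C_NormedModule)).
- intros x Hx eps.
    apply (is_filter_lim_locally_unique (V := AbsRing_NormedModule C_AbsRing)) in Hx. subst x.
    destruct (Hf eps) as [delta Hd]. exists delta. intros y Hy.
    change (Cmod (y - z) < delta)%R in Hy.
    specialize (Hd _ Hy). rewrite sub_Cplus_cancel in Hd.
    exact Hd.
Qed.
(** The inverse, power series and the exponential are all differentiated through an explicit
    quadratic remainder. *)
Lemma is_Cderive_quad (f : C -> C) (z l : C) (K : R) (delta : posreal) :
  (forall h : C, (Cmod h < delta)%R ->
    (Cmod (f (z + h)%C - f z - h * l) <= K * Cmod h ^ 2)%R) ->
  is_Cderive f z l.
Proof.
intros H; apply is_Cderive_spec; intros eps.
assert (HK : (0 < Rabs K + 1)%R) by (pose proof (Rabs_pos K); lra).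
assert (Hd : (0 < Rmin delta (eps / (Rabs K + 1)))%R).
{ apply Rmin_glb_lt; [apply cond_pos|apply Rdiv_lt_0_compat; [apply cond_pos|easy]]. }
exists (mkposreal _ Hd); intros h Hh; simpl in Hh.
eapply Rle_trans; [apply H, (Rlt_le_trans _ _ _ Hh), Rmin_l|].
assert (H2 : (Cmod h < eps / (Rabs K + 1))%R) by (apply (Rlt_le_trans _ _ _ Hh), Rmin_r).
apply (Rmult_lt_compat_r _ _ _ HK) in H2.
replace (eps / (Rabs K + 1) * (Rabs K + 1))%R with (pos eps) in H2 by (field; lra).
pose proof (Cmod_ge_0 h). pose proof (Rle_abs K).
replace (K * Cmod h ^ 2)%R with ((K * Cmod h) * Cmod h)%R by ring.
apply Rmult_le_compat_r; nra.
Qed.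

Lemma is_Cderive_inv (z : C) : z <> 0 -> is_Cderive Cinv z (- / (z * z)).
Proof.
intros Hz. pose proof (proj1 (Cmod_gt_0 z) Hz) as Hm.
assert (Hd : (0 < Cmod z / 2)%R) by lra.
apply (is_Cderive_quad _ _ _ (2 / Cmod z ^ 3) (mkposreal _ Hd)).
intros h Hh; simpl in Hh.
assert (Hzh : (Cmod z / 2 <= Cmod (z + h))%R).
{ pose proof (Cmod_triangle (z + h) (- h)) as H. rewrite Cmod_opp in H.
  replace (z + h + - h) with z in H by ring. lra. }
assert (Hzh0 : z + h <> 0) by (intros E; rewrite E, Cmod_0 in Hzh; lra).
(* The remainder is exactly [h^2 / (z^2 (z + h))], and [|z + h| >= |z| / 2]. *)
replace (/ (z + h) - / z - h * - / (z * z)) with (h ^ 2 / (z ^ 2 * (z + h))) by (field; auto).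
assert (Hz2 : z ^ 2 * (z + h) <> 0) by (apply Cmult_neq_0; [now apply Cpow_nz|easy]).
rewrite Cmod_div, Cmod_mult, !Cmod_pow by easy.
set (m := Cmod z) in *. set (k := Cmod (z + h)) in *.
replace (2 / m ^ 3)%R with (/ (m ^ 2 * (m / 2)))%R by (field; lra).
unfold Rdiv at 1. rewrite Rmult_comm. apply Rmult_le_compat_r; [apply pow2_ge_0|].
apply Rinv_le_contravar; [apply Rmult_lt_0_compat; nra|].
apply Rmult_le_compat_l; nra.
Qed.

(** * Paths in the complex plane *)

Lemma is_path_derive_Re (p : R -> C) (t : R) (v : C) :
  is_path_derive p t v -> is_derive (fun s => Re (p s)) t (Re v).
Proof.
intros H.
eapply filterdiff_ext_lin.
- eapply (filterdiff_comp' (K := R_AbsRing) (V := C_R_NormedModule) (W := R_NormedModule) p fst t); [exact H|].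
  apply filterdiff_linear, is_linear_fst.
- reflexivity.
Qed.

Lemma is_path_derive_Im (p : R -> C) (t : R) (v : C) :
  is_path_derive p t v -> is_derive (fun s => Im (p s)) t (Im v).
Proof.
intros H.
eapply filterdiff_ext_lin.
- eapply (filterdiff_comp' (K := R_AbsRing) (V := C_R_NormedModule) (W := R_NormedModule) p snd t); [exact H|].
  apply filterdiff_linear, is_linear_snd.
- reflexivity.
Qed.

Lemma is_path_derive_pair (p : R -> C) (t : R) (v : C) :
  is_derive (fun s => Re (p s)) t (Re v) -> is_derive (fun s => Im (p s)) t (Im v) ->
  is_path_derive p t v.
Proof.
intros H1 H2.
apply (is_derive_ext (K := R_AbsRing) (V := C_R_NormedModule) (fun s => (Re (p s), Im (p s)))).
{ intros s; now destruct (p s). }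
apply (filterdiff_ext_lin (K := R_AbsRing) (V := C_R_NormedModule) _ (fun y : R => (scal y (Re v), scal y (Im v)))).
2:{ intros y; now destruct v. }
apply (filterdiff_comp'_2 (K := R_AbsRing) (fun s => Re (p s)) (fun s => Im (p s)) (fun a b => (a, b) : C_R_NormedModule) t _ _ (fun a b => (a, b) : C_R_NormedModule) H1 H2).
apply filterdiff_linear.
split; [| |exists 1%R; split; [lra|]].
- now intros [x1 x2] [y1 y2].
- now intros k [x1 x2].
- intros [x1 x2]; rewrite Rmult_1_l; apply Rle_refl.
Qed.

Lemma is_path_derive_line (a w : C) (t : R) :
  is_path_derive (fun s : R => a + s * w) t w.
Proof.
apply is_path_derive_pair; destruct a as [a1 a2], w as [w1 w2]; unfold Re, Im, Cplus, Cmult, RtoC, fst, snd; auto_derive; auto; apply Rmult_1_l.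
Qed.

Definition cdot (a b : C) : R := (Re a * Re b + Im a * Im b)%R.

Lemma cdot_self (a : C) : cdot a a = (Cmod a ^ 2)%R.
Proof. rewrite Cmod2_alt; unfold cdot; ring. Qed.

Lemma cdot_le (a b : C) : (Rabs (cdot a b) <= Cmod a * Cmod b)%R.
Proof.
rewrite <- (Cmod_conj a), <- Cmod_mult.
replace (cdot a b) with (Re (Cconj a * b)) by (unfold cdot, Cconj, Cmult, Re, Im, fst, snd; ring).
apply re_le_Cmod.
Qed.

Lemma is_derive_Cmod2 (p : R -> C) (t : R) (v : C) :
  is_path_derive p t v ->
  is_derive (fun s => (Cmod (p s) ^ 2)%R) t (2 * cdot (p t) v)%R.
Proof.
intros H.
apply (is_derive_ext (fun s => (Re (p s) * Re (p s) + Im (p s) * Im (p s))%R)).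
{ intros s; now rewrite <- cdot_self. }
pose proof (is_path_derive_Re _ _ _ H) as H1. pose proof (is_path_derive_Im _ _ _ H) as H2.
evar_last.
apply (is_derive_plus (K := R_AbsRing) (V := R_NormedModule)).
apply (is_derive_mult (K := R_AbsRing)); [exact H1|exact H1|exact Rmult_comm].
apply (is_derive_mult (K := R_AbsRing)); [exact H2|exact H2|exact Rmult_comm].
unfold cdot, plus, mult; simpl; ring.
Qed.

Lemma is_derive_Cmod (p : R -> C) (t : R) (v : C) :
  p t <> 0 -> is_path_derive p t v ->
  is_derive (fun s => Cmod (p s)) t (cdot (p t) v / Cmod (p t))%R.
Proof.
intros H0 H. apply Cmod_gt_0 in H0.
apply (is_derive_ext (fun s => sqrt (Cmod (p s) ^ 2))).
{ intros s. apply sqrt_pow2, Cmod_ge_0. }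
assert (Hs : is_derive sqrt (Cmod (p t) ^ 2)%R (/ (2 * sqrt (Cmod (p t) ^ 2)))%R).
{ apply is_derive_Reals, derivable_pt_lim_sqrt, pow_lt, H0. }
pose proof (is_derive_comp sqrt (fun s => (Cmod (p s) ^ 2)%R) t _ _ Hs (is_derive_Cmod2 p t v H)) as Hc.
replace (cdot (p t) v / Cmod (p t))%R
  with (scal (2 * cdot (p t) v)%R (/ (2 * sqrt (Cmod (p t) ^ 2)))%R); [exact Hc|].
rewrite sqrt_pow2 by lra. unfold scal; simpl; unfold mult; simpl. field; lra.
Qed.

Lemma nondecreasing_of_derive (f df : R -> R) (a b : R) :
  (a <= b)%R ->
  (forall x, (a <= x <= b)%R -> is_derive f x (df x) /\ (0 <= df x)%R) ->
  (f a <= f b)%R.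
Proof.
intros Hab H.
destruct (MVT_gen f a b df) as [c [Hc E]].
- intros x Hx. rewrite Rmin_left, Rmax_right in Hx by easy. apply H; lra.
- intros x Hx. rewrite Rmin_left, Rmax_right in Hx by easy.
  apply derivable_continuous_pt. exists (df x). apply is_derive_Reals, H, Hx.
- rewrite Rmin_left, Rmax_right in Hc by easy.
  destruct (H c Hc) as [_ Hp].
  assert (0 <= df c * (b - a))%R by (apply Rmult_le_pos; lra). lra.
Qed.

(** Pairing with the increment [d = p b - p a] reduces the complex case to a real one:
    [Cmod d * g - cdot d p] is nondecreasing, and no constant is lost. *)
Lemma mean_value_path (p v : R -> C) (g dg : R -> R) (a b : R) :
  (a <= b)%R ->
  (forall x, (a <= x <= b)%R -> is_path_derive p x (v x) /\ is_derive g x (dg x) /\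
     (Cmod (v x) <= dg x)%R) ->
  (Cmod (p b - p a) <= g b - g a)%R.
Proof.
intros Hab H.
set (d := p b - p a).
destruct (Req_dec (Cmod d) 0) as [E|E].
- rewrite E.
  assert (g a <= g b)%R; [|lra].
  apply nondecreasing_of_derive with dg; [easy|].
  intros x Hx; destruct (H x Hx) as (_ & H1 & H2); split; [easy|].
  pose proof (Cmod_ge_0 (v x)); lra.
- assert (Hd : (0 < Cmod d)%R) by (pose proof (Cmod_ge_0 d); lra).
  assert (Hm : ((Cmod d * g a - cdot d (p a)) <= (Cmod d * g b - cdot d (p b)))%R).
  { apply (nondecreasing_of_derive (fun x => (Cmod d * g x - cdot d (p x))%R)
      (fun x => (Cmod d * dg x - cdot d (v x))%R)); [easy|].
    intros x Hx; destruct (H x Hx) as (H0 & H1 & H2); split.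
    - pose proof (is_path_derive_Re _ _ _ H0) as HR. pose proof (is_path_derive_Im _ _ _ H0) as HI.
      apply (is_derive_minus (K := R_AbsRing) (V := R_NormedModule)).
      + apply is_derive_scal, H1.
      + unfold cdot. apply (is_derive_plus (K := R_AbsRing) (V := R_NormedModule)); apply is_derive_scal; easy.
    - pose proof (cdot_le d (v x)). pose proof (Rle_abs (cdot d (v x))).
      assert (Cmod d * Cmod (v x) <= Cmod d * dg x)%R by (apply Rmult_le_compat_l; lra). lra. }
  assert (E2 : (cdot d (p b) - cdot d (p a) = Cmod d * Cmod d)%R).
  { replace (Cmod d * Cmod d)%R with (Cmod d ^ 2)%R by ring. rewrite <- cdot_self. unfold cdot, d, Cminus, Cplus, Copp, Re, Im, fst, snd; ring. }
  apply Rmult_le_reg_l with (Cmod d); [easy|]. lra.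
Qed.

(** * Weber's equation and the invariant cone *)

Definition weber (mu : C) (psi dpsi : C -> C) : Prop :=
  forall z : C, is_Cderive psi z (dpsi z) /\
    is_Cderive dpsi z ((z ^ 2 - 2 - mu) * psi z).

(** The operator [d/dz + z] annihilates [exp (- z^2 / 2)], so this function detects the growing part
    of a solution; [ladder_down] annihilates [exp (z^2 / 2)] and detects the decaying part. *)
Definition ladder_up (psi dpsi : C -> C) (z : C) : C := dpsi z + z * psi z.

Definition ladder_down (psi dpsi : C -> C) (z : C) : C := dpsi z - z * psi z.

Lemma is_Cderive_opp (f : C -> C) (z df : C) :
  is_Cderive f z df -> is_Cderive (fun x => - f x) z (- df).
Proof. exact (is_derive_opp (K := C_AbsRing) (V := AbsRing_NormedModule C_AbsRing) f z df). Qed.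

Lemma is_Cderive_minus (f g : C -> C) (z df dg : C) :
  is_Cderive f z df -> is_Cderive g z dg ->
  is_Cderive (fun x => f x - g x) z (df - dg).
Proof. exact (is_derive_minus (K := C_AbsRing) (V := AbsRing_NormedModule C_AbsRing) f g z df dg). Qed.

Lemma is_Cderive_eq (f : C -> C) (z l l' : C) :
  is_Cderive f z l -> l = l' -> is_Cderive f z l'.
Proof. now intros H <-. Qed.

Lemma is_path_derive_eq (p : R -> C) (t : R) (v v' : C) :
  is_path_derive p t v -> v = v' -> is_path_derive p t v'.
Proof. now intros H <-. Qed.

Lemma ladder_up_derive (mu : C) (psi dpsi : C -> C) (z : C) :
  weber mu psi dpsi ->
  is_Cderive (ladder_up psi dpsi) z (z * ladder_up psi dpsi z - (1 + mu) * psi z).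
Proof.
intros H; destruct (H z) as [H1 H2].
eapply is_Cderive_eq.
- apply is_Cderive_plus; [exact H2|apply is_Cderive_mult; [apply is_Cderive_id|exact H1]].
- unfold ladder_up; ring.
Qed.

Lemma ladder_down_derive (mu : C) (psi dpsi : C -> C) (z : C) :
  weber mu psi dpsi ->
  is_Cderive (ladder_down psi dpsi) z (- (z * ladder_down psi dpsi z) - (3 + mu) * psi z).
Proof.
intros H; destruct (H z) as [H1 H2].
eapply is_Cderive_eq.
- apply is_Cderive_minus; [exact H2|apply is_Cderive_mult; [apply is_Cderive_id|exact H1]].
- unfold ladder_down; ring.
Qed.

Lemma ladder_bound (psi dpsi : C -> C) (z : C) :
  (2 * Cmod z * Cmod (psi z) <= Cmod (ladder_up psi dpsi z) + Cmod (ladder_down psi dpsi z))%R.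
Proof.
replace (2 * Cmod z * Cmod (psi z))%R with (Cmod (2 * z * psi z)).
- replace (2 * z * psi z) with (ladder_up psi dpsi z + - ladder_down psi dpsi z)
    by (unfold ladder_up, ladder_down; ring).
  rewrite <- (Cmod_opp (ladder_down psi dpsi z)). apply Cmod_triangle.
- rewrite !Cmod_mult, Cmod_R, Rabs_pos_eq; lra.
Qed.

(** [w] is the direction of a ray [z = x + s w]. The two lower bounds make [Re (w z)], the rate at
    which [z^2 / 2] grows along the ray, at least [kappa (x + s)]. *)
Definition steep (kappa : R) (w : C) : Prop :=
  Cmod w = 1%R /\ (kappa <= Re w)%R /\ (kappa <= Re (w ^ 2))%R.

Lemma steep_ray (kappa x s : R) (w : C) :
  steep kappa w -> (0 < x)%R -> (0 <= s)%R ->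
  (kappa * (x + s) <= Re (w * (x + s * w)))%R /\
  (kappa * (x + s) <= Cmod (x + s * w))%R /\
  (Cmod (x + s * w) <= x + s)%R.
Proof.
intros (H1 & H2 & H3) Hx Hs.
assert (E : Re (w * (x + s * w)) = (x * Re w + s * Re (w ^ 2))%R).
{ destruct w as [w1 w2]; unfold Re; simpl; ring. }
assert (H : (kappa * (x + s) <= Re (w * (x + s * w)))%R) by (rewrite E; nra).
split; [exact H|split].
- eapply Rle_trans; [exact H|]. eapply Rle_trans; [apply Rle_abs|].
  eapply Rle_trans; [apply re_le_Cmod|]. rewrite Cmod_mult, H1; lra.
- eapply Rle_trans; [apply Cmod_triangle|].
  rewrite Cmod_mult, !Cmod_R, H1, !Rabs_pos_eq by lra. lra.
Qed.

(** For [p' = z p - a psi] the right-hand side is half the derivative of [|p|^2] along a ray of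
    direction [w]; the factor [w] turns the main term into [Re (w z) |p|^2]. *)
Lemma cdot_rotated_lower (p psi a w z : C) (c : R) :
  Cmod w = 1%R -> (c <= Re (w * z))%R ->
  (c * Cmod p ^ 2 - Cmod p * Cmod a * Cmod psi <= cdot p ((z * p - a * psi) * w))%R.
Proof.
intros Hw Hc.
assert (E : cdot p ((z * p - a * psi) * w) = (Re (w * z) * Cmod p ^ 2 - cdot p (a * psi * w))%R).
{ rewrite <- cdot_self. unfold cdot, Cminus, Cplus, Copp, Cmult, Re, Im, fst, snd; ring. }
pose proof (cdot_le p (a * psi * w)) as H. rewrite !Cmod_mult, Hw in H.
pose proof (Rle_abs (cdot p (a * psi * w))).
assert (c * Cmod p ^ 2 <= Re (w * z) * Cmod p ^ 2)%R by (apply Rmult_le_compat_r; [apply pow2_ge_0|easy]).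
rewrite E; lra.
Qed.

Lemma cdot_rotated_upper (q psi a w z : C) (c : R) :
  Cmod w = 1%R -> (c <= Re (w * z))%R ->
  (cdot q ((- (z * q) - a * psi) * w) <= - c * Cmod q ^ 2 + Cmod q * Cmod a * Cmod psi)%R.
Proof.
intros Hw Hc.
pose proof (cdot_rotated_lower q psi (- a) w z c Hw Hc) as H.
replace (cdot q ((- (z * q) - a * psi) * w)) with (- cdot q ((z * q - - a * psi) * w))%R.
- rewrite Cmod_opp in H. lra.
- unfold cdot, Cminus, Cplus, Copp, Cmult, Re, Im, fst, snd; ring.
Qed.

(** Here [p], [q], [m] stand for the moduli of [ladder_up], [ladder_down], [psi], and [a], [b] for
    those of [1 + mu], [3 + mu]. The main terms give [2 c (p^2 + q^2)]; since [2 c m <= p + q], the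
    errors consume at most half of it. *)
Lemma cone_estimate (a b p q m c : R) :
  (0 <= a -> 0 <= b -> 0 <= p -> 0 <= q -> 0 < c -> 2 * (a + b) <= c ^ 2 ->
   2 * c * m <= p + q -> 0 <= m ->
   c * (p ^ 2 + q ^ 2) <= 2 * (c * p ^ 2 - p * a * m) - 2 * (- c * q ^ 2 + q * b * m))%R.
Proof.
intros Ha Hb Hp Hq Hc H1 H2 Hm.
assert (Hpa : (p * a + q * b <= (a + b) * (p + q))%R) by nra.
assert (H3 : ((p * a + q * b) * m <= (a + b) * (p + q) * m)%R) by (apply Rmult_le_compat_r; easy).
assert (H4 : (2 * c * ((a + b) * (p + q) * m) <= (a + b) * (p + q) ^ 2)%R).
{ replace (2 * c * ((a + b) * (p + q) * m))%R with ((a + b) * (p + q) * (2 * c * m))%R by ring.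
  replace ((a + b) * (p + q) ^ 2)%R with ((a + b) * (p + q) * (p + q))%R by ring.
  apply Rmult_le_compat_l; [|easy]. apply Rmult_le_pos; lra. }
assert (H5 : ((a + b) * (p + q) ^ 2 <= c ^ 2 * (p ^ 2 + q ^ 2))%R).
{ assert ((p + q) ^ 2 <= 2 * (p ^ 2 + q ^ 2))%R by (pose proof (pow2_ge_0 (p - q)); lra).
  assert ((a + b) * (p + q) ^ 2 <= (a + b) * (2 * (p ^ 2 + q ^ 2)))%R by (apply Rmult_le_compat_l; lra).
  assert (2 * (a + b) * (p ^ 2 + q ^ 2) <= c ^ 2 * (p ^ 2 + q ^ 2))%R.
  { apply Rmult_le_compat_r; [|easy]. pose proof (pow2_ge_0 p); pose proof (pow2_ge_0 q); lra. }
  lra. }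
assert (H6 : (2 * ((p * a + q * b) * m) <= c * (p ^ 2 + q ^ 2))%R).
{ apply Rmult_le_reg_l with c; [easy|].
  assert (c * ((p * a + q * b) * m) <= c * ((a + b) * (p + q) * m))%R by (apply Rmult_le_compat_l; lra).
  lra. }
lra.
Qed.

Lemma cone_estimate_up (a b p q m c : R) :
  (0 <= a -> 0 <= b -> 0 <= p -> q <= p -> 0 < c -> 2 * (a + b) <= c ^ 2 ->
   2 * c * m <= p + q -> 0 <= m ->
   c / 2 * p ^ 2 <= c * p ^ 2 - p * a * m)%R.
Proof.
intros Ha Hb Hp Hq Hc H1 H2 Hm.
assert (H3 : (c * m <= p)%R) by lra.
assert (H4 : (p * a * (c * m) <= p * a * p)%R) by (apply Rmult_le_compat_l; [apply Rmult_le_pos|]; lra).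
assert (H5 : (a * p ^ 2 <= c ^ 2 / 2 * p ^ 2)%R) by (apply Rmult_le_compat_r; [apply pow2_ge_0|lra]).
apply Rmult_le_reg_l with c; [easy|].
lra.
Qed.

Lemma is_path_derive_ray (f : C -> C) (x w l : C) (t : R) :
  is_Cderive f (x + t * w) l -> is_path_derive (fun s : R => f (x + s * w)) t (l * w).
Proof.
intros H. apply (is_path_derive_comp f (fun s : R => x + s * w)); [exact H|apply is_path_derive_line].
Qed.

(** The difference [|P|^2 - |Q|^2] is nondecreasing along the whole ray, inside the cone or not, so
    invariance of the cone needs no first exit time. The largeness condition at [x] persists because
    [kappa (x + s)] increases with [s]. *)
Lemma cone_growth (mu : C) (psi dpsi : C -> C) (kappa x s : R) (w : C) :
  weber mu psi dpsi -> (0 < kappa)%R -> (0 < x)%R ->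
  (2 * (Cmod (1 + mu) + Cmod (3 + mu)) <= (kappa * x) ^ 2)%R ->
  steep kappa w ->
  (Cmod (ladder_down psi dpsi x) < Cmod (ladder_up psi dpsi x))%R ->
  (0 <= s)%R ->
  let z := x + s * w in
  let up := ladder_up psi dpsi in
  (Cmod (ladder_down psi dpsi z) <= Cmod (up z))%R /\
  up z <> 0 /\
  (kappa / 2 * (x + s) * Cmod (up z) ^ 2 <= cdot (up z) ((z * up z - (1 + mu) * psi z) * w))%R.
Proof.
intros HW Hk Hx Hbig Hw Hini Hs z up.
set (down := ladder_down psi dpsi).
assert (key : forall t, (0 <= t)%R ->
  let y := x + t * w in
  (0 <= kappa * (x + t) * (Cmod (up y) ^ 2 + Cmod (down y) ^ 2) <=
   2 * cdot (up y) ((y * up y - (1 + mu) * psi y) * w)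
   - 2 * cdot (down y) ((- (y * down y) - (3 + mu) * psi y) * w))%R /\
  ((Cmod (down y) <= Cmod (up y))%R ->
   (kappa / 2 * (x + t) * Cmod (up y) ^ 2 <= cdot (up y) ((y * up y - (1 + mu) * psi y) * w))%R)).
{ intros t Ht y.
  destruct (steep_ray kappa x t w Hw Hx Ht) as (R1 & R2 & R3). fold y in R1, R2, R3.
  pose proof (ladder_bound psi dpsi y) as Hb. fold up down in Hb.
  pose proof (Cmod_ge_0 (up y)). pose proof (Cmod_ge_0 (down y)). pose proof (Cmod_ge_0 (psi y)).
  pose proof (Cmod_ge_0 (1 + mu)). pose proof (Cmod_ge_0 (3 + mu)).
  assert (Hc : (0 < kappa * (x + t))%R) by (apply Rmult_lt_0_compat; lra).
  assert (Hc2 : (2 * (Cmod (1 + mu) + Cmod (3 + mu)) <= (kappa * (x + t)) ^ 2)%R).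
  { eapply Rle_trans; [exact Hbig|]. apply pow_incr. split; [apply Rmult_le_pos|apply Rmult_le_compat_l]; lra. }
  assert (Hm : (2 * (kappa * (x + t)) * Cmod (psi y) <= Cmod (up y) + Cmod (down y))%R).
  { eapply Rle_trans; [|exact Hb]. apply Rmult_le_compat_r; lra. }
  destruct Hw as (Hw1 & _).
  pose proof (cdot_rotated_lower (up y) (psi y) (1 + mu) w y _ Hw1 R1) as L1.
  pose proof (cdot_rotated_upper (down y) (psi y) (3 + mu) w y _ Hw1 R1) as L2.
  split; [split|].
  - apply Rmult_le_pos; [lra|]. pose proof (pow2_ge_0 (Cmod (up y))). pose proof (pow2_ge_0 (Cmod (down y))). lra.
  - pose proof (cone_estimate (Cmod (1 + mu)) (Cmod (3 + mu)) (Cmod (up y)) (Cmod (down y)) (Cmod (psi y)) (kappa * (x + t))). lra.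
  - intros Hle.
    pose proof (cone_estimate_up (Cmod (1 + mu)) (Cmod (3 + mu)) (Cmod (up y)) (Cmod (down y)) (Cmod (psi y)) (kappa * (x + t))).
    replace (kappa / 2 * (x + t))%R with (kappa * (x + t) / 2)%R by field. lra. }
assert (mono : (Cmod (up x) ^ 2 - Cmod (down x) ^ 2 <= Cmod (up z) ^ 2 - Cmod (down z) ^ 2)%R).
{ pose (ray := fun t : R => x + t * w).
  replace (x : C) with (ray 0%R) by (unfold ray; ring).
  apply (nondecreasing_of_derive
    (fun t => Cmod (up (ray t)) ^ 2 - Cmod (down (ray t)) ^ 2)%R
    (fun t => 2 * cdot (up (ray t)) ((ray t * up (ray t) - (1 + mu) * psi (ray t)) * w)
       - 2 * cdot (down (ray t)) ((- (ray t * down (ray t)) - (3 + mu) * psi (ray t)) * w))%R 0 s Hs).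
  intros t Ht. split.
  - apply (is_derive_minus (K := R_AbsRing) (V := R_NormedModule)); apply is_derive_Cmod2.
    + apply (is_path_derive_ray up), ladder_up_derive, HW.
    + apply (is_path_derive_ray down), ladder_down_derive, HW.
  - destruct (key t (proj1 Ht)) as [K _]. cbv zeta in K. unfold ray. lra. }
fold up down in Hini.
assert (Hini2 : (0 < Cmod (up x) ^ 2 - Cmod (down x) ^ 2)%R).
{ pose proof (Cmod_ge_0 (down x)). nra. }
assert (Hle : (Cmod (down z) <= Cmod (up z))%R).
{ pose proof (Cmod_ge_0 (down z)). pose proof (Cmod_ge_0 (up z)). nra. }
split; [exact Hle|split].
- intros E. rewrite E, Cmod_0 in mono. pose proof (pow2_ge_0 (Cmod (down z))). lra.
- apply (key s Hs), Hle.
Qed.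

(** * Growth of the quotient along rays *)

Definition reduced (mu : C) (prim dpsi : C -> C) (z : C) : C :=
  prim z - dpsi z * / (z ^ 2 - mu).

Definition corrected (mu : C) (prim psi dpsi : C -> C) (z : C) : C :=
  reduced mu prim dpsi z - 2 * ladder_up psi dpsi z * (/ (z ^ 2 - mu)) ^ 2.

Lemma is_Cderive_sqr (z : C) : is_Cderive (fun x : C => x ^ 2) z (2 * z).
Proof.
apply (is_derive_ext (K := C_AbsRing) (V := AbsRing_NormedModule C_AbsRing) (fun x : C => x * x)).
{ intros t; simpl. now rewrite Cmult_1_r. }
eapply is_Cderive_eq; [apply is_Cderive_mult; apply is_Cderive_id|cbv beta; ring].
Qed.

Lemma is_Cderive_inv_quadratic (mu z : C) : z ^ 2 - mu <> 0 ->
  is_Cderive (fun x : C => / (x ^ 2 - mu)) z (- (2 * z) * (/ (z ^ 2 - mu)) ^ 2).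
Proof.
intros Hz.
eapply is_Cderive_eq.
- apply (is_Cderive_comp Cinv (fun x : C => x ^ 2 - mu)); [apply is_Cderive_inv, Hz|].
  apply is_Cderive_minus; [apply is_Cderive_sqr|apply is_Cderive_const].
- cbv beta. field. exact Hz.
Qed.

(* In the derivative of [reduced] the terms [2 psi / q] and [2 z dpsi / q^2],
   q = z^2 - mu, combine to leading order [2 z ladder_up / q^2], which is
   integrated approximately by [2 ladder_up / q^2]. *)
Lemma corrected_derive (mu : C) (prim psi dpsi : C -> C) (z : C) :
  weber mu psi dpsi -> is_Cderive prim z (psi z) -> z ^ 2 - mu <> 0 ->
  is_Cderive (corrected mu prim psi dpsi) z
    (2 * psi z / (z ^ 2 - mu) ^ 2
     + 8 * z * ladder_up psi dpsi z / (z ^ 2 - mu) ^ 3).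
Proof.
intros HW HE Hz.
pose proof (is_Cderive_inv_quadratic mu z Hz) as Hi.
pose proof (ladder_up_derive mu psi dpsi z HW) as Hup.
destruct (HW z) as [H1 H2].
assert (Hi2 : is_Cderive (fun x : C => (/ (x ^ 2 - mu)) ^ 2) z
  (2 * / (z ^ 2 - mu) * (- (2 * z) * (/ (z ^ 2 - mu)) ^ 2))).
{ apply (is_derive_ext (K := C_AbsRing) (V := AbsRing_NormedModule C_AbsRing)
    (fun x : C => / (x ^ 2 - mu) * / (x ^ 2 - mu))).
  { intros t; simpl. now rewrite !Cmult_1_r. }
  eapply is_Cderive_eq; [apply is_Cderive_mult; exact Hi|cbv beta; ring]. }
unfold corrected, reduced.
eapply is_Cderive_eq.
- apply is_Cderive_minus.
  + apply is_Cderive_minus; [exact HE|].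
    apply is_Cderive_mult; [exact H2|exact Hi].
  + apply is_Cderive_mult; [|exact Hi2].
    apply is_Cderive_mult; [apply is_Cderive_const|exact Hup].
- unfold ladder_up. field. exact Hz.
Qed.

Lemma Cmod_quadratic_bounds (mu z : C) (kappa r : R) :
  (0 < kappa <= 1)%R -> (0 < r)%R -> (kappa * r <= Cmod z <= r)%R ->
  (2 * Cmod mu <= (kappa * r) ^ 2)%R ->
  (kappa ^ 2 * r ^ 2 / 2 <= Cmod (z ^ 2 - mu) <= 2 * r ^ 2)%R.
Proof.
intros Hk Hr Hz Hmu.
assert (H1 : (Cmod (z ^ 2) <= Cmod (z ^ 2 - mu) + Cmod mu)%R).
{ replace (z ^ 2) with (z ^ 2 - mu + mu) at 1 by ring. apply Cmod_triangle. }
assert (H2 : (Cmod (z ^ 2 - mu) <= Cmod (z ^ 2) + Cmod mu)%R).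
{ unfold Cminus; rewrite <- (Cmod_opp mu). apply Cmod_triangle. }
rewrite Cmod_pow in H1, H2.
assert (H3 : ((kappa * r) ^ 2 <= Cmod z ^ 2)%R) by (apply pow_incr; split; [apply Rmult_le_pos|]; lra).
assert (H4 : (Cmod z ^ 2 <= r ^ 2)%R) by (apply pow_incr; split; [apply Cmod_ge_0|lra]).
rewrite Rpow_mult_distr in *.
pose proof (Cmod_ge_0 mu).
split; lra.
Qed.

(** With [q >= kappa^2 r^2 / 2], the first term is at most [8 p / (kappa^5 r^5)] and the second at
    most [64 p / (kappa^6 r^5)]; as [kappa <= 1], the sum gives 72. *)
Lemma corrected_derive_bound (kappa r m p q mz : R) :
  (0 < kappa <= 1)%R -> (0 < r)%R -> (0 <= p)%R -> (0 <= m)%R ->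
  (kappa * r * m <= p)%R -> (mz <= r)%R -> (0 <= mz)%R ->
  (kappa ^ 2 * r ^ 2 / 2 <= q)%R ->
  (2 * m / q ^ 2 + 8 * mz * p / q ^ 3 <= 72 / kappa ^ 6 * (p / r ^ 5))%R.
Proof.
intros Hk Hr Hp Hm H1 H2 H3 Hq.
assert (Hk2 : (0 < kappa ^ 2)%R) by (apply pow_lt; lra).
assert (Hr2 : (0 < r ^ 2)%R) by (apply pow_lt; lra).
assert (Hq0 : (0 < kappa ^ 2 * r ^ 2 / 2)%R) by (pose proof (Rmult_lt_0_compat _ _ Hk2 Hr2); lra).
assert (I : forall n, (/ q ^ n <= / (kappa ^ 2 * r ^ 2 / 2) ^ n)%R).
{ intros n. apply Rinv_le_contravar; [apply pow_lt, Hq0|apply pow_incr; lra]. }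
assert (J : forall n, (0 < / q ^ n)%R) by (intros n; apply Rinv_0_lt_compat, pow_lt; lra).
assert (A : (2 * m / q ^ 2 <= 8 * p / (kappa ^ 5 * r ^ 5))%R).
{ assert (Hm2 : (m <= p / (kappa * r))%R).
  { apply -> Rle_div_r; [lra|apply Rlt_gt, Rmult_lt_0_compat; lra]. }
  apply Rle_trans with (2 * (p / (kappa * r)) * / (kappa ^ 2 * r ^ 2 / 2) ^ 2)%R.
  - apply Rmult_le_compat; [lra|apply Rlt_le, J|lra|apply I].
  - apply Req_le. field. lra. }
assert (B : (8 * mz * p / q ^ 3 <= 64 * p / (kappa ^ 6 * r ^ 5))%R).
{ apply Rle_trans with (8 * r * p * / (kappa ^ 2 * r ^ 2 / 2) ^ 3)%R.
  - apply Rmult_le_compat; [|apply Rlt_le, J| |apply I].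
    + apply Rmult_le_pos; lra.
    + apply Rmult_le_compat_r; lra.
  - apply Req_le. field. lra. }
assert (A2 : (8 * p / (kappa ^ 5 * r ^ 5) <= 8 * p / (kappa ^ 6 * r ^ 5))%R).
{ apply Rmult_le_compat_l; [lra|]. apply Rinv_le_contravar.
  - apply Rmult_lt_0_compat; apply pow_lt; lra.
  - apply Rmult_le_compat_r; [apply pow_le; lra|].
    replace (kappa ^ 6)%R with (kappa * kappa ^ 5)%R by ring.
    assert (0 < kappa ^ 5)%R by (apply pow_lt; lra). nra. }
replace (72 / kappa ^ 6 * (p / r ^ 5))%R
  with (8 * p / (kappa ^ 6 * r ^ 5) + 64 * p / (kappa ^ 6 * r ^ 5))%R by (field; lra).
lra.
Qed.

Lemma is_derive_div_pow (p : R -> R) (dp x t : R) (n : nat) :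
  (x + t <> 0)%R -> is_derive p t dp ->
  is_derive (fun s => p s / (x + s) ^ n)%R t
    (dp / (x + t) ^ n - INR n * p t / (x + t) ^ S n)%R.
Proof.
intros H0 Hp.
assert (Hq : is_derive (fun s => (x + s) ^ n)%R t (INR n * (x + t) ^ pred n)%R).
{ auto_derive; [easy|ring]. }
assert (Hn : ((x + t) ^ n <> 0)%R) by now apply pow_nonzero.
evar_last; [apply (is_derive_div p _ t dp _ Hp Hq Hn)|].
destruct n as [|n].
- simpl; field; easy.
- simpl pred. simpl pow. field. split; [now apply pow_nonzero|easy].
Qed.

(** The constants [c] and [D] are fixed before [w] and [s]: this order carries the uniformity in the
    sector. *)
Lemma reduced_growth (mu : C) (prim psi dpsi : C -> C) (kappa : R) :
  weber mu psi dpsi -> (forall z, is_Cderive prim z (psi z)) -> (0 < kappa <= 1)%R ->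
  exists r0 : R, (0 < r0)%R /\ forall x : R, (r0 <= x)%R ->
    (Cmod (ladder_down psi dpsi x) < Cmod (ladder_up psi dpsi x))%R ->
    exists c D : R, (0 < c)%R /\ forall (w : C) (s : R), steep kappa w -> (0 <= s)%R ->
      (c * (x + s) ^ 2 - D <= Cmod (reduced mu prim dpsi (x + s * w)))%R.
Proof.
intros HW HE Hk.
set (K := (72 / kappa ^ 6)%R).
assert (HK : (0 < K)%R) by (apply Rdiv_lt_0_compat; [lra|apply pow_lt; lra]).
set (S1 := (2 * (Cmod (1 + mu) + Cmod (3 + mu)))%R).
set (m := Cmod mu).
assert (HS1 : (0 <= S1)%R) by (pose proof (Cmod_ge_0 (1 + mu)); pose proof (Cmod_ge_0 (3 + mu)); unfold S1; lra).
assert (Hm : (0 <= m)%R) by apply Cmod_ge_0.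
(* One summand per requirement on [kappa * x]: 1 gives [kappa x <= (kappa x)^2], [S1] the invariant
   cone, [2 m] the dominance of [z^2] over [mu], 6 the comparison with powers in [growth] and
   [corr], [4 K] the error bound [T3]. *)
exists ((1 + S1 + 2 * m + 6 + 4 * K) / kappa)%R.
split; [apply Rdiv_lt_0_compat; lra|].
intros x Hx Hini.
assert (Hkx : (1 + S1 + 2 * m + 6 + 4 * K <= kappa * x)%R).
{ apply Rle_div_l in Hx; lra. }
assert (Hx1 : (kappa * x <= x)%R) by (assert (0 < x)%R; nra).
assert (Hx0 : (6 <= x)%R) by lra.
assert (Hkx2 : (kappa * x <= (kappa * x) ^ 2)%R) by nra.
set (up := ladder_up psi dpsi) in *.
set (p0 := Cmod (up x)).
assert (Hp0 : (0 < p0)%R) by (pose proof (Cmod_ge_0 (ladder_down psi dpsi x)); unfold p0; lra).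
(* These are the constants left at the end: [T4] produces the first, and the value of [corrected] at
   the start of the ray is the second. *)
exists (p0 / (4 * x ^ 6))%R, (Cmod (corrected mu prim psi dpsi x)).
split; [apply Rdiv_lt_0_compat; [easy|]; assert (0 < x ^ 6)%R by (apply pow_lt; lra); lra|].
intros w s Hw Hs.
pose (ray := fun t : R => x + t * w).
pose (dp := fun t : R => (cdot (up (ray t)) ((ray t * up (ray t) - (1 + mu) * psi (ray t)) * w)
   / Cmod (up (ray t)))%R).
assert (G : forall t, (0 <= t)%R ->
  (Cmod (ladder_down psi dpsi (ray t)) <= Cmod (up (ray t)))%R /\
  (0 < Cmod (up (ray t)))%R /\
  is_derive (fun t => Cmod (up (ray t))) t (dp t) /\
  (kappa / 2 * (x + t) * Cmod (up (ray t)) <= dp t)%R).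
{ intros t Ht.
  assert (HS : (2 * (Cmod (1 + mu) + Cmod (3 + mu)) <= (kappa * x) ^ 2)%R) by (fold S1; lra).
  destruct (cone_growth mu psi dpsi kappa x t w HW (proj1 Hk) ltac:(lra) HS Hw Hini Ht) as (C1 & C2 & C3).
  fold up in C1, C2, C3. fold (ray t) in C1, C2, C3.
  assert (C2' := proj1 (Cmod_gt_0 _) C2).
  split; [easy|]. split; [easy|]. split.
  - apply (is_derive_Cmod (fun t => up (ray t))); [easy|].
    apply (is_path_derive_ray up), ladder_up_derive, HW.
  - unfold dp. apply -> Rle_div_r; [|lra].
    eapply Rle_trans; [|exact C3]. apply Req_le; ring. }
(* The exponent 6 is chosen above the 4 lost in [lead], so that a factor [(x + s)^2] survives. *)
assert (growth : (p0 / x ^ 6 <= Cmod (up (ray s)) / (x + s) ^ 6)%R).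
{ replace p0 with (Cmod (up (ray 0%R))) by (unfold ray, p0; f_equal; f_equal; ring).
  replace (x ^ 6)%R with ((x + 0) ^ 6)%R by (f_equal; ring).
  apply (nondecreasing_of_derive (fun t => Cmod (up (ray t)) / (x + t) ^ 6)%R
    (fun t => (dp t / (x + t) ^ 6 - INR 6 * Cmod (up (ray t)) / (x + t) ^ 7)%R)); [easy|].
  intros t Ht. destruct (G t (proj1 Ht)) as (G1 & G2 & G3 & G4).
  split; [apply (is_derive_div_pow (fun t => Cmod (up (ray t)))); [lra|easy]|].
  set (p := Cmod (up (ray t))) in *.
  assert (Hr : (0 < (x + t) ^ 7)%R) by (apply pow_lt; lra).
  replace (dp t / (x + t) ^ 6 - INR 6 * p / (x + t) ^ 7)%R
    with ((dp t * (x + t) - 6 * p) / (x + t) ^ 7)%R by (simpl INR; field; lra).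
  apply -> Rle_div_r; [|easy]. rewrite Rmult_0_l.
  assert (kappa * x <= kappa * (x + t))%R by (apply Rmult_le_compat_l; lra).
  assert (1 * p <= (kappa / 2 * (x + t)) * p)%R by (apply Rmult_le_compat_r; lra).
  assert (p * 6 <= dp t * (x + t))%R by (apply Rmult_le_compat; lra). lra. }
(* The majorant [K p / (x + t)^5] of the derivative serves as its own primitive: [p' >= 3 p], so its
   derivative is at least itself. *)
assert (corr : (Cmod (corrected mu prim psi dpsi (ray s) - corrected mu prim psi dpsi (ray 0%R))
   <= K * (Cmod (up (ray s)) / (x + s) ^ 5) - K * (Cmod (up (ray 0%R)) / (x + 0) ^ 5))%R).
{ apply (mean_value_path (fun t => corrected mu prim psi dpsi (ray t))
   (fun t => (2 * psi (ray t) / (ray t ^ 2 - mu) ^ 2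
     + 8 * ray t * up (ray t) / (ray t ^ 2 - mu) ^ 3) * w)
   (fun t => K * (Cmod (up (ray t)) / (x + t) ^ 5))%R
   (fun t => K * (dp t / (x + t) ^ 5 - INR 5 * Cmod (up (ray t)) / (x + t) ^ 6))%R); [easy|].
  intros t Ht. destruct (G t (proj1 Ht)) as (G1 & G2 & G3 & G4).
  destruct (steep_ray kappa x t w Hw) as (_ & R2 & R3); [lra|lra|]. fold (ray t) in R2, R3.
  assert (Hkt : (kappa * x <= kappa * (x + t))%R) by (apply Rmult_le_compat_l; lra).
  assert (Hmu : (2 * Cmod mu <= (kappa * (x + t)) ^ 2)%R) by (fold m; nra).
  destruct (Cmod_quadratic_bounds mu (ray t) kappa (x + t) Hk) as [Q1 Q2]; [lra|lra|easy|].
  assert (Hq0 : (0 < kappa ^ 2 * (x + t) ^ 2 / 2)%R).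
  { assert (0 < kappa ^ 2 * (x + t) ^ 2)%R by (apply Rmult_lt_0_compat; apply pow_lt; lra). lra. }
  assert (Hq : ray t ^ 2 - mu <> 0) by (apply Cmod_gt_0; lra).
  split; [|split].
  - apply (is_path_derive_ray (corrected mu prim psi dpsi)), corrected_derive; try easy.
  - apply is_derive_scal, (is_derive_div_pow (fun t => Cmod (up (ray t)))); [lra|easy].
  - rewrite Cmod_mult, (proj1 Hw), Rmult_1_r.
    eapply Rle_trans; [apply Cmod_triangle|].
    rewrite !Cmod_div by now apply Cpow_nz.
    rewrite !Cmod_mult, !Cmod_pow, !Cmod_R, !Rabs_pos_eq by lra.
    set (p := Cmod (up (ray t))) in *.
    eapply Rle_trans.
    + apply (corrected_derive_bound kappa (x + t) (Cmod (psi (ray t))) p); try easy; try lra; try apply Cmod_ge_0.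
      pose proof (ladder_bound psi dpsi (ray t)) as Hb. fold up p in Hb.
      pose proof (Cmod_ge_0 (psi (ray t))).
      assert (kappa * (x + t) * Cmod (psi (ray t)) <= Cmod (ray t) * Cmod (psi (ray t)))%R by (apply Rmult_le_compat_r; lra).
      lra.
    + fold K. apply Rmult_le_compat_l; [lra|].
      assert (Hr : (0 < (x + t) ^ 6)%R) by (apply pow_lt; lra).
      replace (dp t / (x + t) ^ 5 - INR 5 * p / (x + t) ^ 6)%R
        with ((dp t * (x + t) - 5 * p) / (x + t) ^ 6)%R by (simpl INR; field; lra).
      apply -> Rle_div_r; [|easy].
      replace (p / (x + t) ^ 5 * (x + t) ^ 6)%R with (p * (x + t))%R by (field; lra).
      assert (3 * p <= (kappa / 2 * (x + t)) * p)%R by (apply Rmult_le_compat_r; lra).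
      assert (3 * p * (x + t) <= dp t * (x + t))%R by (apply Rmult_le_compat_r; lra).
      assert (p * 6 <= p * (x + t))%R by (apply Rmult_le_compat_l; lra). lra. }
replace (ray 0%R) with (x : C) in corr by (unfold ray; ring).
destruct (G s Hs) as (_ & Gp & _).
set (p := Cmod (up (ray s))) in *.
fold (ray s).
destruct (steep_ray kappa x s w Hw) as (_ & R2 & R3); [lra|lra|]. fold (ray s) in R2, R3.
assert (Hks : (kappa * x <= kappa * (x + s))%R) by (apply Rmult_le_compat_l; lra).
assert (Hmu : (2 * Cmod mu <= (kappa * (x + s)) ^ 2)%R) by (fold m; nra).
destruct (Cmod_quadratic_bounds mu (ray s) kappa (x + s) Hk) as [Q1 Q2]; [lra|lra|easy|].
assert (Hq0 : (0 < kappa ^ 2 * (x + s) ^ 2 / 2)%R).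
{ assert (0 < kappa ^ 2 * (x + s) ^ 2)%R by (apply Rmult_lt_0_compat; apply pow_lt; lra). lra. }
assert (Hq : ray s ^ 2 - mu <> 0) by (apply Cmod_gt_0; lra).
set (Y := corrected mu prim psi dpsi) in *.
set (lead := 2 * up (ray s) * (/ (ray s ^ 2 - mu)) ^ 2).
assert (T1 : (Cmod lead <= Cmod (reduced mu prim dpsi (ray s)) + Cmod (Y (ray s) - Y x) + Cmod (Y x))%R).
{ replace lead with (reduced mu prim dpsi (ray s) + - ((Y (ray s) - Y x) + Y x)).
  - eapply Rle_trans; [apply Cmod_triangle|]. rewrite Cmod_opp.
    pose proof (Cmod_triangle (Y (ray s) - Y x) (Y x)). lra.
  - change (Y (ray s)) with (reduced mu prim dpsi (ray s) - lead). ring. }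
assert (T2 : (p / (2 * (x + s) ^ 4) <= Cmod lead)%R).
{ unfold lead. rewrite !Cmod_mult, Cmod_pow, Cmod_inv, Cmod_R, Rabs_pos_eq by (easy || lra).
  fold p. rewrite pow_inv.
  apply Rle_trans with (2 * p * / (2 * (x + s) ^ 2) ^ 2)%R.
  - apply Req_le; field; lra.
  - apply Rmult_le_compat_l; [lra|]. apply Rinv_le_contravar; [apply pow_lt; lra|].
    apply pow_incr; lra. }
(* Of the lower bound [p / (2 (x + s)^4)] for [lead], the integrated error takes half ([T3]); the
   other half grows like [(x + s)^2] ([T4]). *)
assert (Hr4 : (0 < (x + s) ^ 4)%R) by (apply pow_lt; lra).
assert (T3 : (K * (p / (x + s) ^ 5) <= p / (4 * (x + s) ^ 4))%R).
{ assert (Hr5 : (0 < 4 * (x + s) ^ 5)%R) by (assert (0 < (x + s) ^ 5)%R by (apply pow_lt; lra); lra).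
  apply (Rmult_le_reg_r _ _ _ Hr5).
  replace (K * (p / (x + s) ^ 5) * (4 * (x + s) ^ 5))%R with (4 * K * p)%R by (field; lra).
  replace (p / (4 * (x + s) ^ 4) * (4 * (x + s) ^ 5))%R with ((x + s) * p)%R by (field; lra).
  apply Rmult_le_compat_r; lra. }
assert (T4 : (p0 / (4 * x ^ 6) * (x + s) ^ 2 <= p / (4 * (x + s) ^ 4))%R).
{ replace (p0 / (4 * x ^ 6) * (x + s) ^ 2)%R with (p0 / x ^ 6 * ((x + s) ^ 2 / 4))%R by (field; lra).
  replace (p / (4 * (x + s) ^ 4))%R with (p / (x + s) ^ 6 * ((x + s) ^ 2 / 4))%R by (field; lra).
  apply Rmult_le_compat_r; [|easy].
  pose proof (pow2_ge_0 (x + s)). lra. }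
assert (T5 : (0 <= K * (Cmod (up x) / (x + 0) ^ 5))%R).
{ apply Rmult_le_pos; [lra|]. apply Rlt_le, Rdiv_lt_0_compat; [exact Hp0|apply pow_lt; lra]. }
replace (p / (2 * (x + s) ^ 4))%R with (p / (4 * (x + s) ^ 4) + p / (4 * (x + s) ^ 4))%R in T2 by (field; lra).
lra.
Qed.

(** * Uniform growth in a sector *)

Lemma sector_steep (alpha : R) : (alpha < PI / 4)%R ->
  exists kappa : R, (0 < kappa <= 1)%R /\ forall z : C, z <> 0 ->
    (Rabs (Carg z) <= alpha)%R ->
    (kappa * Cmod z <= Re z)%R /\ (kappa * Cmod z ^ 2 <= Re (z ^ 2))%R.
Proof.
intros Ha. pose proof PI_RGT_0 as Hpi.
destruct (Rlt_le_dec alpha 0) as [Hneg|Hpos].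
(* A negative [alpha] leaves an empty sector. *)
{ exists 1%R; split; [lra|]. intros z _ H. pose proof (Rabs_pos (Carg z)). lra. }
(* [Re (z^2) = |z|^2 cos (2 arg z)], and [cos (2 alpha) > 0] precisely uses [alpha < PI / 4]; the
   same constant bounds [cos (arg z)]. *)
exists (cos (2 * alpha)). split.
{ split; [apply cos_gt_0; lra|apply COS_bound]. }
intros z Hz Harg.
destruct (Carg_spec z Hz) as [_ E].
set (t := Carg z) in *. set (r := Cmod z) in *.
assert (Hr : (0 < r)%R) by now apply Cmod_gt_0.
assert (E1 : Re z = (r * cos (Rabs t))%R).
{ rewrite E. unfold Re, Cmult, RtoC, fst, snd.
  unfold Rabs; destruct (Rcase_abs t); rewrite ?cos_neg; ring. }
assert (E2 : Re (z ^ 2) = (r ^ 2 * cos (2 * Rabs t))%R).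
{ rewrite E. replace (cos (2 * Rabs t)) with (cos (2 * t)).
  - rewrite cos_2a. simpl. unfold Re, Cmult, RtoC, fst, snd. ring.
  - unfold Rabs; destruct (Rcase_abs t); [|easy].
    rewrite <- (cos_neg (2 * - t)). f_equal; ring. }
pose proof (Rabs_pos t) as Ht0.
assert (C2 : (cos (2 * alpha) <= cos (2 * Rabs t))%R) by (apply cos_decr_1; lra).
assert (C1 : (cos (2 * alpha) <= cos (Rabs t))%R) by (apply cos_decr_1; lra).
rewrite E1, E2. split.
- rewrite Rmult_comm. apply Rmult_le_compat_l; lra.
- rewrite Rmult_comm. apply Rmult_le_compat_l; [apply pow2_ge_0|easy].
Qed.

(** Seen from [x] instead of 0, a distant point of the sector has almost the same direction; at
    distance [8 x / kappa] the change costs no more than half of [kappa]. *)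
Lemma steep_from (kappa x : R) (z : C) :
  (0 < kappa <= 1)%R -> (0 < x)%R -> (8 * x / kappa < Cmod z)%R ->
  (kappa * Cmod z <= Re z)%R -> (kappa * Cmod z ^ 2 <= Re (z ^ 2))%R ->
  exists (w : C) (s : R), steep (kappa / 2) w /\ (Cmod z - x <= s)%R /\ z = x + s * w.
Proof.
intros Hk Hx Hz H1 H2.
set (r := Cmod z) in *.
assert (Hkr : (8 * x < kappa * r)%R).
{ apply (Rmult_lt_compat_l kappa) in Hz; [|easy].
  replace (kappa * (8 * x / kappa))%R with (8 * x)%R in Hz by (field; lra). lra. }
assert (Hr : (8 * x < r)%R) by nra.
set (s := Cmod (z - x)).
assert (Hs1 : (r - x <= s)%R).
{ pose proof (Cmod_triangle (z - x) x) as T. rewrite Cmod_R, Rabs_pos_eq in T by lra.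
  replace (z - x + x) with z in T by ring. fold r s in T. lra. }
assert (Hs2 : (s <= r + x)%R).
{ pose proof (Cmod_triangle z (- x)) as T. rewrite Cmod_opp, Cmod_R, Rabs_pos_eq in T by lra. exact T. }
assert (Hs0 : (0 < s)%R) by lra.
assert (Hsc : RtoC s <> 0) by (intros E; apply RtoC_inj in E; lra).
exists ((z - x) / s), s. split; [|split].
- split; [|split].
  + rewrite Cmod_div by easy. rewrite Cmod_R, Rabs_pos_eq by lra. fold s. field; lra.
  + replace (Re ((z - x) / s)) with ((Re z - x) / s)%R.
    * apply -> Rle_div_r; [|lra]. nra.
    * destruct z as [z1 z2]. unfold Re, Cdiv, Cmult, Cminus, Cplus, Copp, Cinv, RtoC, fst, snd. field; lra.
  + replace (Re (((z - x) / s) ^ 2)) with ((Re (z ^ 2) - 2 * x * Re z + x ^ 2) / s ^ 2)%R.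
    * apply -> Rle_div_r; [|apply pow_lt; lra].
      assert (Re z <= r)%R by (eapply Rle_trans; [apply Rle_abs|apply re_le_Cmod]).
      assert (s ^ 2 <= (r + x) ^ 2)%R by (apply pow_incr; lra).
      assert (kappa / 2 * s ^ 2 <= kappa / 2 * (r + x) ^ 2)%R by (apply Rmult_le_compat_l; lra).
      assert (2 * x * Re z <= 2 * x * r)%R by (apply Rmult_le_compat_l; lra).
      assert (8 * x * r <= kappa * r * r)%R by (apply Rmult_le_compat_r; lra).
      assert (kappa / 2 * (r + x) ^ 2 <= kappa / 2 * r ^ 2 + x * r + x * x)%R.
      { assert (0 <= x * r)%R by (apply Rmult_le_pos; lra). assert (0 <= x * x)%R by (apply Rmult_le_pos; lra).
        replace (kappa / 2 * (r + x) ^ 2)%R with (kappa / 2 * r ^ 2 + kappa * (x * r) + kappa / 2 * (x * x))%R by field.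
        assert (kappa * (x * r) <= 1 * (x * r))%R by (apply Rmult_le_compat_r; lra).
        assert (kappa / 2 * (x * x) <= 1 * (x * x))%R by (apply Rmult_le_compat_r; lra). lra. }
      assert (x * x <= x * r)%R by (apply Rmult_le_compat_l; lra).
      assert (0 <= x * x)%R by (apply Rmult_le_pos; lra). lra.
    * destruct z as [z1 z2]. simpl. unfold Re, Cdiv, Cmult, Cminus, Cplus, Copp, Cinv, RtoC, fst, snd. field; lra.
- lra.
- field. easy.
Qed.

(** Once [alpha] fixes [kappa] and thereby [r0], one dominant point [x] beyond [r0] suffices: the
    rays issued from it reach every distant point of the sector. *)
Lemma sector_growth (mu : C) (prim psi dpsi : C -> C) :
  weber mu psi dpsi -> (forall z, is_Cderive prim z (psi z)) ->
  (forall x0 : R, exists x : R, (x0 <= x)%R /\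
     (Cmod (ladder_down psi dpsi x) < Cmod (ladder_up psi dpsi x))%R) ->
  forall alpha M : R, (alpha < PI / 4)%R ->
  exists L : R, forall z : C, (L < Cmod z)%R -> (Rabs (Carg z) <= alpha)%R ->
    (M < Cmod (reduced mu prim dpsi z))%R.
Proof.
intros HW HE Hdom alpha M Ha.
destruct (sector_steep alpha Ha) as (kappa & Hk & Hsec).
destruct (reduced_growth mu prim psi dpsi (kappa / 2) HW HE) as (r0 & Hr0 & HG); [lra|].
destruct (Hdom r0) as (x & Hx & Hini).
destruct (HG x Hx Hini) as (c & D & Hc & HB).
(* The first bound is for [steep_from], 1 gives [r <= (x + s)^2], and the last one makes [c r]
   exceed [|M| + |D|]. *)
exists (Rmax (8 * x / kappa) (Rmax 1 ((Rabs M + Rabs D) / c + 1))).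
intros z Hz Harg.
assert (Z1 := Rle_lt_trans _ _ _ (Rmax_l _ _) Hz).
assert (Z2 := Rle_lt_trans _ _ _ (Rmax_r _ _) Hz).
assert (Z3 := Rle_lt_trans _ _ _ (Rmax_l _ _) Z2).
assert (Z4 := Rle_lt_trans _ _ _ (Rmax_r _ _) Z2).
assert (Hz0 : z <> 0) by (apply Cmod_gt_0; lra).
destruct (Hsec z Hz0 Harg) as [S1 S2].
destruct (steep_from kappa x z Hk ltac:(lra) Z1 S1 S2) as (w & s & Hw & Hs & ->).
set (r := Cmod (x + s * w)) in *.
assert (8 * x < r)%R.
{ apply Rle_lt_trans with (8 * x / kappa)%R; [|easy].
  apply -> Rle_div_r; [|lra]. nra. }
specialize (HB w s Hw ltac:(lra)).
assert (R2 : (r * 1 <= (x + s) ^ 2)%R).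
{ replace ((x + s) ^ 2)%R with ((x + s) * (x + s))%R by ring.
  apply Rmult_le_compat; lra. }
assert (HcM : (Rabs M + Rabs D < c * r)%R).
{ apply Rle_lt_trans with (c * ((Rabs M + Rabs D) / c))%R; [apply Req_le; field; lra|].
  apply Rmult_lt_compat_l; lra. }
assert (c * r <= c * (x + s) ^ 2)%R by (apply Rmult_le_compat_l; lra).
pose proof (Rle_abs M). pose proof (Rle_abs D). lra.
Qed.

(** * Decaying solutions on the real line *)

Lemma is_path_derive_real (f : C -> C) (t : R) (l : C) :
  is_Cderive f (RtoC t) l -> is_path_derive (fun s : R => f s) t l.
Proof.
intros H. apply is_path_derive_eq with (l * 1); [|ring].
apply (is_path_derive_comp f RtoC); [easy|].
apply is_path_derive_pair; simpl; [apply (is_derive_id (K := R_AbsRing))|apply (is_derive_const (K := R_AbsRing) (V := R_NormedModule))].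
Qed.

(** All powers are required at once because multiplication by [z], hence each use of [ladder_up],
    costs one of them. *)
Definition decays (f : C -> C) : Prop :=
  forall n : nat, exists K x0 : R, forall x : R, (x0 <= Rabs x)%R ->
    (Rabs x ^ n * Cmod (f x) <= K)%R.

Definition decays_right (f : C -> C) : Prop :=
  forall n : nat, exists K x0 : R, forall x : R, (x0 <= x)%R ->
    (x ^ n * Cmod (f x) <= K)%R.

Lemma decays_both (f : C -> C) :
  decays_right f -> decays_right (fun z => f (- z)) -> decays f.
Proof.
intros H1 H2 n.
destruct (H1 n) as (K1 & x1 & B1). destruct (H2 n) as (K2 & x2 & B2).
exists (Rmax K1 K2), (Rmax x1 x2). intros x Hx.
unfold Rabs in *. destruct (Rcase_abs x).
- eapply Rle_trans; [|apply Rmax_r].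
  specialize (B2 (- x)%R (Rle_trans _ _ _ (Rmax_r _ _) Hx)).
  rewrite <- RtoC_opp, Ropp_involutive in B2. exact B2.
- eapply Rle_trans; [|apply Rmax_l]. apply B1, (Rle_trans _ _ _ (Rmax_l _ _) Hx).
Qed.

Lemma decays_right_le (f g : C -> C) (x1 : R) :
  (forall x : R, (x1 <= x)%R -> (Cmod (f x) <= Cmod (g x))%R) ->
  decays_right g -> decays_right f.
Proof.
intros H Hg n. destruct (Hg n) as (K & x0 & B).
exists K, (Rmax 0 (Rmax x0 x1)). intros x Hx.
assert (X0 := Rle_trans _ _ _ (Rmax_l _ _) Hx).
assert (X1 := Rle_trans _ _ _ (Rmax_r _ _) Hx).
eapply Rle_trans; [|apply B, (Rle_trans _ _ _ (Rmax_l _ _) X1)].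
apply Rmult_le_compat_l; [now apply pow_le|].
apply H, (Rle_trans _ _ _ (Rmax_r _ _) X1).
Qed.

Lemma decays_plus (f g : C -> C) : decays f -> decays g -> decays (fun z => f z + g z).
Proof.
intros H1 H2 n.
destruct (H1 n) as (K1 & x1 & B1). destruct (H2 n) as (K2 & x2 & B2).
exists (K1 + K2)%R, (Rmax x1 x2). intros x Hx.
specialize (B1 x (Rle_trans _ _ _ (Rmax_l _ _) Hx)).
specialize (B2 x (Rle_trans _ _ _ (Rmax_r _ _) Hx)).
pose proof (Cmod_triangle (f x) (g x)) as T.
apply (Rmult_le_compat_l (Rabs x ^ n)) in T; [lra|apply pow_le, Rabs_pos].
Qed.

Lemma decays_scal (c : C) (f : C -> C) : decays f -> decays (fun z => c * f z).
Proof.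
intros H n. destruct (H n) as (K & x0 & B).
exists (Cmod c * K)%R, x0. intros x Hx. specialize (B x Hx).
rewrite Cmod_mult. apply (Rmult_le_compat_l (Cmod c)) in B; [lra|apply Cmod_ge_0].
Qed.

Lemma decays_mul_id (f : C -> C) : decays f -> decays (fun z => z * f z).
Proof.
intros H n. destruct (H (S n)) as (K & x0 & B).
exists K, x0. intros x Hx. specialize (B x Hx).
rewrite Cmod_mult, Cmod_R. simpl in B. lra.
Qed.

(** When [|P| <= |Q|], [ladder_bound] gives [x |psi| <= |Q|], so the equation
    [Q' = - x Q - (3 + mu) psi] closes on [Q] alone and forces its decay; [psi] and [dpsi] are then
    bounded by [|Q|]. *)
Lemma recessive_decays (mu : C) (psi dpsi : C -> C) (x1 : R) :
  weber mu psi dpsi ->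
  (forall x : R, (x1 <= x)%R ->
     (Cmod (ladder_up psi dpsi x) <= Cmod (ladder_down psi dpsi x))%R) ->
  decays_right psi /\ decays_right dpsi.
Proof.
intros HW Hrec.
set (down := ladder_down psi dpsi) in *. set (up := ladder_up psi dpsi) in *.
assert (psi_small : forall x : R, (Rmax 1 x1 <= x)%R -> (x * Cmod (psi x) <= Cmod (down x))%R).
{ intros x Hx. assert (1 <= x)%R by exact (Rle_trans _ _ _ (Rmax_l _ _) Hx).
  pose proof (ladder_bound psi dpsi x) as Hb. fold up down in Hb.
  specialize (Hrec x (Rle_trans _ _ _ (Rmax_r _ _) Hx)).
  rewrite Cmod_R, Rabs_pos_eq in Hb by lra. lra. }
assert (Hdown : decays_right down).
{ intros n.
  set (a := Cmod (3 + mu)).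
  assert (Ha : (0 <= a)%R) by apply Cmod_ge_0.
  set (x0 := Rmax (Rmax 1 x1) (1 + a + INR n)).
  assert (Hn := pos_INR n).
  assert (X1 : (Rmax 1 x1 <= x0)%R) by apply Rmax_l.
  assert (X2 : (1 + a + INR n <= x0)%R) by apply Rmax_r.
  exists (1 + Cmod (down x0) ^ 2 * (x0 ^ n) ^ 2)%R, x0. intros x Hx.
  (* [|Q|^2 t^(2n)] is nonincreasing beyond [x0]: with [k] half the derivative of [|Q|^2] one has
     [t k <= (a - t^2) |Q|^2], and [t^2 >= t >= 1 + a + n]. The square keeps the function
     differentiable where [Q] vanishes. *)
  assert (M : (- (Cmod (down x0) ^ 2 * (x0 ^ n) ^ 2) <= - (Cmod (down x) ^ 2 * (x ^ n) ^ 2))%R).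
  { apply (nondecreasing_of_derive (fun t => - (Cmod (down t) ^ 2 * (t ^ n) ^ 2))%R
     (fun t => - (2 * cdot (down t) ((- (t * down t) - (3 + mu) * psi t)) * (t ^ n) ^ 2
        + Cmod (down t) ^ 2 * (2 * (INR n * t ^ pred n) * t ^ n)))%R); [easy|].
    intros t Ht. split.
    - apply (is_derive_opp (K := R_AbsRing) (V := R_NormedModule)).
      apply (is_derive_mult (K := R_AbsRing) (fun t => Cmod (down t) ^ 2)%R (fun t => (t ^ n) ^ 2)%R).
      + apply (is_derive_Cmod2 (fun t : R => down t)), is_path_derive_real, ladder_down_derive, HW.
      + auto_derive; [easy|]. simpl. ring.
      + exact Rmult_comm.
    - assert (T1 : (Rmax 1 x1 <= t)%R) by lra.
      assert (T2 : (1 + a + INR n <= t)%R) by lra.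
      pose proof (psi_small t T1) as Hp.
      pose proof (cdot_rotated_upper (down t) (psi t) (3 + mu) 1 t t (Cmod_1)) as Hd.
      rewrite !Cmult_1_l, !Cmult_1_r in Hd. specialize (Hd (Rle_refl t)). fold a in Hd.
      set (d := Cmod (down t)) in *. set (m := Cmod (psi t)) in *.
      assert (Hd0 : (0 <= d)%R) by apply Cmod_ge_0.
      assert (Hm0 : (0 <= m)%R) by apply Cmod_ge_0.
      assert (Ht0 : (0 < t)%R) by lra.
      set (k := cdot (down t) _) in *.
      assert (H1 : (t * (d * a * m) <= a * d ^ 2)%R).
      { replace (t * (d * a * m))%R with (a * d * (t * m))%R by ring.
        replace (a * d ^ 2)%R with (a * d * d)%R by ring.
        apply Rmult_le_compat_l; [apply Rmult_le_pos; lra|lra]. }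
      assert (Hpn : (0 <= t ^ n)%R) by (apply pow_le; lra).
      assert (Hpp : (INR n * t ^ pred n * t = INR n * t ^ n)%R).
      { destruct n; simpl; ring. }
      assert (H2 : (t * k + INR n * d ^ 2 <= 0)%R).
      { assert (H3 : (t * k <= t * (- t * d ^ 2 + d * a * m))%R) by (apply Rmult_le_compat_l; lra).
        assert (H4 : ((1 + a + INR n) * d ^ 2 <= t * t * d ^ 2)%R).
        { apply Rmult_le_compat_r; [apply pow2_ge_0|nra]. }
        pose proof (pow2_ge_0 d). lra. }
      assert (H5 : (t * (2 * k * (t ^ n) ^ 2 + d ^ 2 * (2 * (INR n * t ^ pred n) * t ^ n)) <= 0)%R).
      { replace (t * (2 * k * (t ^ n) ^ 2 + d ^ 2 * (2 * (INR n * t ^ pred n) * t ^ n)))%R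
          with (2 * (t ^ n) ^ 2 * (t * k) + d ^ 2 * (2 * (INR n * t ^ pred n * t) * t ^ n))%R by ring.
        rewrite Hpp.
        replace (2 * (t ^ n) ^ 2 * (t * k) + d ^ 2 * (2 * (INR n * t ^ n) * t ^ n))%R
          with (2 * (t ^ n) ^ 2 * (t * k + INR n * d ^ 2))%R by ring.
        pose proof (pow2_ge_0 (t ^ n)). nra. }
      nra. }
  assert (Hx0 : (1 <= x0)%R) by lra.
  (* Passes from a bound on [y^2] to one on [y] through [2 y <= 1 + y^2]. *)
  pose proof (pow2_ge_0 (x ^ n * Cmod (down x) - 1)).
  set (y := (x ^ n * Cmod (down x))%R) in *.
  replace (Cmod (down x) ^ 2 * (x ^ n) ^ 2)%R with (y ^ 2)%R in M by (unfold y; ring). nra. }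
split.
- apply (decays_right_le psi down (Rmax 1 x1)); [|easy].
  intros x Hx. assert (1 <= x)%R by exact (Rle_trans _ _ _ (Rmax_l _ _) Hx).
  specialize (psi_small x Hx). pose proof (Cmod_ge_0 (psi x)). nra.
- apply (decays_right_le dpsi down (Rmax 1 x1)); [|easy].
  intros x Hx. specialize (Hrec x (Rle_trans _ _ _ (Rmax_r _ _) Hx)).
  assert (T : (2 * Cmod (dpsi x) <= Cmod (up x) + Cmod (down x))%R).
  { replace (2 * Cmod (dpsi x))%R with (Cmod (up x + down x)); [apply Cmod_triangle|].
    replace (up x + down x) with (2 * dpsi x) by (unfold up, down, ladder_up, ladder_down; ring).
    rewrite Cmod_mult, Cmod_R, Rabs_pos_eq; lra. }
  lra.
Qed.

Lemma weber_ladder_up (mu : C) (psi dpsi : C -> C) :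
  weber mu psi dpsi ->
  weber (mu - 2) (ladder_up psi dpsi) (fun z => z * ladder_up psi dpsi z - (1 + mu) * psi z).
Proof.
intros H z. pose proof (ladder_up_derive mu psi dpsi z H) as H0.
split; [exact H0|].
destruct (H z) as [H1 H2].
eapply is_Cderive_eq.
- apply is_Cderive_minus; apply is_Cderive_mult;
    [apply is_Cderive_id|exact H0|apply is_Cderive_const|exact H1].
- cbv beta. unfold ladder_up. ring.
Qed.

Lemma decays_small (f : C -> C) (eps : R) :
  decays f -> (0 < eps)%R ->
  exists y0 : R, (0 < y0)%R /\ forall y : R, (y0 <= Rabs y)%R -> (Cmod (f y) <= eps)%R.
Proof.
intros H He. destruct (H 1%nat) as (K & x0 & B).
exists (Rmax x0 (Rabs K / eps + 1)).
assert (HK : (0 <= Rabs K / eps)%R) by (apply Rmult_le_pos; [apply Rabs_pos|apply Rlt_le, Rinv_0_lt_compat, He]).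
split; [eapply Rlt_le_trans; [|apply Rmax_r]; lra|].
intros y Hy. specialize (B y (Rle_trans _ _ _ (Rmax_l _ _) Hy)).
assert (Y := Rle_trans _ _ _ (Rmax_r _ _) Hy).
rewrite pow_1 in B.
apply Rmult_le_reg_l with (Rabs y); [lra|].
pose proof (Rle_abs K).
assert (Rabs K <= Rabs y * eps)%R.
{ replace (Rabs K) with (Rabs K / eps * eps)%R by (field; lra). apply Rmult_le_compat_r; lra. }
lra.
Qed.

(* With [Re (-2 - mu) > 0] the function [|psi|^2] is convex on the real line. *)
Lemma weber_decays_zero (mu : C) (psi dpsi : C -> C) :
  weber mu psi dpsi -> (Re mu < -2)%R -> decays psi -> decays dpsi ->
  forall x : R, psi x = 0.
Proof.
intros HW Hmu D0 D1.
set (k := fun t : R => cdot (psi t) (dpsi t)).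
assert (Hk : forall t : R, is_derive k t (Cmod (dpsi t) ^ 2 + (t ^ 2 - 2 - Re mu) * Cmod (psi t) ^ 2)%R).
{ intros t. destruct (HW t) as [H1 H2].
  apply is_path_derive_real in H1. apply is_path_derive_real in H2.
  pose proof (is_path_derive_Re _ _ _ H1) as R1. pose proof (is_path_derive_Im _ _ _ H1) as I1.
  pose proof (is_path_derive_Re _ _ _ H2) as R2. pose proof (is_path_derive_Im _ _ _ H2) as I2.
  evar_last.
  - apply (is_derive_plus (K := R_AbsRing) (V := R_NormedModule) (fun s : R => Re (psi s) * Re (dpsi s))%R (fun s : R => Im (psi s) * Im (dpsi s))%R).
    + apply (is_derive_mult (K := R_AbsRing)); [exact R1|exact R2|exact Rmult_comm].
    + apply (is_derive_mult (K := R_AbsRing)); [exact I1|exact I2|exact Rmult_comm].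
  - rewrite <- !cdot_self. unfold cdot. destruct (psi t) as [p1 p2], (dpsi t) as [q1 q2], mu as [m1 m2].
    unfold plus, mult; simpl. unfold mult; simpl. ring. }
assert (mono : forall s t : R, (s <= t)%R -> (k s <= k t)%R).
{ intros s t Hst. eapply (nondecreasing_of_derive k); [easy|].
  intros x _. split; [apply Hk|]. cbv beta.
  pose proof (pow2_ge_0 (Cmod (dpsi x))). pose proof (pow2_ge_0 (Cmod (psi x))). pose proof (pow2_ge_0 x).
  assert (0 <= (x ^ 2 - 2 - Re mu) * Cmod (psi x) ^ 2)%R by (apply Rmult_le_pos; lra). lra. }
assert (ksmall : forall eps : R, (0 < eps)%R -> exists y0 : R, (0 < y0)%R /\
  forall y : R, (y0 <= Rabs y)%R -> (Rabs (k y) <= eps)%R).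
{ intros eps He.
  destruct (decays_small psi 1 D0 Rlt_0_1) as (y1 & P1 & B1).
  destruct (decays_small dpsi eps D1 He) as (y2 & P2 & B2).
  exists (Rmax y1 y2). split; [eapply Rlt_le_trans; [exact P1|apply Rmax_l]|].
  intros y Hy. specialize (B1 y (Rle_trans _ _ _ (Rmax_l _ _) Hy)). specialize (B2 y (Rle_trans _ _ _ (Rmax_r _ _) Hy)).
  eapply Rle_trans; [apply cdot_le|].
  replace eps with (1 * eps)%R by ring. apply Rmult_le_compat; try apply Cmod_ge_0; lra. }
(* [k], half the derivative of [|psi|^2], is nondecreasing and tends to 0 at both ends of the line.
   This is where decay on both sides is needed. *)
assert (kzero : forall x : R, k x = 0%R).
{ intros x. apply Rle_antisym; apply le_epsilon; intros eps He; destruct (ksmall eps He) as (y0 & P & B).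
  - assert (H := mono x (Rmax y0 x) (Rmax_r _ _)).
    assert (y0 <= Rabs (Rmax y0 x))%R by (eapply Rle_trans; [apply (Rmax_l _ x)|apply Rle_abs]).
    specialize (B _ H0). pose proof (Rle_abs (k (Rmax y0 x))). lra.
  - assert (H := mono (Rmin (- y0) x) x (Rmin_r _ _)).
    assert (y0 <= Rabs (Rmin (- y0) x))%R.
    { pose proof (Rmin_l (- y0) x). rewrite <- Rabs_Ropp. eapply Rle_trans; [|apply Rle_abs]. lra. }
    specialize (B _ H0). rewrite <- Rabs_Ropp in B. pose proof (Rle_abs (- k (Rmin (- y0) x))). lra. }
intros x. apply Cmod_eq_0.
apply Rle_antisym; [|apply Cmod_ge_0].
apply le_epsilon; intros eps He; rewrite Rplus_0_l.
destruct (decays_small psi eps D0 He) as (y0 & P & B).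
assert (Y : (y0 <= Rabs (Rmax y0 x))%R) by (eapply Rle_trans; [apply (Rmax_l _ x)|apply Rle_abs]).
specialize (B _ Y).
assert (H : (Cmod (psi x) ^ 2 <= Cmod (psi (Rmax y0 x)) ^ 2)%R).
{ apply (nondecreasing_of_derive (fun t : R => Cmod (psi t) ^ 2)%R (fun t : R => 2 * k t)%R); [apply Rmax_r|].
  intros t _. split.
  - apply (is_derive_Cmod2 (fun t : R => psi t)), is_path_derive_real, HW.
  - rewrite kzero; lra. }
eapply Rle_trans; [|exact B].
apply Rsqr_incr_0_var; [unfold Rsqr; lra|apply Cmod_ge_0].
Qed.

Lemma is_Cderive_zero_on_R (f : C -> C) (x : R) (l : C) :
  (forall t : R, f t = 0) -> is_Cderive f (RtoC x) l -> l = 0.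
Proof.
intros H0 H. apply is_path_derive_real in H.
assert (R1 := is_path_derive_Re _ _ _ H). assert (I1 := is_path_derive_Im _ _ _ H).
apply is_derive_unique in R1. apply is_derive_unique in I1.
rewrite (Derive_ext _ (fun _ => 0%R)) in R1 by (intros t; now rewrite H0).
rewrite (Derive_ext _ (fun _ => 0%R)) in I1 by (intros t; now rewrite H0).
rewrite Derive_const in R1, I1. destruct l as [l1 l2]. simpl in R1, I1. now subst.
Qed.

Lemma decays_ladder_up (mu : C) (psi dpsi : C -> C) :
  decays psi -> decays dpsi ->
  decays (ladder_up psi dpsi) /\ decays (fun z => z * ladder_up psi dpsi z - (1 + mu) * psi z).
Proof.
intros D0 D1.
assert (D : decays (ladder_up psi dpsi)) by (apply decays_plus; [easy|now apply decays_mul_id]).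
split; [easy|].
intros n.
destruct (decays_plus _ _ (decays_mul_id _ D) (decays_scal (- (1 + mu)) _ D0) n) as (K & x0 & B).
exists K, x0. intros x Hx. specialize (B x Hx).
now replace (x * ladder_up psi dpsi x - (1 + mu) * psi x)
  with (x * ladder_up psi dpsi x + - (1 + mu) * psi x) by ring.
Qed.

(** The values [2n - 1] are the eigenvalues, with Hermite functions as decaying solutions. [N]
    counts the applications of [ladder_up] that bring [Re mu] below -2; the excluded set is mapped
    into itself when [mu] drops by 2. *)
Lemma weber_no_eigenfunction (N : nat) : forall (mu : C) (psi dpsi : C -> C),
  weber mu psi dpsi -> (Re mu < 2 * INR N - 2)%R ->
  (forall n : nat, mu <> RtoC (2 * INR n - 1)%R) ->
  decays psi -> decays dpsi -> forall x : R, psi x = 0.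
Proof.
induction N as [|N IH]; intros mu psi dpsi HW Hmu Hne D0 D1.
- apply (weber_decays_zero mu psi dpsi HW); try easy. simpl in Hmu. lra.
- destruct (decays_ladder_up mu psi dpsi D0 D1) as [E0 E1].
  assert (Z : forall x : R, ladder_up psi dpsi x = 0).
  { apply (IH (mu - 2) _ _ (weber_ladder_up mu psi dpsi HW)); try easy.
    - rewrite S_INR in Hmu. destruct mu as [m1 m2]. simpl in *. lra.
    - intros n En. apply (Hne (S n)). rewrite S_INR.
      replace (2 * (INR n + 1) - 1)%R with ((2 * INR n - 1) + 2)%R by ring.
      rewrite RtoC_plus, <- En. ring. }
  (* Climbing back: where [P] vanishes identically on the line, so does [P' = x P - (1 + mu) psi],
     and [1 + mu] is nonzero by the case [n = 0]. *)
  intros x.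
  pose proof (is_Cderive_zero_on_R _ x _ Z (ladder_up_derive mu psi dpsi x HW)) as E.
  rewrite Z in E.
  assert (E' : (1 + mu) * psi x = 0).
  { replace ((1 + mu) * psi x) with (- (x * 0 - (1 + mu) * psi x)) by ring. rewrite E. ring. }
  apply (f_equal Cmod) in E'. rewrite Cmod_mult, Cmod_0 in E'.
  apply Rmult_integral in E'. destruct E' as [E'|E']; apply Cmod_eq_0 in E'; [|easy].
  exfalso. apply (Hne O). simpl INR.
  replace (2 * 0 - 1)%R with (- (1))%R by ring. rewrite RtoC_opp.
  replace mu with ((1 + mu) - 1) by ring. rewrite E'. ring.
Qed.

(** * Complex power series *)

Lemma im_le_Cmod (z : C) : (Rabs (Im z) <= Cmod z)%R.
Proof.
pose proof (cdot_le z Ci) as H. rewrite Cmod_Ci, Rmult_1_r in H.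
replace (Im z) with (cdot z Ci); [easy|]. unfold cdot; simpl; ring.
Qed.

Definition is_Cseries (a : nat -> C) (l : C) : Prop :=
  is_series (fun n => Re (a n)) (Re l) /\ is_series (fun n => Im (a n)) (Im l).

Lemma is_Cseries_unique (a : nat -> C) (l : C) : is_Cseries a l -> Cseries a = l.
Proof.
intros [H1 H2]. unfold Cseries. rewrite (is_series_unique _ _ H1), (is_series_unique _ _ H2).
now destruct l.
Qed.

Lemma is_Cseries_abs (a : nat -> C) :
  ex_series (fun n => Cmod (a n)) -> is_Cseries a (Cseries a).
Proof.
intros H. split; apply Series_correct.
- apply (ex_series_le (K := R_AbsRing) (V := R_CompleteNormedModule) _ (fun n => Cmod (a n))); [|easy].
  intros n. apply re_le_Cmod.
- apply (ex_series_le (K := R_AbsRing) (V := R_CompleteNormedModule) _ (fun n => Cmod (a n))); [|easy].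
  intros n. apply im_le_Cmod.
Qed.

Lemma is_Cseries_plus (a b : nat -> C) (la lb : C) :
  is_Cseries a la -> is_Cseries b lb -> is_Cseries (fun n => a n + b n) (la + lb).
Proof.
intros [H1 H2] [H3 H4]. split.
- exact (is_series_plus (K := R_AbsRing) (V := R_NormedModule) _ _ _ _ H1 H3).
- exact (is_series_plus (K := R_AbsRing) (V := R_NormedModule) _ _ _ _ H2 H4).
Qed.

Lemma is_Cseries_scal (c : C) (a : nat -> C) (l : C) :
  is_Cseries a l -> is_Cseries (fun n => c * a n) (c * l).
Proof.
intros [H1 H2]. destruct c as [c1 c2].
pose proof (is_series_scal (K := R_AbsRing) (V := R_NormedModule) c1 _ _ H1) as A1.
pose proof (is_series_scal (K := R_AbsRing) (V := R_NormedModule) c2 _ _ H1) as A2.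
pose proof (is_series_scal (K := R_AbsRing) (V := R_NormedModule) c1 _ _ H2) as A3.
pose proof (is_series_scal (K := R_AbsRing) (V := R_NormedModule) c2 _ _ H2) as A4.
split.
- exact (is_series_minus (K := R_AbsRing) (V := R_NormedModule) _ _ _ _ A1 A4).
- exact (is_series_plus (K := R_AbsRing) (V := R_NormedModule) _ _ _ _ A3 A2).
Qed.

Lemma is_Cseries_ext (a b : nat -> C) (l : C) :
  (forall n, a n = b n) -> is_Cseries a l -> is_Cseries b l.
Proof.
intros E [H1 H2]. split.
- eapply is_series_ext; [|exact H1]. intros n; simpl; now rewrite E.
- eapply is_series_ext; [|exact H2]. intros n; simpl; now rewrite E.
Qed.

Lemma is_Cseries_cons (a : nat -> C) (l : C) :
  is_Cseries (fun n => a (S n)) l -> is_Cseries a (a O + l).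
Proof.
intros [H1 H2]. split.
- apply is_series_decr_1. evar_last; [exact H1|].
  change (Re l = ((Re (a O) + Re l) + - Re (a O))%R). ring.
- apply is_series_decr_1. evar_last; [exact H2|].
  change (Im l = ((Im (a O) + Im l) + - Im (a O))%R). ring.
Qed.

(** Sums are defined by components, which would lose a constant; pairing each term with [l] gives
    [|l|^2 <= |l| * Series b] instead. *)
Lemma is_Cseries_Cmod_le (a : nat -> C) (b : nat -> R) (l : C) :
  is_Cseries a l -> (forall n, (Cmod (a n) <= b n)%R) -> ex_series b ->
  (Cmod l <= Series b)%R.
Proof.
intros [H1 H2] Hab Hb.
destruct (Req_dec (Cmod l) 0) as [E|E].
{ rewrite E. replace 0%R with (Series (fun _ => 0%R)).
  - apply Series_le; [|easy]. intros n. pose proof (Cmod_ge_0 (a n)). specialize (Hab n). lra.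
  - apply is_series_unique.
    apply (filterlim_ext (fun _ => 0%R)); [|apply filterlim_const].
    intros n. rewrite sum_n_const. ring. }
assert (Hl : (0 < Cmod l)%R) by (pose proof (Cmod_ge_0 l); lra).
pose proof (is_series_scal (K := R_AbsRing) (V := R_NormedModule) (Re l) _ _ H1) as A1.
pose proof (is_series_scal (K := R_AbsRing) (V := R_NormedModule) (Im l) _ _ H2) as A2.
pose proof (is_series_plus (K := R_AbsRing) (V := R_NormedModule) _ _ _ _ A1 A2) as A.
assert (E1 : Series (fun n => cdot l (a n)) = cdot l l) by (apply is_series_unique; exact A).
assert (Hle : (Series (fun n => cdot l (a n)) <= Series (fun n => Cmod l * b n))%R).
{ rewrite (Series_scal_l (Cmod l) b).
  assert (Hex : ex_series (fun n => (Cmod l * b n)%R)) by (apply (ex_series_scal_l (Cmod l) b Hb)).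
  rewrite <- Series_scal_l.
  apply (is_lim_seq_le (sum_n (fun n => cdot l (a n))) (sum_n (fun n => (Cmod l * b n)%R))
     (Series (fun n => cdot l (a n))) (Series (fun n => (Cmod l * b n)%R))).
  - intros n. apply sum_n_m_le. intros k. eapply Rle_trans; [apply Rle_abs|].
    eapply Rle_trans; [apply cdot_le|]. apply Rmult_le_compat_l; [lra|apply Hab].
  - rewrite E1. exact A.
  - apply (Series_correct _ Hex). }
rewrite E1, cdot_self, Series_scal_l in Hle.
apply Rmult_le_reg_l with (Cmod l); [easy|]. lra.
Qed.

Definition power_series (a : nat -> C) (z : C) : C := Cseries (fun n => a n * z ^ n).

(** An infinite radius of convergence, expressed by bounded terms for every radius: in this form a
    factor such as [n] or [2^n] is absorbed by enlarging [r]. *)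
Definition entire_coef (a : nat -> C) : Prop :=
  forall r : R, (0 <= r)%R -> exists K : R, forall n : nat, (Cmod (a n) * r ^ n <= K)%R.

Lemma entire_ex_series (a : nat -> C) (r : R) :
  entire_coef a -> (0 <= r)%R -> ex_series (fun n => Cmod (a n) * r ^ n)%R.
Proof.
(* Boundedness at radius [2 r] leaves the geometric factor [(1/2)^n] at radius [r]. *)
intros Ha Hr. destruct (Ha (2 * r)%R) as [K HK]; [lra|].
apply (ex_series_le (K := R_AbsRing) (V := R_CompleteNormedModule) _ (fun n => K * (/ 2) ^ n)%R).
- intros n. change (norm (Cmod (a n) * r ^ n)%R) with (Rabs (Cmod (a n) * r ^ n)).
  rewrite Rabs_pos_eq by (apply Rmult_le_pos; [apply Cmod_ge_0|now apply pow_le]).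
  specialize (HK n). rewrite Rpow_mult_distr in HK. rewrite pow_inv.
  assert (H2 : (0 < 2 ^ n)%R) by (apply pow_lt; lra).
  apply -> Rle_div_r; [|easy]. lra.
- apply (ex_series_scal_l K (fun n => (/ 2) ^ n)%R). apply ex_series_geom. rewrite Rabs_pos_eq; lra.
Qed.

Lemma power_series_correct (a : nat -> C) (z : C) :
  entire_coef a -> is_Cseries (fun n => a n * z ^ n) (power_series a z).
Proof.
intros Ha. apply is_Cseries_abs.
eapply ex_series_ext; [|apply (entire_ex_series a (Cmod z) Ha (Cmod_ge_0 z))].
intros n; simpl. now rewrite Cmod_mult, Cmod_pow.
Qed.

Definition deriv_coef (a : nat -> C) (n : nat) : C := INR (S n) * a (S n).

Definition prim_coef (a : nat -> C) (n : nat) : C :=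
  match n with O => 0 | S m => a m / INR (S m) end.

Definition shift_coef (a : nat -> C) (n : nat) : C :=
  match n with O => 0 | S m => a m end.

Lemma INR_le_pow2 (n : nat) : (INR n <= 2 ^ n)%R.
Proof.
induction n as [|n IH]; [simpl; lra|].
rewrite S_INR. simpl. assert (1 <= 2 ^ n)%R by (apply pow_R1_Rle; lra). lra.
Qed.

Lemma entire_deriv (a : nat -> C) : entire_coef a -> entire_coef (deriv_coef a).
Proof.
(* In [2 (r + 1)], the 2 absorbs the factor [n + 1], and [r + 1 >= 1] allows the exponent to rise
   from [n] to [n + 1]. *)
intros Ha r Hr. destruct (Ha (2 * r + 2)%R) as [K HK]; [lra|].
exists K. intros n. eapply Rle_trans; [|apply (HK (S n))].
unfold deriv_coef. rewrite Cmod_mult, Cmod_R, Rabs_pos_eq by apply pos_INR.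
replace (2 * r + 2)%R with (2 * (r + 1))%R by ring. rewrite Rpow_mult_distr.
assert (H1 : (r ^ n <= (r + 1) ^ S n)%R).
{ apply Rle_trans with ((r + 1) ^ n)%R; [apply pow_incr; lra|]. apply Rle_pow; [lra|lia]. }
pose proof (INR_le_pow2 (S n)). pose proof (pos_INR (S n)).
assert (H2 : (INR (S n) * r ^ n <= 2 ^ S n * (r + 1) ^ S n)%R).
{ apply Rmult_le_compat; try easy. now apply pow_le. }
apply (Rmult_le_compat_l (Cmod (a (S n)))) in H2; [|apply Cmod_ge_0]. lra.
Qed.

Lemma entire_shift (a : nat -> C) : entire_coef a -> entire_coef (shift_coef a).
Proof.
intros Ha r Hr. destruct (Ha r Hr) as [K HK].
exists (Rmax 0 (r * K)). intros [|n].
- simpl. rewrite Cmod_0, Rmult_0_l. apply Rmax_l.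
- simpl. specialize (HK n). eapply Rle_trans; [|apply Rmax_r].
  apply (Rmult_le_compat_l r) in HK; lra.
Qed.

Lemma entire_prim (a : nat -> C) : entire_coef a -> entire_coef (prim_coef a).
Proof.
intros Ha r Hr. destruct (entire_shift a Ha r Hr) as [K HK].
exists K. intros [|n]; [apply (HK O)|].
eapply Rle_trans; [|apply (HK (S n))].
apply Rmult_le_compat_r; [now apply pow_le|].
change (Cmod (a n / INR (S n)) <= Cmod (a n))%R.
assert (Hn : (1 <= INR (S n))%R) by (rewrite S_INR; pose proof (pos_INR n); lra).
assert (Hn0 : RtoC (INR (S n)) <> 0) by (intros E; apply RtoC_inj in E; lra).
rewrite Cmod_div, Cmod_R, Rabs_pos_eq by (easy || lra).
apply <- Rle_div_l; [|lra]. pose proof (Cmod_ge_0 (a n)).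
assert (Cmod (a n) * 1 <= Cmod (a n) * INR (S n))%R by (apply Rmult_le_compat_l; lra). lra.
Qed.

Lemma pow_diff_bound (z h : C) (rho : R) (n : nat) :
  (1 <= rho)%R -> (Cmod z <= rho)%R -> (Cmod (z + h) <= rho)%R ->
  (Cmod ((z + h) ^ n - z ^ n) <= INR n * Cmod h * rho ^ n)%R.
Proof.
intros H1 Hz Hzh. pose proof (Cmod_ge_0 h).
induction n as [|n IH].
- simpl. replace (1 - 1) with (0 : C) by ring. rewrite Cmod_0. lra.
- replace ((z + h) ^ S n - z ^ S n) with (z * ((z + h) ^ n - z ^ n) + h * (z + h) ^ n) by (rewrite !Cpow_S; ring).
  eapply Rle_trans; [apply Cmod_triangle|]. rewrite !Cmod_mult, Cmod_pow.
  assert (A : (Cmod z * Cmod ((z + h) ^ n - z ^ n) <= rho * (INR n * Cmod h * rho ^ n))%R).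
  { apply Rmult_le_compat; try easy; apply Cmod_ge_0. }
  assert (B : (Cmod (z + h) ^ n <= rho ^ n)%R) by (apply pow_incr; split; [apply Cmod_ge_0|easy]).
  assert (0 <= rho ^ n)%R by (apply pow_le; lra).
  assert (B2 : (Cmod h * Cmod (z + h) ^ n <= Cmod h * (rho * rho ^ n))%R).
  { apply Rmult_le_compat_l; [easy|]. nra. }
  rewrite S_INR, <- tech_pow_Rmult. lra.
Qed.

(** Each step of the induction multiplies the old remainder by [z] and adds [h] times the difference
    bounded in [pow_diff_bound], so the factors [n] add up to at most [n^2]. *)
Lemma pow_taylor_bound (z h : C) (rho : R) (n : nat) :
  (1 <= rho)%R -> (Cmod z <= rho)%R -> (Cmod (z + h) <= rho)%R ->
  (Cmod ((z + h) ^ n - z ^ n - h * (INR n * z ^ pred n)) <= INR n ^ 2 * Cmod h ^ 2 * rho ^ n)%R.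
Proof.
intros H1 Hz Hzh. pose proof (Cmod_ge_0 h).
induction n as [|n IH].
- simpl. replace (1 - 1 - h * (0 * 1)) with (0 : C) by ring. rewrite Cmod_0. lra.
- replace ((z + h) ^ S n - z ^ S n - h * (INR (S n) * z ^ pred (S n)))
    with (z * ((z + h) ^ n - z ^ n - h * (INR n * z ^ pred n)) + h * ((z + h) ^ n - z ^ n)).
  2:{ rewrite S_INR, RtoC_plus. destruct n as [|n].
      - simpl. ring.
      - change (pred (S (S n))) with (S n). change (pred (S n)) with n. rewrite !Cpow_S. ring. }
  eapply Rle_trans; [apply Cmod_triangle|]. rewrite !(Cmod_mult z), (Cmod_mult h).
  pose proof (pow_diff_bound z h rho n H1 Hz Hzh) as D.
  set (T := Cmod ((z + h) ^ n - z ^ n - h * (INR n * z ^ pred n))) in *.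
  assert (A : (Cmod z * T <= rho * (INR n ^ 2 * Cmod h ^ 2 * rho ^ n))%R).
  { apply Rmult_le_compat; try easy; apply Cmod_ge_0. }
  assert (B : (Cmod h * Cmod ((z + h) ^ n - z ^ n) <= Cmod h * (INR n * Cmod h * rho ^ n))%R)
    by (apply Rmult_le_compat_l; easy).
  assert (0 <= rho ^ n)%R by (apply pow_le; lra). pose proof (pos_INR n).
  set (q := (Cmod h ^ 2 * rho ^ n)%R).
  assert (Hq : (0 <= q)%R) by (apply Rmult_le_pos; [apply pow2_ge_0|easy]).
  assert (F : (INR n * q <= INR n * (rho * q))%R) by (apply Rmult_le_compat_l; [easy|nra]).
  assert (F2 : (0 <= INR n * (rho * q))%R) by (apply Rmult_le_pos; [easy|nra]).
  assert (F3 : (0 <= rho * q)%R) by nra.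
  rewrite S_INR. change (rho ^ S n)%R with (rho * rho ^ n)%R. unfold q in *. lra.
Qed.

Lemma is_Cderive_power_series (a : nat -> C) (z : C) :
  entire_coef a -> is_Cderive (power_series a) z (power_series (deriv_coef a) z).
Proof.
intros Ha.
set (rho := (Cmod z + 1)%R).
assert (Hrho : (1 <= rho)%R) by (pose proof (Cmod_ge_0 z); unfold rho; lra).
(* The 4 absorbs the [n^2] of [pow_taylor_bound], as [n <= 2^n]; [rho = |z| + 1] covers all [z + h]
   with [|h| < 1]. *)
apply (is_Cderive_quad _ _ _ (Series (fun n => Cmod (a n) * (4 * rho) ^ n)%R) (mkposreal 1 Rlt_0_1)).
simpl pos. intros h Hh.
assert (Hz : (Cmod z <= rho)%R) by (unfold rho; lra).
assert (Hzh : (Cmod (z + h) <= rho)%R) by (pose proof (Cmod_triangle z h); unfold rho; lra).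
assert (Hd : is_Cseries (fun n => a n * (INR n * z ^ pred n)) (power_series (deriv_coef a) z)).
{ replace (power_series (deriv_coef a) z)
    with (a O * (INR O * z ^ pred O) + power_series (deriv_coef a) z) by (simpl; ring).
  apply (is_Cseries_cons (fun n => a n * (INR n * z ^ pred n))).
  eapply is_Cseries_ext; [|apply power_series_correct, entire_deriv, Ha].
  intros n. unfold deriv_coef. simpl pred. ring. }
pose proof (is_Cseries_plus _ _ _ _ (power_series_correct a (z + h) Ha)
  (is_Cseries_scal (-1) _ _ (power_series_correct a z Ha))) as S1.
pose proof (is_Cseries_plus _ _ _ _ S1 (is_Cseries_scal (- h) _ _ Hd)) as S2.
pose proof (entire_ex_series a (4 * rho) Ha ltac:(lra)) as Hex.
replace (power_series a (z + h) - power_series a z - h * power_series (deriv_coef a) z)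
  with (power_series a (z + h) + -1 * power_series a z + - h * power_series (deriv_coef a) z) by ring.
rewrite Rmult_comm, <- Series_scal_l.
apply (is_Cseries_Cmod_le _ _ _ S2); [|exact (ex_series_scal_l _ _ Hex)].
intros n.
replace (a n * (z + h) ^ n + -1 * (a n * z ^ n) + - h * (a n * (INR n * z ^ pred n)))
  with (a n * ((z + h) ^ n - z ^ n - h * (INR n * z ^ pred n))) by ring.
rewrite Cmod_mult.
replace (Cmod h ^ 2 * (Cmod (a n) * (4 * rho) ^ n))%R
  with (Cmod (a n) * (Cmod h ^ 2 * (4 * rho) ^ n))%R by ring.
apply Rmult_le_compat_l; [apply Cmod_ge_0|].
eapply Rle_trans; [apply (pow_taylor_bound z h rho n Hrho Hz Hzh)|].
rewrite Rpow_mult_distr.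
assert (H4 : (INR n ^ 2 <= 4 ^ n)%R).
{ replace 4%R with (2 * 2)%R by ring. rewrite Rpow_mult_distr.
  pose proof (INR_le_pow2 n). pose proof (pos_INR n). nra. }
assert (0 <= Cmod h ^ 2 * rho ^ n)%R by (apply Rmult_le_pos; [apply pow2_ge_0|apply pow_le; lra]).
apply (Rmult_le_compat_r _ _ _ H) in H4. lra.
Qed.

(** Stated on terms rather than coefficients to serve both at [z = 0] and for a series whose
    coefficients vanish. *)
Lemma power_series_tail_zero (a : nat -> C) (z : C) :
  (forall n, a (S n) * z ^ S n = 0) -> power_series a z = a O.
Proof.
intros H. apply is_Cseries_unique.
replace (a O) with (a O * z ^ O + 0 * 0) at 1 by (simpl; ring).
apply (is_Cseries_cons (fun n => a n * z ^ n)).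
apply is_Cseries_ext with (fun n => 0 * power_series (fun _ => 0) 0).
- intros n. rewrite H. ring.
- assert (E : is_series (fun _ : nat => 0%R) 0%R).
  { apply (filterlim_ext (fun _ => 0%R)); [|apply filterlim_const].
    intros n. rewrite sum_n_const. ring. }
  split.
  + eapply is_series_ext; [|replace (Re (0 * 0)) with 0%R; [exact E|simpl; ring]].
    intros n. simpl. ring.
  + eapply is_series_ext; [|replace (Im (0 * 0)) with 0%R; [exact E|simpl; ring]].
    intros n. simpl. ring.
Qed.

Lemma power_series_0 (a : nat -> C) : power_series a 0 = a O.
Proof. apply power_series_tail_zero. intros n. rewrite Cpow_S. ring. Qed.

Lemma power_series_ext (a b : nat -> C) (z : C) :
  (forall n, a n = b n) -> power_series a z = power_series b z.
Proof.
intros H. unfold power_series, Cseries.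
f_equal; apply Series_ext; intros n; now rewrite H.
Qed.

Lemma power_series_plus (a b : nat -> C) (z : C) : entire_coef a -> entire_coef b ->
  power_series (fun n => a n + b n) z = power_series a z + power_series b z.
Proof.
intros Ha Hb. apply is_Cseries_unique.
eapply is_Cseries_ext; [|apply (is_Cseries_plus _ _ _ _ (power_series_correct a z Ha) (power_series_correct b z Hb))].
intros n; simpl; ring.
Qed.

Lemma power_series_scal (c : C) (a : nat -> C) (z : C) : entire_coef a ->
  power_series (fun n => c * a n) z = c * power_series a z.
Proof.
intros Ha. apply is_Cseries_unique.
eapply is_Cseries_ext; [|apply (is_Cseries_scal c _ _ (power_series_correct a z Ha))].
intros n; simpl; ring.
Qed.

Lemma power_series_shift (a : nat -> C) (z : C) : entire_coef a ->
  power_series (shift_coef a) z = z * power_series a z.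
Proof.
intros Ha. apply is_Cseries_unique.
replace (z * power_series a z) with (shift_coef a O * z ^ O + z * power_series a z) by (simpl; ring).
apply (is_Cseries_cons (fun n => shift_coef a n * z ^ n)).
eapply is_Cseries_ext; [|apply (is_Cseries_scal z _ _ (power_series_correct a z Ha))].
intros n. simpl. ring.
Qed.

Lemma entire_plus (a b : nat -> C) :
  entire_coef a -> entire_coef b -> entire_coef (fun n => a n + b n).
Proof.
intros Ha Hb r Hr. destruct (Ha r Hr) as [K HK], (Hb r Hr) as [L HL].
exists (K + L)%R. intros n. specialize (HK n); specialize (HL n).
pose proof (Cmod_triangle (a n) (b n)) as T.
apply (Rmult_le_compat_r (r ^ n)) in T; [lra|now apply pow_le].
Qed.

Lemma entire_scal (c : C) (a : nat -> C) : entire_coef a -> entire_coef (fun n => c * a n).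
Proof.
intros Ha r Hr. destruct (Ha r Hr) as [K HK].
exists (Cmod c * K)%R. intros n. specialize (HK n). rewrite Cmod_mult.
apply (Rmult_le_compat_l (Cmod c)) in HK; [lra|apply Cmod_ge_0].
Qed.

(** * Power series solutions of Weber's equation *)

(** Suits recurrences of any order: which earlier term dominates may vary with [n], and descending
    leads to one of the first [N]. *)
Lemma bounded_of_dominated (x : nat -> R) (N : nat) :
  (forall n, (N <= n)%nat -> exists m, (m < n)%nat /\ (x n <= x m)%R) ->
  exists K : R, forall n, (x n <= K)%R.
Proof.
intros H.
assert (P : exists K : R, forall n, (n < N)%nat -> (x n <= K)%R).
{ clear H. induction N as [|N [K HK]]; [exists 0%R; lia|].
  exists (Rmax K (x N)). intros n Hn. destruct (Nat.eq_dec n N) as [->|E]; [apply Rmax_r|].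
  eapply Rle_trans; [apply HK; lia|apply Rmax_l]. }
destruct P as [K HK]. exists K. intros n.
induction n as [n IH] using (well_founded_induction Nat.lt_wf_0).
destruct (Nat.lt_ge_cases n N) as [L|L]; [now apply HK|].
destruct (H n L) as (m & Hm & Hx). eapply Rle_trans; [exact Hx|now apply IH].
Qed.

Lemma nat_above (r : R) : exists n : nat, (r <= INR n)%R.
Proof. destruct (INR_unbounded r) as [n Hn]. exists n; lra. Qed.

(* The four consecutive coefficients [d_n, ..., d_(n+3)] of the power series of a solution. *)
Fixpoint weber_window (mu c1 c2 : C) (n : nat) : C * C * (C * C) :=
  match n with
  | O => ((c1, c2), (- (2 + mu) * c1 / 2, - (2 + mu) * c2 / 6))
  | S m => let '((u0, u1), (u2, u3)) := weber_window mu c1 c2 m in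
     ((u1, u2), (u3, (u0 - (2 + mu) * u2) / ((INR m + 4) * (INR m + 3))))
  end.

Definition weber_coef (mu c1 c2 : C) (n : nat) : C := fst (fst (weber_window mu c1 c2 n)).

Lemma INR_plus_neq_0 (n : nat) (k : R) : (0 < k)%R -> INR n + k <> 0.
Proof.
intros Hk E. rewrite <- RtoC_plus in E. apply RtoC_inj in E. pose proof (pos_INR n). lra.
Qed.

Lemma weber_coef_rec (mu c1 c2 : C) (n : nat) :
  (INR n + 4) * (INR n + 3) * weber_coef mu c1 c2 (4 + n) =
  weber_coef mu c1 c2 n - (2 + mu) * weber_coef mu c1 c2 (2 + n).
Proof.
unfold weber_coef. simpl. destruct (weber_window mu c1 c2 n) as [[u0 u1] [u2 u3]]. simpl.
pose proof (INR_plus_neq_0 n 4 ltac:(lra)). pose proof (INR_plus_neq_0 n 3 ltac:(lra)).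
field. split; easy.
Qed.

(** Dividing by [(k + 4) (k + 3)] makes the terms eventually no larger than one of the two earlier
    terms of the recurrence; the single factor [k + 3 >= r^4 + |2 + mu| r^2] is enough. *)
Lemma weber_coef_entire (mu c1 c2 : C) : entire_coef (weber_coef mu c1 c2).
Proof.
intros r Hr.
set (d := weber_coef mu c1 c2).
destruct (nat_above (r ^ 4 + Cmod (2 + mu) * r ^ 2)) as [N HN].
apply (bounded_of_dominated _ (4 + N)).
intros n Hn. set (k := (n - 4)%nat). replace n with (4 + k)%nat by (unfold k; lia).
assert (Hk : (N <= k)%nat) by (unfold k; lia). clearbody k. clear n Hn.
apply le_INR in Hk.
pose proof (weber_coef_rec mu c1 c2 k) as E. fold d in E. apply (f_equal Cmod) in E.
pose proof (pos_INR k) as Hk0.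
rewrite <- !RtoC_plus, !Cmod_mult, !Cmod_R, !Rabs_pos_eq in E by lra.
assert (T : (Cmod (d k - (2 + mu) * d (2 + k)%nat) <= Cmod (d k) + Cmod (2 + mu) * Cmod (d (2 + k)%nat))%R).
{ rewrite <- Cmod_mult, <- (Cmod_opp ((2 + mu) * d (2 + k)%nat)). apply Cmod_triangle. }
set (x0 := (Cmod (d k) * r ^ k)%R). set (x2 := (Cmod (d (2 + k)%nat) * r ^ (2 + k))%R).
set (x4 := (Cmod (d (4 + k)%nat) * r ^ (4 + k))%R).
set (a := Cmod (2 + mu)) in *.
assert (Ha : (0 <= a)%R) by apply Cmod_ge_0.
assert (Hr2 : (0 <= r ^ 2)%R) by apply pow2_ge_0.
assert (Hr4 : (0 <= r ^ 4)%R) by now apply pow_le.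
assert (Har : (0 <= a * r ^ 2)%R) by now apply Rmult_le_pos.
assert (X4 : (0 <= x4)%R) by (apply Rmult_le_pos; [apply Cmod_ge_0|now apply pow_le]).
assert (X : ((INR k + 3) * x4 <= r ^ 4 * x0 + a * r ^ 2 * x2)%R).
{ apply Rle_trans with ((INR k + 4) * (INR k + 3) * x4)%R; [nra|].
  unfold x4, x0, x2.
  replace ((INR k + 4) * (INR k + 3) * (Cmod (d (4 + k)%nat) * r ^ (4 + k)))%R
    with ((INR k + 4) * (INR k + 3) * Cmod (d (4 + k)%nat) * r ^ (4 + k))%R by ring.
  rewrite E. eapply Rle_trans; [apply Rmult_le_compat_r; [now apply pow_le|exact T]|].
  apply Req_le. rewrite !pow_add. ring. }
assert (Y : (r ^ 4 * x0 + a * r ^ 2 * x2 <= (r ^ 4 + a * r ^ 2) * Rmax x0 x2)%R).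
{ pose proof (Rmax_l x0 x2). pose proof (Rmax_r x0 x2).
  assert (r ^ 4 * x0 <= r ^ 4 * Rmax x0 x2)%R by (apply Rmult_le_compat_l; easy).
  assert (a * r ^ 2 * x2 <= a * r ^ 2 * Rmax x0 x2)%R by (apply Rmult_le_compat_l; easy). lra. }
assert (X0 : (0 <= Rmax x0 x2)%R).
{ eapply Rle_trans; [|apply Rmax_l]. apply Rmult_le_pos; [apply Cmod_ge_0|now apply pow_le]. }
assert (Z : (x4 <= Rmax x0 x2)%R).
{ apply Rmult_le_reg_l with (INR k + 3)%R; [lra|].
  eapply Rle_trans; [exact X|]. eapply Rle_trans; [exact Y|].
  apply Rmult_le_compat_r; [easy|lra]. }
unfold Rmax in Z. destruct (Rle_dec x0 x2).
- exists (2 + k)%nat. split; [lia|exact Z].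
- exists k. split; [lia|exact Z].
Qed.

(** A solution given as a bare power series, unlike [psi1] and [psi2], can be integrated termwise;
    this is what it is built for. *)
Definition weber_sol (mu c1 c2 : C) : C -> C := power_series (weber_coef mu c1 c2).

Definition weber_dsol (mu c1 c2 : C) : C -> C := power_series (deriv_coef (weber_coef mu c1 c2)).

Definition weber_prim (mu c1 c2 : C) : C -> C := power_series (prim_coef (weber_coef mu c1 c2)).

Lemma weber_sol_spec (mu c1 c2 : C) : weber mu (weber_sol mu c1 c2) (weber_dsol mu c1 c2).
Proof.
intros z. pose proof (weber_coef_entire mu c1 c2) as H0.
pose proof (entire_deriv _ H0) as H1. pose proof (entire_deriv _ H1) as H2.
split; [now apply is_Cderive_power_series|].
eapply is_Cderive_eq; [now apply is_Cderive_power_series|].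
set (d := weber_coef mu c1 c2) in *. unfold weber_sol. fold d.
pose proof (entire_shift _ H0) as S1. pose proof (entire_shift _ S1) as S2.
pose proof (entire_scal (- (2 + mu)) _ H0) as S3.
replace ((z ^ 2 - 2 - mu) * power_series d z)
  with (z * (z * power_series d z) + - (2 + mu) * power_series d z) by ring.
rewrite <- (power_series_shift d z H0), <- (power_series_shift _ z S1), <- (power_series_scal _ _ z H0).
rewrite <- (power_series_plus _ _ z S2 S3).
apply power_series_ext. intros n. unfold deriv_coef.
destruct n as [|[|n]].
- unfold d, weber_coef; simpl. rewrite ?RtoC_plus. field.
- unfold d, weber_coef; simpl. rewrite ?RtoC_plus. field.
- pose proof (weber_coef_rec mu c1 c2 n) as E. fold d in E.
  replace (shift_coef (shift_coef d) (S (S n)) + - (2 + mu) * d (S (S n)))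
    with (d n - (2 + mu) * d (2 + n)%nat) by (simpl; ring).
  rewrite <- E. rewrite !S_INR, !RtoC_plus. simpl (4 + n)%nat. ring.
Qed.

Lemma weber_prim_spec (mu c1 c2 z : C) : is_Cderive (weber_prim mu c1 c2) z (weber_sol mu c1 c2 z).
Proof.
pose proof (weber_coef_entire mu c1 c2) as H0.
eapply is_Cderive_eq; [apply is_Cderive_power_series, entire_prim, H0|].
apply power_series_ext. intros n. unfold deriv_coef.
change (prim_coef (weber_coef mu c1 c2) (S n)) with (weber_coef mu c1 c2 n / INR (S n)).
field. intros E. apply RtoC_inj in E. now apply (not_0_INR (S n)).
Qed.

Lemma weber_sol_0 (mu c1 c2 : C) : weber_sol mu c1 c2 0 = c1 /\ weber_dsol mu c1 c2 0 = c2.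
Proof.
split; unfold weber_sol, weber_dsol; rewrite power_series_0; [easy|].
unfold deriv_coef, weber_coef; simpl. ring.
Qed.

(** * Kummer's function *)

Definition kummer_coef (a c : C) (n : nat) : C :=
  pochhammer a n / pochhammer c n / INR (fact n).

Lemma kummer_power_series (a c z : C) : kummer a c z = power_series (kummer_coef a c) z.
Proof.
unfold kummer, power_series, Cseries, kummer_coef, Cdiv.
f_equal; apply Series_ext; intros n; f_equal; ring.
Qed.

(** [c] is real and positive so that the Pochhammer symbols in the denominators do not vanish; it is
    used at 1/2 and 3/2. *)
Lemma kummer_coef_rec (a : C) (c : R) (n : nat) : (0 < c)%R ->
  (c + INR n) * INR (S n) * kummer_coef a c (S n) = (a + INR n) * kummer_coef a c n.
Proof.
intros Hc.
assert (P : forall m, pochhammer c m <> 0).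
{ induction m as [|m IH]; simpl.
  - intros E; apply RtoC_inj in E; lra.
  - apply Cmult_neq_0; [easy|]. rewrite Cplus_comm. now apply INR_plus_neq_0. }
unfold kummer_coef. rewrite fact_simpl, mult_INR, RtoC_mult.
change (pochhammer a (S n)) with (pochhammer a n * (a + INR n)).
change (pochhammer c (S n)) with (pochhammer c n * (c + INR n)).
assert (F : RtoC (INR (fact n)) <> 0) by (intros E; apply RtoC_inj in E; now apply (INR_fact_neq_0 n)).
assert (S : RtoC (INR (S n)) <> 0) by (intros E; apply RtoC_inj in E; now apply (not_0_INR (S n))).
assert (T : c + INR n <> 0) by (rewrite Cplus_comm; now apply INR_plus_neq_0).
field. repeat split; try easy.
Qed.

Lemma kummer_coef_entire (a : C) (c : R) : (0 < c)%R -> entire_coef (kummer_coef a c).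
Proof.
intros Hc r Hr.
destruct (nat_above (r * (Cmod a + 1))) as [N HN].
apply (bounded_of_dominated _ (2 + N)).
intros n Hn. set (k := (n - 1)%nat). replace n with (S k) by (unfold k; lia).
assert (Hk : (N <= k)%nat) by (unfold k; lia). assert (Hk1 : (1 <= k)%nat) by (unfold k; lia).
clearbody k. clear n Hn. apply le_INR in Hk, Hk1. simpl (INR 1) in Hk1.
exists k. split; [lia|].
pose proof (kummer_coef_rec a c k Hc) as E. apply (f_equal Cmod) in E.
set (u := kummer_coef a c) in *.
rewrite <- RtoC_plus, !Cmod_mult, !Cmod_R, !Rabs_pos_eq in E by (try lra; apply pos_INR).
rewrite S_INR in E.
assert (T : (Cmod (a + INR k) <= Cmod a + INR k)%R).
{ eapply Rle_trans; [apply Cmod_triangle|]. rewrite Cmod_R, Rabs_pos_eq; [lra|apply pos_INR]. }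
set (x := Cmod (u k)) in *. set (y := Cmod (u (S k))) in *.
assert (Hx : (0 <= x)%R) by apply Cmod_ge_0.
assert (Hy : (0 <= y)%R) by apply Cmod_ge_0.
pose proof (Cmod_ge_0 a) as Ha.
assert (A : (INR k * (INR k + 1) * y <= (c + INR k) * (INR k + 1) * y)%R).
{ apply Rmult_le_compat_r; [easy|]. apply Rmult_le_compat_r; lra. }
assert (B : (Cmod (a + INR k) * x <= (Cmod a + 1) * INR k * x)%R).
{ apply Rmult_le_compat_r; [easy|]. nra. }
assert (D : ((INR k + 1) * y <= (Cmod a + 1) * x)%R).
{ apply Rmult_le_reg_l with (INR k); lra. }
assert (F : ((INR k + 1) * (r * y) <= (INR k + 1) * x)%R).
{ apply Rle_trans with (r * (Cmod a + 1) * x)%R.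
  - apply (Rmult_le_compat_l r) in D; [lra|easy].
  - apply Rmult_le_compat_r; lra. }
apply Rmult_le_reg_l in F; [|lra].
simpl. apply (Rmult_le_compat_r (r ^ k)) in F; [lra|now apply pow_le].
Qed.

Definition kummer_d (a c : C) : C -> C := power_series (deriv_coef (kummer_coef a c)).

Definition kummer_dd (a c : C) : C -> C :=
  power_series (deriv_coef (deriv_coef (kummer_coef a c))).

Lemma kummer_derive (a : C) (c : R) (z : C) : (0 < c)%R ->
  is_Cderive (kummer a c) z (kummer_d a c z) /\
  is_Cderive (kummer_d a c) z (kummer_dd a c z).
Proof.
intros Hc. pose proof (kummer_coef_entire a c Hc) as H0.
split.
- eapply is_derive_ext; [intros t; symmetry; apply kummer_power_series|].
  now apply is_Cderive_power_series.
- now apply is_Cderive_power_series, entire_deriv.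
Qed.

Lemma kummer_0 (a c : C) : kummer a c 0 = 1.
Proof.
rewrite kummer_power_series, power_series_0. unfold kummer_coef. simpl. field.
Qed.

(** Kummer's differential equation. Its left-hand side is assembled into one power series whose
    coefficients vanish by [kummer_coef_rec]. *)
Lemma kummer_ode (a : C) (c : R) (z : C) : (0 < c)%R ->
  z * kummer_dd a c z + (c - z) * kummer_d a c z - a * kummer a c z = 0.
Proof.
intros Hc. pose proof (kummer_coef_entire a c Hc) as H0.
pose proof (entire_deriv _ H0) as H1. pose proof (entire_deriv _ H1) as H2.
rewrite kummer_power_series. unfold kummer_d, kummer_dd.
set (u := kummer_coef a c) in *.
pose proof (entire_shift _ H2) as S2. pose proof (entire_shift _ H1) as S1.
pose proof (entire_scal c _ H1) as S3. pose proof (entire_scal (-1) _ S1) as S4.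
pose proof (entire_scal (- a) _ H0) as S5.
pose proof (entire_plus _ _ S2 S3) as S6. pose proof (entire_plus _ _ S6 S4) as S7.
match goal with |- ?l = _ => replace l with
  (z * power_series (deriv_coef (deriv_coef u)) z + c * power_series (deriv_coef u) z
   + -1 * (z * power_series (deriv_coef u) z) + - a * power_series u z) by ring end.
rewrite <- (power_series_shift _ z H2), <- (power_series_shift _ z H1).
rewrite <- (power_series_scal c _ z H1), <- (power_series_scal (-1) _ z S1), <- (power_series_scal (- a) _ z H0).
rewrite <- (power_series_plus _ _ z S2 S3), <- (power_series_plus _ _ z S6 S4), <- (power_series_plus _ _ z S7 S5).
assert (Z : forall n : nat, shift_coef (deriv_coef (deriv_coef u)) n + c * deriv_coef u n
   + -1 * shift_coef (deriv_coef u) n + - a * u n = 0).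
{ intros n. pose proof (kummer_coef_rec a c n Hc) as E. fold u in E.
  destruct n as [|n]; simpl shift_coef; unfold deriv_coef.
  - simpl INR in *. replace (0 + c * (1%R * u 1%nat) + -1 * 0 + - a * u 0%nat)
      with ((c + 0) * 1 * u 1%nat - (a + 0) * u 0%nat) by ring. rewrite E. ring.
  - rewrite !S_INR, !RtoC_plus in *.
    match goal with |- ?l = _ => replace l with
     ((c + (INR n + 1)) * (INR n + 1 + 1) * u (S (S n)) - (a + (INR n + 1)) * u (S n)) by ring end.
    rewrite E. ring. }
rewrite (power_series_tail_zero _ z).
- apply Z.
- intros n. rewrite Z. ring.
Qed.

(** * The exponential, psi1 and psi2 *)

Lemma Cexp_plus (z w : C) : Cexp (z + w) = Cexp z * Cexp w.
Proof.
unfold Cexp. destruct z as [x y], w as [u v].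
change (Re ((x, y) + (u, v))) with (x + u)%R. change (Im ((x, y) + (u, v))) with (y + v)%R.
unfold Re, Im, fst, snd.
rewrite exp_plus, cos_plus, sin_plus. unfold Cmult, fst, snd. f_equal; ring.
Qed.

Lemma Cmod_Cexp (z : C) : Cmod (Cexp z) = exp (Re z).
Proof.
unfold Cexp, Cmod, fst, snd.
pose proof (exp_pos (Re z)) as H.
replace ((exp (Re z) * cos (Im z)) ^ 2 + (exp (Re z) * sin (Im z)) ^ 2)%R with (exp (Re z) ^ 2)%R.
- apply sqrt_pow2; lra.
- pose proof (sin2_cos2 (Im z)) as T. unfold Rsqr in T.
  replace (exp (Re z) ^ 2)%R with (exp (Re z) ^ 2 * 1)%R by ring. rewrite <- T. ring.
Qed.

Lemma Cexp_0 : Cexp 0 = 1.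
Proof.
unfold Cexp; simpl. rewrite exp_0, cos_0, sin_0. unfold RtoC. f_equal; ring.
Qed.

Lemma Cexp_line_derive (h : C) (t : R) :
  is_path_derive (fun s : R => Cexp (s * h)) t (h * Cexp (t * h)).
Proof.
destruct h as [a b].
assert (E : forall s : R, Cexp (s * (a, b)) = ((exp (s * a) * cos (s * b))%R, (exp (s * a) * sin (s * b))%R)).
{ intros s. unfold Cexp, Cmult, RtoC, Re, Im, fst, snd. now rewrite !Rmult_0_l, Rminus_0_r, Rplus_0_r. }
apply is_path_derive_pair.
- apply (is_derive_ext (fun s => exp (s * a) * cos (s * b))%R); [intros s; now rewrite E|].
  rewrite E. unfold Cmult, Re, fst, snd. auto_derive; [easy|]. ring.
- apply (is_derive_ext (fun s => exp (s * a) * sin (s * b))%R); [intros s; now rewrite E|].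
  rewrite E. unfold Cmult, Im, fst, snd. auto_derive; [easy|]. ring.
Qed.

Lemma exp_le_compat (x y : R) : (x <= y)%R -> (exp x <= exp y)%R.
Proof. intros [H| ->]; [now apply Rlt_le, exp_increasing|apply Rle_refl]. Qed.

(** The mean value inequality is applied twice on the segment from 0 to [h], where [|Cexp|] stays
    below [exp 1]: first to [Cexp - 1], then to the full remainder. *)
Lemma Cexp_taylor_bound (h : C) : (Cmod h < 1)%R ->
  (Cmod (Cexp h - 1 - h) <= exp 1 * Cmod h ^ 2)%R.
Proof.
intros Hh. pose proof (Cmod_ge_0 h) as H0. pose proof (exp_pos 1) as He.
assert (Hexp : forall t : R, (0 <= t <= 1)%R -> (Cmod (Cexp (t * h)) <= exp 1)%R).
{ intros t Ht. rewrite Cmod_Cexp.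
  assert (Re (t * h) <= 1)%R; [|now apply exp_le_compat].
  eapply Rle_trans; [apply Rle_abs|]. eapply Rle_trans; [apply re_le_Cmod|].
  rewrite Cmod_mult, Cmod_R, Rabs_pos_eq by lra. nra. }
assert (first : forall t : R, (0 <= t <= 1)%R -> (Cmod (Cexp (t * h) - 1) <= exp 1 * Cmod h * t)%R).
{ intros t Ht.
  pose proof (mean_value_path (fun s : R => Cexp (s * h)) (fun s : R => h * Cexp (s * h))
    (fun s => exp 1 * Cmod h * s)%R (fun _ => exp 1 * Cmod h)%R 0 t (proj1 Ht)) as M.
  cbv beta in M. rewrite Cmult_0_l, Cexp_0 in M.
  eapply Rle_trans; [apply M|lra].
  intros x Hx. split; [apply Cexp_line_derive|split].
  - auto_derive; [easy|ring].
  - rewrite Cmod_mult, Rmult_comm. apply Rmult_le_compat_r; [easy|]. apply Hexp. lra. }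
pose proof (mean_value_path (fun s : R => Cexp (s * h) + - (0 + s * h)) (fun s : R => h * Cexp (s * h) + - h)
    (fun s => exp 1 * Cmod h ^ 2 * s)%R (fun _ => exp 1 * Cmod h ^ 2)%R 0 1 ltac:(lra)) as M.
cbv beta in M.
rewrite !Cmult_0_l, !Cmult_1_l, Cexp_0 in M.
replace (Cexp h - 1 - h) with (Cexp h + - (0 + h) - (1 + - (0 + 0))) by ring.
eapply Rle_trans; [apply M|lra].
intros x Hx. split; [|split].
- apply (is_derive_minus (K := R_AbsRing) (V := C_R_NormedModule) (fun s : R => Cexp (s * h)) (fun s : R => 0 + s * h)).
  + apply Cexp_line_derive.
  + apply is_path_derive_line.
- auto_derive; [easy|ring].
- replace (h * Cexp (x * h) + - h) with (h * (Cexp (x * h) - 1)) by ring.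
  rewrite Cmod_mult. specialize (first x Hx).
  apply Rle_trans with (Cmod h * (exp 1 * Cmod h * x))%R; [now apply Rmult_le_compat_l|].
  assert (0 <= exp 1 * Cmod h ^ 2)%R by (apply Rmult_le_pos; [lra|apply pow2_ge_0]). nra.
Qed.

Lemma is_Cderive_Cexp (z : C) : is_Cderive Cexp z (Cexp z).
Proof.
apply (is_Cderive_quad _ _ _ (Cmod (Cexp z) * exp 1) (mkposreal 1 Rlt_0_1)).
simpl pos. intros h Hh.
rewrite Cexp_plus.
replace (Cexp z * Cexp h - Cexp z - h * Cexp z) with (Cexp z * (Cexp h - 1 - h)) by ring.
rewrite Cmod_mult, Rmult_assoc. apply Rmult_le_compat_l; [apply Cmod_ge_0|].
now apply Cexp_taylor_bound.
Qed.

Lemma is_Cderive_gauss (z : C) :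
  is_Cderive (fun x : C => Cexp (- (x ^ 2 / 2))) z (- z * Cexp (- (z ^ 2 / 2))).
Proof.
eapply is_Cderive_eq.
- apply (is_Cderive_comp Cexp (fun x : C => - (x ^ 2 * / 2))); [apply is_Cderive_Cexp|].
  apply is_Cderive_opp, is_Cderive_mult; [apply is_Cderive_sqr|apply is_Cderive_const].
- cbv beta. unfold Cdiv. field.
Qed.

Lemma is_Cderive_kummer_sqr (a : C) (c : R) (z : C) : (0 < c)%R ->
  is_Cderive (fun x => kummer a c (x ^ 2)) z (2 * z * kummer_d a c (z ^ 2)) /\
  is_Cderive (fun x => kummer_d a c (x ^ 2)) z (2 * z * kummer_dd a c (z ^ 2)).
Proof.
intros Hc. destruct (kummer_derive a c (z ^ 2) Hc) as [H1 H2]. split.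
- now apply (is_Cderive_comp _ (fun x : C => x ^ 2)); [|apply is_Cderive_sqr].
- now apply (is_Cderive_comp _ (fun x : C => x ^ 2)); [|apply is_Cderive_sqr].
Qed.

(** The initial data, here (1, 0) and (0, 1) for [psi2], make [(c1, c2)] the Cauchy data of the
    combination at 0. *)
Lemma weber_psi1 (mu : C) : exists dpsi : C -> C,
  weber mu (psi1 mu) dpsi /\ psi1 mu 0 = 1 /\ dpsi 0 = 0.
Proof.
set (a := - ((1 + mu) / 4)).
assert (Ec : 1 / 2 = RtoC (1 / 2)) by now rewrite RtoC_div by lra.
set (c := (1 / 2)%R) in *. assert (Hc : (0 < c)%R) by (unfold c; lra).
exists (fun z => (2 * z * kummer_d a c (z ^ 2) - z * kummer a c (z ^ 2)) * Cexp (- (z ^ 2 / 2))).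
split; [|split].
- intros z. destruct (is_Cderive_kummer_sqr a c z Hc) as [K1 K2].
  pose proof (is_Cderive_gauss z) as Hg.
  split.
  + unfold psi1. fold a. rewrite Ec.
    eapply is_Cderive_eq; [apply is_Cderive_mult; [exact K1|exact Hg]|]. cbv beta. ring.
  + eapply is_Cderive_eq.
    * apply is_Cderive_mult; [|exact Hg]. apply is_Cderive_minus.
      -- apply is_Cderive_mult; [|exact K2]. apply is_Cderive_mult; [apply is_Cderive_const|apply is_Cderive_id].
      -- apply is_Cderive_mult; [apply is_Cderive_id|exact K1].
    * cbv beta. unfold psi1. fold a. rewrite Ec.
      pose proof (kummer_ode a c (z ^ 2) Hc) as O.
      set (k0 := kummer a c (z ^ 2)) in *. set (k1 := kummer_d a c (z ^ 2)) in *.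
      set (k2 := kummer_dd a c (z ^ 2)) in *. set (ex := Cexp (- (z ^ 2 / 2))).
      rewrite <- Ec in O.
      (* Under [w = z^2] the defect in Weber's equation is [4 exp (- z^2 / 2)] times that in
         Kummer's equation. *)
      match goal with |- ?l = ?r => replace l with
        (r + 4 * ex * (z ^ 2 * k2 + (1 / 2 - z ^ 2) * k1 - a * k0)) by (unfold a; field) end.
      rewrite O. ring.
- unfold psi1. fold a. replace (0 ^ 2) with (0 : C) by ring. rewrite kummer_0.
  replace (- (0 / 2)) with (0 : C) by field. rewrite Cexp_0. ring.
- ring.
Qed.

Lemma weber_psi2 (mu : C) : exists dpsi : C -> C,
  weber mu (psi2 mu) dpsi /\ psi2 mu 0 = 0 /\ dpsi 0 = 1.
Proof.
set (a := (1 - mu) / 4).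
assert (Ec : 3 / 2 = RtoC (3 / 2)) by now rewrite RtoC_div by lra.
set (c := (3 / 2)%R) in *. assert (Hc : (0 < c)%R) by (unfold c; lra).
exists (fun z => (kummer a c (z ^ 2) + z * (2 * z * kummer_d a c (z ^ 2)) - z * (z * kummer a c (z ^ 2)))
   * Cexp (- (z ^ 2 / 2))).
split; [|split].
- intros z. destruct (is_Cderive_kummer_sqr a c z Hc) as [K1 K2].
  pose proof (is_Cderive_gauss z) as Hg.
  split.
  + unfold psi2. fold a. rewrite Ec.
    eapply is_Cderive_eq; [apply is_Cderive_mult; [apply is_Cderive_mult; [apply is_Cderive_id|exact K1]|exact Hg]|].
    cbv beta. ring.
  + eapply is_Cderive_eq.
    * apply is_Cderive_mult; [|exact Hg]. apply is_Cderive_minus; [apply is_Cderive_plus; [exact K1|]|].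
      -- apply is_Cderive_mult; [apply is_Cderive_id|].
         apply is_Cderive_mult; [|exact K2]. apply is_Cderive_mult; [apply is_Cderive_const|apply is_Cderive_id].
      -- apply is_Cderive_mult; [apply is_Cderive_id|]. apply is_Cderive_mult; [apply is_Cderive_id|exact K1].
    * cbv beta. unfold psi2. fold a. rewrite Ec.
      pose proof (kummer_ode a c (z ^ 2) Hc) as O.
      set (k0 := kummer a c (z ^ 2)) in *. set (k1 := kummer_d a c (z ^ 2)) in *.
      set (k2 := kummer_dd a c (z ^ 2)) in *. set (ex := Cexp (- (z ^ 2 / 2))).
      rewrite <- Ec in O.
      match goal with |- ?l = ?r => replace l with
        (r + 4 * z * ex * (z ^ 2 * k2 + (3 / 2 - z ^ 2) * k1 - a * k0)) by (unfold a; field) end.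
      rewrite O. ring.
- unfold psi2. fold a. ring.
- replace (0 ^ 2) with (0 : C) by ring. rewrite kummer_0.
  replace (- (0 / 2)) with (0 : C) by field. rewrite Cexp_0. ring.
Qed.

Lemma weber_plus_scal (mu c1 c2 : C) (f df g dg : C -> C) :
  weber mu f df -> weber mu g dg ->
  weber mu (fun z => c1 * f z + c2 * g z) (fun z => c1 * df z + c2 * dg z).
Proof.
intros Hf Hg z. destruct (Hf z) as [F1 F2], (Hg z) as [G1 G2].
pose proof (is_Cderive_const c1 z) as K1. pose proof (is_Cderive_const c2 z) as K2.
split; eapply is_Cderive_eq.
- exact (is_Cderive_plus _ _ _ _ _ (is_Cderive_mult _ _ _ _ _ K1 F1) (is_Cderive_mult _ _ _ _ _ K2 G1)).
- cbv beta; ring.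
- exact (is_Cderive_plus _ _ _ _ _ (is_Cderive_mult _ _ _ _ _ K1 F2) (is_Cderive_mult _ _ _ _ _ K2 G2)).
- cbv beta; ring.
Qed.

(** Gronwall's argument on the segment from 0 to [z]: [N = |f|^2 + |df|^2] satisfies [N' <= L N], so
    [N exp (- L t)] cannot leave its initial value 0. *)
Lemma weber_zero (mu : C) (f df : C -> C) (z : C) :
  weber mu f df -> f 0 = 0 -> df 0 = 0 -> f z = 0.
Proof.
intros HW H0 H1.
set (K := (Cmod z * (Cmod z ^ 2 + Cmod (2 + mu)))%R).
set (L := (Cmod z + K)%R).
pose (ray := fun t : R => 0 + t * z).
set (N := fun t : R => (Cmod (f (ray t)) ^ 2 + Cmod (df (ray t)) ^ 2)%R).
set (dN := fun t : R => (2 * cdot (f (ray t)) (df (ray t) * z)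
   + 2 * cdot (df (ray t)) (((ray t ^ 2 - 2 - mu) * f (ray t)) * z))%R).
assert (M : (- (N 0 * exp (- L * 0)) <= - (N 1 * exp (- L * 1)))%R).
{ apply (nondecreasing_of_derive (fun t => - (N t * exp (- L * t)))%R
    (fun t => - ((dN t - L * N t) * exp (- L * t)))%R); [lra|].
  intros t Ht. destruct (HW (ray t)) as [D1 D2]. split.
  - apply (is_derive_opp (K := R_AbsRing) (V := R_NormedModule)).
    assert (E : is_derive (fun t => exp (- L * t)) t (- L * exp (- L * t))%R) by (auto_derive; [easy|ring]).
    assert (P : is_derive N t (dN t)).
    { apply (is_derive_plus (K := R_AbsRing) (V := R_NormedModule)); apply is_derive_Cmod2.
      - now apply (is_path_derive_ray f).
      - now apply (is_path_derive_ray df). }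
    evar_last; [apply (is_derive_mult (K := R_AbsRing)); [exact P|exact E|exact Rmult_comm]|].
    unfold plus, mult; simpl. ring.
  - pose proof (exp_pos (- L * t)) as Ex.
    assert (B : (dN t <= L * N t)%R); [|nra].
    unfold dN, N. set (y := ray t). set (p := Cmod (f y)). set (q := Cmod (df y)).
    assert (Hp : (0 <= p)%R) by apply Cmod_ge_0. assert (Hq : (0 <= q)%R) by apply Cmod_ge_0.
    pose proof (cdot_le (f y) (df y * z)) as C1. pose proof (cdot_le (df y) ((y ^ 2 - 2 - mu) * f y * z)) as C2.
    rewrite !Cmod_mult in C1. rewrite 2!Cmod_mult in C2. fold p q in C1, C2.
    pose proof (Rle_abs (cdot (f y) (df y * z))). pose proof (Rle_abs (cdot (df y) ((y ^ 2 - 2 - mu) * f y * z))).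
    assert (T : (Cmod (y ^ 2 - 2 - mu) <= Cmod z ^ 2 + Cmod (2 + mu))%R).
    { replace (y ^ 2 - 2 - mu) with (y ^ 2 + - (2 + mu)) by ring.
      eapply Rle_trans; [apply Cmod_triangle|]. rewrite Cmod_opp, Cmod_pow.
      apply Rplus_le_compat_r, pow_incr. split; [apply Cmod_ge_0|].
      unfold y, ray. rewrite Cplus_0_l, Cmod_mult, Cmod_R, Rabs_pos_eq by lra.
      pose proof (Cmod_ge_0 z). nra. }
    pose proof (Cmod_ge_0 z) as Hz.
    assert (T2 : (q * (Cmod (y ^ 2 - 2 - mu) * p * Cmod z) <= K * (p * q))%R).
    { unfold K. replace (q * (Cmod (y ^ 2 - 2 - mu) * p * Cmod z))%R with (Cmod (y ^ 2 - 2 - mu) * (p * q * Cmod z))%R by ring.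
      replace (Cmod z * (Cmod z ^ 2 + Cmod (2 + mu)) * (p * q))%R with ((Cmod z ^ 2 + Cmod (2 + mu)) * (p * q * Cmod z))%R by ring.
      apply Rmult_le_compat_r; [|easy]. apply Rmult_le_pos; [now apply Rmult_le_pos|easy]. }
    assert (T3 : (2 * (p * q) <= p ^ 2 + q ^ 2)%R) by (pose proof (pow2_ge_0 (p - q)); lra).
    assert (HL : (0 <= L)%R).
    { unfold L, K. pose proof (Cmod_ge_0 (2 + mu)). pose proof (pow2_ge_0 (Cmod z)).
      assert (0 <= Cmod z * (Cmod z ^ 2 + Cmod (2 + mu)))%R by (apply Rmult_le_pos; lra). lra. }
    apply (Rmult_le_compat_l L) in T3; [|easy]. unfold L in T3 |- *. lra. }
assert (N0 : N 0 = 0%R).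
{ unfold N. replace (ray 0%R) with (0 : C) by (unfold ray; ring). rewrite H0, H1, Cmod_0. ring. }
rewrite N0 in M. pose proof (exp_pos (- L * 1)) as Ex.
assert (N1 : (N 1 <= 0)%R) by nra.
unfold N in N1. replace (ray 1%R) with z in N1 by (unfold ray; ring).
apply Cmod_eq_0. pose proof (Cmod_ge_0 (f z)). pose proof (pow2_ge_0 (Cmod (df z))). nra.
Qed.

(** By uniqueness [psi] equals the power series solution with the same data at 0, so the termwise
    primitive of that series is one of [psi]. *)
Lemma weber_primitive (mu : C) (psi dpsi : C -> C) :
  weber mu psi dpsi -> exists prim : C -> C, forall z, is_Cderive prim z (psi z).
Proof.
intros HW. exists (weber_prim mu (psi 0) (dpsi 0)). intros z.
pose proof (weber_plus_scal mu 1 (-1) _ _ _ _ HW (weber_sol_spec mu (psi 0) (dpsi 0))) as HD.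
destruct (weber_sol_0 mu (psi 0) (dpsi 0)) as [S0 S1].
pose proof (weber_zero _ _ _ z HD) as Z. cbv beta in Z. rewrite S0, S1 in Z.
eapply is_Cderive_eq; [apply weber_prim_spec|].
replace (psi z) with (1 * psi z + -1 * weber_sol mu (psi 0) (dpsi 0) z + weber_sol mu (psi 0) (dpsi 0) z) by ring.
rewrite Z; ring.
Qed.

(** * Path integrals and the functions Upsilon *)

Lemma is_Cderive_continuous (f : C -> C) (z l : C) : is_Cderive f z l ->
  continuous (T := C_R_NormedModule) (U := C_R_NormedModule) f z.
Proof.
intros H. rewrite is_Cderive_spec in H.
intros P HP. change (locally (f z) P) in HP. rewrite locally_C in HP.
destruct HP as [eps He].
destruct (H (mkposreal 1 Rlt_0_1)) as [delta Hd]. simpl pos in Hd.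
pose proof (Cmod_ge_0 l) as Hl.
assert (Hq : (0 < Rmin delta (eps / (Cmod l + 2)))%R).
{ apply Rmin_glb_lt; [apply cond_pos|apply Rdiv_lt_0_compat; [apply cond_pos|lra]]. }
unfold filtermap. apply locally_C.
exists (mkposreal _ Hq). intros y Hy.
change (Cmod (y - z) < Rmin delta (eps / (Cmod l + 2)))%R in Hy.
apply He. change (Cmod (f y - f z) < eps)%R.
specialize (Hd _ (Rlt_le_trans _ _ _ Hy (Rmin_l _ _))). rewrite sub_Cplus_cancel in Hd.
assert (H2 := Rlt_le_trans _ _ _ Hy (Rmin_r _ _)).
apply (Rmult_lt_compat_r (Cmod l + 2)) in H2; [|lra].
replace (eps / (Cmod l + 2) * (Cmod l + 2))%R with (pos eps) in H2 by (field; lra).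
assert (T := Cmod_triangle (f y - f z - (y - z) * l) ((y - z) * l)).
set (w := y - z) in *.
replace (f y - f z - w * l + w * l) with (f y - f z) in T by ring.
rewrite Cmod_mult in T. pose proof (Cmod_ge_0 w). lra.
Qed.

(** The fundamental theorem of calculus for [F] along [gamma]; it is also what makes the value
    independent of the chosen path. *)
Lemma path_integral_primitive (f F : C -> C) (a b : C) (gamma : R -> C) :
  (forall z, is_Cderive F z (f z)) ->
  (forall z, continuous (T := C_R_NormedModule) (U := C_R_NormedModule) f z) ->
  C1_path a b gamma -> path_integral f gamma = F b - F a.
Proof.
intros HF Hf (<- & <- & Hg).
apply (is_RInt_unique (V := C_R_CompleteNormedModule)).
apply (is_RInt_derive (V := C_R_CompleteNormedModule) (fun t => F (gamma t)) (fun t => f (gamma t) * velocity gamma t)).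
- intros t Ht. rewrite Rmin_left, Rmax_right in Ht by lra.
  destruct (Hg t Ht) as [[v Hv] _].
  replace (velocity gamma t) with v.
  + apply (is_path_derive_comp F gamma); [apply HF|exact Hv].
  + symmetry. apply injective_projections; apply is_derive_unique.
    * now apply is_path_derive_Re.
    * now apply is_path_derive_Im.
- intros t Ht. rewrite Rmin_left, Rmax_right in Ht by lra.
  destruct (Hg t Ht) as [[v Hv] Hc].
  assert (Hgam : continuous (U := C_R_NormedModule) gamma t).
  { apply (ex_derive_continuous (V := C_R_NormedModule)). now exists v. }
  assert (Hfg : continuous (U := C_R_NormedModule) (fun t => f (gamma t)) t).
  { apply (continuous_comp gamma f); [exact Hgam|apply Hf]. }
  set (u := fun t => f (gamma t)) in *. set (w := velocity gamma) in *.
  assert (Pr : forall p : R -> C, continuous (U := C_R_NormedModule) p t ->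
     continuous (U := R_UniformSpace) (fun s => Re (p s)) t /\ continuous (U := R_UniformSpace) (fun s => Im (p s)) t).
  { intros p Hp. split.
    - apply (continuous_comp (V := C_R_NormedModule) p fst); [exact Hp|apply continuous_fst].
    - apply (continuous_comp (V := C_R_NormedModule) p snd); [exact Hp|apply continuous_snd]. }
  destruct (Pr u Hfg) as [u1 u2]. destruct (Pr w Hc) as [w1 w2].
  apply (continuous_comp_2 (V := R_UniformSpace) (W := R_UniformSpace) (X := C_R_NormedModule)
    (fun s => Re (u s) * Re (w s) - Im (u s) * Im (w s))%R
    (fun s => Re (u s) * Im (w s) + Im (u s) * Re (w s))%R (fun x y => (x, y))).
  + apply (continuous_minus (V := R_NormedModule)); now apply (continuous_mult (K := R_AbsRing)).
  + apply (continuous_plus (V := R_NormedModule)); now apply (continuous_mult (K := R_AbsRing)).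
  + apply (continuous_ext (fun q : R * R => q)); [now intros [x y]|apply continuous_id].
Qed.

(** Weber's equation gives [xi^2 psi = psi'' + (2 + mu) psi], so the integrand has an explicit
    primitive. The boundary term at [eta_star] cancels against the subtracted
    [psi' (eta_star) / 2]. *)
Lemma Upsilon_of_formula (mu eta_star eta : C) (psi dpsi prim : C -> C) (gamma : C -> R -> C) :
  weber mu psi dpsi -> (forall z, is_Cderive prim z (psi z)) ->
  C1_path eta_star eta (gamma eta) ->
  Upsilon_of psi eta_star gamma eta =
    ((eta ^ 2 - mu) * (prim eta - prim eta_star) - dpsi eta) / 2.
Proof.
intros HW HE Hg. unfold Upsilon_of.
rewrite (is_Cderive_C_derive psi eta_star (dpsi eta_star)) by apply HW.
assert (Hpoly : forall z, is_Cderive (fun x : C => 1 + (eta ^ 2 - x ^ 2) * / 2) z (- z)).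
{ intros z. eapply is_Cderive_eq.
  - apply is_Cderive_plus; [apply is_Cderive_const|].
    apply is_Cderive_mult; [|apply is_Cderive_const].
    apply is_Cderive_minus; [apply is_Cderive_const|apply is_Cderive_sqr].
  - cbv beta. field. }
rewrite (path_integral_primitive _
  (fun x => (1 + eta ^ 2 / 2) * prim x - / 2 * (dpsi x + (2 + mu) * prim x)) eta_star eta (gamma eta)); [| | |exact Hg].
- field.
- intros z. destruct (HW z) as [H1 H2]. eapply is_Cderive_eq.
  + apply is_Cderive_minus; apply is_Cderive_mult; [apply is_Cderive_const|apply HE|apply is_Cderive_const|].
    apply is_Cderive_plus; [exact H2|]. apply is_Cderive_mult; [apply is_Cderive_const|apply HE].
  + cbv beta. field.
- intros z. destruct (HW z) as [H1 _].
  apply (is_Cderive_continuous _ z _ (is_Cderive_mult _ _ z _ _ (Hpoly z) H1)).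
Qed.

Lemma sqr_neq_of_large (mu z : C) : (Cmod mu + 1 < Cmod z)%R -> z ^ 2 - mu <> 0.
Proof.
intros Hz E.
assert (E2 : z ^ 2 = mu) by (replace (z ^ 2) with (z ^ 2 - mu + mu) by ring; rewrite E; ring).
apply (f_equal Cmod) in E2. rewrite Cmod_pow in E2. pose proof (Cmod_ge_0 mu). nra.
Qed.

(** After division by [mu - eta^2], the term with [c0] and the values at [eta_star] are constants
    and merge into the primitive; the remaining factor is -1/2. *)
Lemma ratio_reduced (mu eta_star c0 c1 c2 eta : C) (gamma1 gamma2 : C -> R -> C)
    (dpsi1 dpsi2 prim1 prim2 : C -> C) :
  weber mu (psi1 mu) dpsi1 -> weber mu (psi2 mu) dpsi2 ->
  (forall z, is_Cderive prim1 z (psi1 mu z)) -> (forall z, is_Cderive prim2 z (psi2 mu z)) ->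
  C1_path eta_star eta (gamma1 eta) -> C1_path eta_star eta (gamma2 eta) ->
  eta ^ 2 - mu <> 0 ->
  (ratio mu eta_star c0 c1 c2 gamma1 gamma2 eta =
  Cmod (reduced mu
    (fun z => c1 * prim1 z + c2 * prim2 z - (c1 * prim1 eta_star + c2 * prim2 eta_star + 2 * c0))%C
    (fun z => c1 * dpsi1 z + c2 * dpsi2 z)%C eta) / 2)%R.
Proof.
intros W1 W2 E1 E2 G1 G2 Hq. unfold ratio, Upsilon, reduced.
rewrite (Upsilon_of_formula mu _ _ _ _ _ _ W1 E1 G1), (Upsilon_of_formula mu _ _ _ _ _ _ W2 E2 G2).
assert (Hq' : mu - eta ^ 2 <> 0).
{ intros E. apply Hq. replace (eta ^ 2 - mu) with (- (mu - eta ^ 2)) by ring. rewrite E; ring. }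
match goal with |- _ = (Cmod ?r / 2)%R => set (q := r) end.
replace (Cmod q / 2)%R with (Cmod (- (q / 2))).
- f_equal. unfold q. field. now split.
- assert (T : RtoC 2 <> 0) by (intros E; apply RtoC_inj in E; lra).
  rewrite Cmod_opp, Cmod_div, Cmod_R, Rabs_pos_eq by (easy || lra). easy.
Qed.

(** * Reflection, and the alternative between growth and decay *)

Lemma is_Cderive_flip (f : C -> C) (z l : C) :
  is_Cderive f (- z) l -> is_Cderive (fun x => f (- x)) z (- l).
Proof.
intros H. eapply is_Cderive_eq.
- apply (is_Cderive_comp f Copp); [exact H|]. apply (is_Cderive_opp (fun x => x)), is_Cderive_id.
- ring.
Qed.

Lemma weber_flip (mu : C) (psi dpsi : C -> C) :
  weber mu psi dpsi -> weber mu (fun z => psi (- z)) (fun z => - dpsi (- z)).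
Proof.
intros HW z. destruct (HW (- z)) as [H1 H2]. split.
- now apply is_Cderive_flip.
- eapply is_Cderive_eq; [apply is_Cderive_opp, is_Cderive_flip; exact H2|]. ring.
Qed.

(** Only arbitrarily large [x] are asked for: [reduced_growth] starts from a single point, but
    beyond a threshold that depends on the opening of the sector. *)
Definition dominant (psi dpsi : C -> C) : Prop :=
  forall x0 : R, exists x : R, (x0 <= x)%R /\
    (Cmod (ladder_down psi dpsi x) < Cmod (ladder_up psi dpsi x))%R.

Lemma recessive_of_not_dominant (mu : C) (psi dpsi : C -> C) :
  weber mu psi dpsi -> ~ dominant psi dpsi -> decays_right psi /\ decays_right dpsi.
Proof.
intros HW H. apply not_all_ex_not in H. destruct H as [x0 H].
apply (recessive_decays mu psi dpsi x0 HW).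
intros x Hx. apply Rnot_lt_le. intros L. apply H. now exists x.
Qed.

Lemma dominant_or_decays (mu : C) (psi dpsi : C -> C) :
  weber mu psi dpsi ->
  dominant psi dpsi \/ dominant (fun z => psi (- z)) (fun z => - dpsi (- z)) \/
  (decays psi /\ decays dpsi).
Proof.
intros HW.
destruct (classic (dominant psi dpsi)) as [H|H]; [now left|right].
destruct (classic (dominant (fun z => psi (- z)) (fun z => - dpsi (- z)))) as [H'|H']; [now left|right].
destruct (recessive_of_not_dominant mu _ _ HW H) as [A1 A2].
destruct (recessive_of_not_dominant mu _ _ (weber_flip _ _ _ HW) H') as [B1 B2].
split; apply decays_both; try easy.
apply (decays_right_le _ _ 0) with (2 := B2). intros x _. rewrite Cmod_opp. apply Rle_refl.
Qed.

Lemma is_lim_right_p_infty (f : C -> R) :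
  (forall alpha M : R, (alpha < PI / 4)%R -> exists L : R, forall z : C,
     (L < Cmod z)%R -> (Rabs (Carg z) <= alpha)%R -> (M < f z)%R) ->
  is_lim_right f p_infty.
Proof.
intros H alpha Ha P [M HM]. destruct (H alpha M Ha) as [L HL].
exists L. intros z Hz Harg. now apply HM, HL.
Qed.

Lemma is_lim_right_finite (f : C -> R) (l : R) :
  (forall alpha eps : R, (alpha < PI / 4)%R -> (0 < eps)%R -> exists L : R, forall z : C,
     (L < Cmod z)%R -> (Rabs (Carg z) <= alpha)%R -> (Rabs (f z - l) < eps)%R) ->
  is_lim_right f l.
Proof.
intros H alpha Ha P [eps HP]. destruct (H alpha eps Ha (cond_pos eps)) as [L HL].
exists L. intros z Hz Harg. now apply HP, HL.
Qed.

Lemma is_lim_left_flip (f : C -> R) (l : Rbar) :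
  is_lim_right (fun z => f (- z)) l -> is_lim_left f l.
Proof.
intros H alpha Ha P HP. destruct (H alpha Ha P HP) as [L HL].
exists L. intros z Hz Harg. specialize (HL (- z)). rewrite Cmod_opp in HL.
specialize (HL Hz Harg). now replace (- - z) with z in HL by ring.
Qed.

Lemma reduced_flip (mu : C) (prim dpsi : C -> C) (z : C) :
  reduced mu (fun z => - prim (- z)) (fun z => - dpsi (- z)) z = - reduced mu prim dpsi (- z).
Proof. unfold reduced. replace ((- z) ^ 2) with (z ^ 2) by ring. ring. Qed.

Lemma is_Cderive_flip_primitive (prim psi : C -> C) :
  (forall z, is_Cderive prim z (psi z)) ->
  forall z, is_Cderive (fun z => - prim (- z)) z (psi (- z)).
Proof.
intros H z. eapply is_Cderive_eq; [apply is_Cderive_opp, is_Cderive_flip, H|]. ring.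
Qed.

(** The left sector is the right one for the reflected solution, whose primitive is [- prim (- z)];
    thus one growth argument [G] covers both sides. *)
Lemma growth_of_not_decays (mu : C) (prim psi dpsi : C -> C) (f : C -> R) :
  weber mu psi dpsi -> (forall z, is_Cderive prim z (psi z)) ->
  (forall z, z ^ 2 - mu <> 0 -> f z = (Cmod (reduced mu prim dpsi z) / 2)%R) ->
  ~ (decays psi /\ decays dpsi) ->
  is_lim_right f p_infty \/ is_lim_left f p_infty.
Proof.
intros HW HE Hf Hd.
assert (G : forall (p ps dp : C -> C) (k : C -> R), weber mu ps dp ->
  (forall z, is_Cderive p z (ps z)) -> dominant ps dp ->
  (forall z, z ^ 2 - mu <> 0 -> k z = (Cmod (reduced mu p dp z) / 2)%R) ->
  is_lim_right k p_infty).
{ intros p ps dp k W E D Hk. apply is_lim_right_p_infty. intros alpha M Ha.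
  destruct (sector_growth mu p ps dp W E D alpha (2 * M) Ha) as [L HL].
  exists (Rmax L (Cmod mu + 1)). intros z Hz Harg.
  specialize (HL z (Rle_lt_trans _ _ _ (Rmax_l _ _) Hz) Harg).
  rewrite Hk by apply sqr_neq_of_large, (Rle_lt_trans _ _ _ (Rmax_r _ _) Hz). lra. }
destruct (dominant_or_decays mu psi dpsi HW) as [D|[D|D]]; [left|right|easy].
- exact (G prim psi dpsi f HW HE D Hf).
- apply is_lim_left_flip.
  apply (G _ _ _ (fun z => f (- z)) (weber_flip _ _ _ HW) (is_Cderive_flip_primitive _ _ HE) D).
  intros z Hz. rewrite reduced_flip, Cmod_opp. apply Hf.
  replace ((- z) ^ 2) with (z ^ 2) by ring. easy.
Qed.

(** * The case mu = -1 *)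

Definition gauss (z : C) : C := Cexp (- (z ^ 2 / 2)).

Lemma gauss_real (x : R) : gauss x = exp (- (x ^ 2 / 2)).
Proof.
unfold gauss. replace (- (x ^ 2 / 2)) with (RtoC (- (x ^ 2 / 2))).
- unfold Cexp, RtoC, Re, Im, fst, snd. rewrite cos_0, sin_0. f_equal; ring.
- rewrite RtoC_opp, RtoC_div, RtoC_pow by lra. easy.
Qed.

Lemma exp_neg_le_inv (u : R) : (0 < u)%R -> (exp (- u) <= / u)%R.
Proof.
intros Hu. rewrite exp_Ropp. apply Rinv_le_contravar; [easy|].
pose proof (exp_ineq1 u). lra.
Qed.

Lemma Cmod_gauss (z : C) : Cmod (gauss z) = exp (- (Re (z ^ 2) / 2)).
Proof.
unfold gauss. rewrite Cmod_Cexp. f_equal. destruct (z ^ 2) as [x y].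
unfold Re, Copp, Cdiv, Cmult, Cinv, RtoC, fst, snd. field.
Qed.

Lemma Cmod_gauss_le (z : C) (k : R) : (0 < k)%R -> (k <= Re (z ^ 2))%R ->
  (Cmod (gauss z) <= 2 / k)%R.
Proof.
intros Hk Hz. rewrite Cmod_gauss.
apply Rle_trans with (exp (- (k / 2))); [apply exp_le_compat; lra|].
replace (2 / k)%R with (/ (k / 2))%R by (field; lra). apply exp_neg_le_inv; lra.
Qed.

Lemma Cmod_le_Re_Im (z : C) : (Cmod z <= Rabs (Re z) + Rabs (Im z))%R.
Proof.
destruct z as [x y].
replace (Cmod (x, y)) with (Cmod (x + Ci * y))
  by (f_equal; unfold Ci, Cplus, Cmult, RtoC, fst, snd; f_equal; ring).
eapply Rle_trans; [apply Cmod_triangle|]. rewrite Cmod_mult, Cmod_Ci, !Cmod_R. simpl. lra.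
Qed.

(** The crude bound [2 / t^2] for the Gaussian is integrable at infinity and has the explicit
    primitive [- 2 / t]. *)
Lemma gauss_primitive_cauchy (F : C -> C) (x y : R) :
  (forall z, is_Cderive F z (gauss z)) -> (0 < x)%R -> (x <= y)%R ->
  (Cmod (F y - F x) <= 2 / x)%R.
Proof.
intros HF Hx Hxy.
pose proof (mean_value_path (fun t : R => F t) (fun t : R => gauss t) (fun t => - (2 / t))%R (fun t => 2 / t ^ 2)%R x y Hxy) as M.
cbv beta in M.
assert (0 < 2 / y)%R by (apply Rdiv_lt_0_compat; lra).
eapply Rle_trans; [apply M|lra].
intros t Ht. split; [apply is_path_derive_real, HF|split].
- auto_derive; [lra|field; lra].
- apply Cmod_gauss_le; [apply pow_lt; lra|].
  rewrite <- RtoC_pow. apply Rle_refl.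
Qed.

Lemma gauss_primitive_increasing (F : C -> C) (x y : R) :
  (forall z, is_Cderive F z (gauss z)) -> (x <= y)%R -> (Re (F x) <= Re (F y))%R.
Proof.
intros HF Hxy.
apply (nondecreasing_of_derive (fun t : R => Re (F t)) (fun t : R => Re (gauss t))); [easy|].
intros t _. split.
- apply (is_path_derive_Re (fun t : R => F t)), is_path_derive_real, HF.
- rewrite gauss_real. apply Rlt_le, exp_pos.
Qed.

(** On [-1, 1] the Gaussian is at least [exp (- 1/2)]. This is the strict gain that later separates
    the limits in the two sectors. *)
Lemma gauss_primitive_lt (F : C -> C) :
  (forall z, is_Cderive F z (gauss z)) -> (Re (F (-1)) < Re (F 1))%R.
Proof.
intros HF.
assert (Re (F (RtoC (-1))) - exp (- (1 / 2)) * -1 <= Re (F 1) - exp (- (1 / 2)) * 1)%R.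
{ apply (nondecreasing_of_derive (fun t : R => Re (F t) - exp (- (1 / 2)) * t)%R
    (fun t : R => Re (gauss t) - exp (- (1 / 2)))%R); [lra|].
  intros t Ht. split.
  - apply (is_derive_minus (K := R_AbsRing) (V := R_NormedModule)).
    + apply (is_path_derive_Re (fun t : R => F t)), is_path_derive_real, HF.
    + auto_derive; [easy|ring].
  - rewrite gauss_real. change (0 <= exp (- (t ^ 2 / 2)) - exp (- (1 / 2)))%R.
    assert (exp (- (1 / 2)) <= exp (- (t ^ 2 / 2)))%R by (apply exp_le_compat; nra). lra. }
pose proof (exp_pos (- (1 / 2))). lra.
Qed.

Lemma lim_seq_dist_le (u : nat -> R) (l a eps : R) (N : nat) :
  is_lim_seq u l -> (forall n, (N <= n)%nat -> (Rabs (u n - a) <= eps)%R) ->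
  (Rabs (l - a) <= eps)%R.
Proof.
intros Hu H. apply Rabs_le_between'. split.
- apply (is_lim_seq_le_loc (fun _ => (a - eps)%R) u (a - eps)%R l); [|apply is_lim_seq_const|easy].
  exists N. intros n Hn. specialize (H n Hn). apply Rabs_le_between' in H. lra.
- apply (is_lim_seq_le_loc u (fun _ => (a + eps)%R) l (a + eps)%R); [|easy|apply is_lim_seq_const].
  exists N. intros n Hn. specialize (H n Hn). apply Rabs_le_between' in H. lra.
Qed.

Lemma gauss_primitive_limit (F : C -> C) :
  (forall z, is_Cderive F z (gauss z)) ->
  exists L : C, (Re (F 1) <= Re L)%R /\
    forall x : R, (0 < x)%R -> (Cmod (F x - L) <= 4 / x)%R.
Proof.
intros HF.
assert (Cau : forall p : C -> R, (forall a b : C, (Rabs (p a - p b) <= Cmod (a - b))%R) ->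
  exists l : R, is_lim_seq (fun n => p (F (INR n))) l).
{ intros p Hp. apply ex_lim_seq_cauchy_corr. intros eps.
  destruct (nat_above (2 / eps + 1)) as [N HN].
  assert (He := cond_pos eps).
  assert (H2 : (0 < 2 / eps)%R) by (apply Rdiv_lt_0_compat; lra).
  assert (HN2 : (2 / INR N < eps)%R).
  { apply Rmult_lt_reg_r with (INR N); [lra|]. replace (2 / INR N * INR N)%R with 2%R by (field; lra).
    replace 2%R with (eps * (2 / eps))%R by (field; lra). apply Rmult_lt_compat_l; lra. }
  assert (B : forall n m, (N <= n)%nat -> (n <= m)%nat -> (Rabs (p (F (INR m)) - p (F (INR n))) < eps)%R).
  { intros n m Hn Hm. apply le_INR in Hn, Hm.
    eapply Rle_lt_trans; [apply Hp|]. eapply Rle_lt_trans; [apply gauss_primitive_cauchy; try easy; lra|].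
    eapply Rle_lt_trans; [|exact HN2]. apply Rmult_le_compat_l; [lra|]. apply Rinv_le_contravar; lra. }
  exists N. intros n m Hn Hm. destruct (Nat.le_ge_cases n m) as [T|T].
  - rewrite Rabs_minus_sym. now apply B.
  - now apply B. }
destruct (Cau Re) as [l1 H1].
{ intros a b. replace (Re a - Re b)%R with (Re (a - b)) by (destruct a, b; reflexivity). apply re_le_Cmod. }
destruct (Cau Im) as [l2 H2].
{ intros a b. replace (Im a - Im b)%R with (Im (a - b)) by (destruct a, b; reflexivity). apply im_le_Cmod. }
exists (l1, l2). split.
- apply (is_lim_seq_le_loc (fun _ => Re (F 1)) (fun n => Re (F (INR n))) (Re (F 1)) l1); [|apply is_lim_seq_const|exact H1].
  exists 1%nat. intros n Hn. apply le_INR in Hn. now apply (gauss_primitive_increasing F 1 (INR n)).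
- intros x Hx. destruct (nat_above x) as [N HN].
  assert (B : forall n, (N <= n)%nat -> (Cmod (F (INR n) - F x) <= 2 / x)%R).
  { intros n Hn. apply le_INR in Hn. apply gauss_primitive_cauchy; try easy; lra. }
  rewrite <- Cmod_opp. eapply Rle_trans; [apply Cmod_le_Re_Im|].
  assert (D1 : (Rabs (l1 - Re (F x)) <= 2 / x)%R).
  { apply (lim_seq_dist_le _ _ _ _ N H1). intros n Hn. eapply Rle_trans; [|apply (B n Hn)].
    replace (Re (F (INR n)) - Re (F x))%R with (Re (F (INR n) - F x)) by (destruct (F (INR n)), (F x); reflexivity). apply re_le_Cmod. }
  assert (D2 : (Rabs (l2 - Im (F x)) <= 2 / x)%R).
  { apply (lim_seq_dist_le _ _ _ _ N H2). intros n Hn. eapply Rle_trans; [|apply (B n Hn)].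
    replace (Im (F (INR n)) - Im (F x))%R with (Im (F (INR n) - F x)) by (destruct (F (INR n)), (F x); reflexivity). apply im_le_Cmod. }
  replace (Re (- (F x - (l1, l2)))) with (l1 - Re (F x))%R by (destruct (F x); simpl; ring).
  replace (Im (- (F x - (l1, l2)))) with (l2 - Im (F x))%R by (destruct (F x); simpl; ring).
  replace (4 / x)%R with (2 / x + 2 / x)%R by (field; lra). lra.
Qed.

(** On the vertical segment from [Re z] to [z] the real part of the square is smallest at [z], so
    the Gaussian is at most [2 / k] there, and the length is [|Im z| <= |z|]. *)
Lemma gauss_vertical (F : C -> C) (z : C) (k : R) :
  (forall z, is_Cderive F z (gauss z)) -> (0 < k)%R -> (k <= Re (z ^ 2))%R ->
  (Cmod (F z - F (Re z)) <= 2 / k * Cmod z)%R.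
Proof.
intros HF Hk Hz. destruct z as [x y]. simpl Re.
pose proof (mean_value_path (fun t : R => F (x + t * (Ci * y))) (fun t : R => gauss (x + t * (Ci * y)) * (Ci * y))
  (fun t => 2 / k * Cmod (x, y) * t)%R (fun t => 2 / k * Cmod (x, y))%R 0 1 ltac:(lra)) as M.
cbv beta in M.
replace (x + 1%R * (Ci * y)) with (x, y) in M
  by (unfold Ci, Cplus, Cmult, RtoC, fst, snd; f_equal; ring).
replace (x + 0%R * (Ci * y)) with (RtoC x) in M by ring.
eapply Rle_trans; [apply M|apply Req_le; ring].
intros t Ht. split; [apply is_path_derive_ray, HF|split].
- auto_derive; [easy|ring].
- rewrite Cmod_mult. apply Rmult_le_compat; try apply Cmod_ge_0.
  + apply Cmod_gauss_le; [easy|]. eapply Rle_trans; [exact Hz|].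
    assert (E1 : Re ((x, y) ^ 2) = (x ^ 2 - y ^ 2)%R) by (simpl; ring).
    assert (E2 : Re ((x + t * (Ci * y)) ^ 2) = (x ^ 2 - t ^ 2 * y ^ 2)%R) by (simpl; ring).
    rewrite E1, E2. pose proof (pow2_ge_0 y). assert (t ^ 2 <= 1)%R by nra. nra.
  + rewrite Cmod_mult, Cmod_Ci, Cmod_R, Rmult_1_l. apply (im_le_Cmod (x, y)).
Qed.

Lemma gauss_reduced_limit (F : C -> C) (c k : C) :
  (forall z, is_Cderive F z (gauss z)) ->
  exists L : C, (Re (F 1) <= Re L)%R /\
    forall alpha eps : R, (alpha < PI / 4)%R -> (0 < eps)%R -> exists M : R, forall z : C,
     (M < Cmod z)%R -> (Rabs (Carg z) <= alpha)%R ->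
     (Cmod (reduced (-1) (fun z => c * F z + k)%C (fun z => c * (- z * gauss z))%C z - (c * L + k)) < eps)%R.
Proof.
intros HF. destruct (gauss_primitive_limit F HF) as (L & HL1 & HL).
exists L. split; [easy|]. intros alpha eps Ha He.
destruct (sector_steep alpha Ha) as (kappa & Hk & Hsec).
(* In units of [1 / r]: [2 / kappa] for the vertical segment, [4 / kappa] for the tail on the real
   line, and 2 for the term with the derivative of the Gaussian. *)
set (A := (6 / kappa + 2)%R).
assert (HA : (2 < A)%R) by (unfold A; assert (0 < 6 / kappa)%R by (apply Rdiv_lt_0_compat; lra); lra).
pose proof (Cmod_ge_0 c) as Hc.
exists (Rmax 2 (Cmod c * A / eps)). intros z Hz Harg.
assert (Z1 := Rle_lt_trans _ _ _ (Rmax_l _ _) Hz). assert (Z2 := Rle_lt_trans _ _ _ (Rmax_r _ _) Hz).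
assert (Hz0 : z <> 0) by (apply Cmod_gt_0; lra).
destruct (Hsec z Hz0 Harg) as [S1 S2].
set (r := Cmod z) in *.
assert (Hkr : (0 < kappa * r)%R) by (apply Rmult_lt_0_compat; lra).
assert (Hkr2 : (0 < kappa * r ^ 2)%R) by (apply Rmult_lt_0_compat; [lra|apply pow_lt; lra]).
assert (B1 : (Cmod (F z - F (Re z)) <= 2 / (kappa * r))%R).
{ eapply Rle_trans; [apply (gauss_vertical F z (kappa * r ^ 2) HF Hkr2 S2)|].
  fold r. apply Req_le. field. lra. }
assert (B2 : (Cmod (F (Re z) - L) <= 4 / (kappa * r))%R).
{ eapply Rle_trans; [apply HL; lra|]. apply Rmult_le_compat_l; [lra|]. apply Rinv_le_contravar; lra. }
assert (B3 : (Cmod (F z - L) <= 6 / kappa / r)%R).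
{ replace (F z - L) with ((F z - F (Re z)) + (F (Re z) - L)) by ring.
  eapply Rle_trans; [apply Cmod_triangle|].
  replace (6 / kappa / r)%R with (2 / (kappa * r) + 4 / (kappa * r))%R by (field; lra). lra. }
assert (Q : (r ^ 2 / 2 <= Cmod (z ^ 2 - -1))%R).
{ pose proof (Cmod_triangle (z ^ 2 - -1) (-1)) as T. replace (z ^ 2 - -1 + -1) with (z ^ 2) in T by ring.
  rewrite Cmod_pow, Cmod_R, Rabs_left in T by lra. fold r in T. nra. }
assert (Hr2 : (0 < r ^ 2 / 2)%R) by nra.
assert (Hq : z ^ 2 - -1 <> 0) by (apply Cmod_gt_0; lra).
assert (G1 : (Cmod (gauss z) <= 1)%R).
{ rewrite Cmod_gauss, <- exp_0. apply exp_le_compat. lra. }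
assert (B4 : (Cmod (- z * gauss z * / (z ^ 2 - -1)) <= 2 / r)%R).
{ rewrite !Cmod_mult, Cmod_opp, Cmod_inv by easy. fold r.
  apply Rle_trans with (r * 1 * / (r ^ 2 / 2))%R.
  - apply Rmult_le_compat.
    + apply Rmult_le_pos; [lra|apply Cmod_ge_0].
    + apply Rlt_le, Rinv_0_lt_compat; lra.
    + apply Rmult_le_compat_l; lra.
    + apply Rinv_le_contravar; lra.
  - apply Req_le. field. lra. }
unfold reduced.
replace (c * F z + k - c * (- z * gauss z) * / (z ^ 2 - -1) - (c * L + k))
  with (c * ((F z - L) + - (- z * gauss z * / (z ^ 2 - -1)))) by ring.
rewrite Cmod_mult.
assert (B5 : (Cmod ((F z - L) + - (- z * gauss z * / (z ^ 2 - -1))) <= A / r)%R).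
{ eapply Rle_trans; [apply Cmod_triangle|]. rewrite Cmod_opp.
  replace (A / r)%R with (6 / kappa / r + 2 / r)%R by (unfold A; field; lra). lra. }
apply Rle_lt_trans with (Cmod c * (A / r))%R; [now apply Rmult_le_compat_l|].
apply Rmult_lt_reg_r with r; [lra|].
replace (Cmod c * (A / r) * r)%R with (Cmod c * A)%R by (field; lra).
apply (Rmult_lt_compat_l eps) in Z2; [|easy].
replace (eps * (Cmod c * A / eps))%R with (Cmod c * A)%R in Z2 by (field; lra). lra.
Qed.

Lemma Cmod_dist_le (x y : C) : (Rabs (Cmod x - Cmod y) <= Cmod (x - y))%R.
Proof.
apply Rabs_le_between'. split.
- pose proof (Cmod_triangle x (- (x - y))) as T. rewrite Cmod_opp in T.
  replace (x + - (x - y)) with y in T by ring. lra.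
- pose proof (Cmod_triangle y (x - y)) as T. replace (y + (x - y)) with x in T by ring. lra.
Qed.

(** In the two sectors the limits are half the moduli of [c L + k] and [c L' - k], where [L']
    belongs to the reflected primitive [- F (- z)]. Both vanish only if [L + L' = 0]. *)
Lemma gauss_limits (F : C -> C) (c k : C) (f : C -> R) :
  (forall z, is_Cderive F z (gauss z)) -> c <> 0 ->
  (forall z, z ^ 2 - -1 <> 0 ->
     f z = (Cmod (reduced (-1) (fun z => c * F z + k)%C (fun z => c * (- z * gauss z))%C z) / 2)%R) ->
  (exists l : Rbar, l <> Finite 0 /\ is_lim_right f l) \/
  (exists l : Rbar, l <> Finite 0 /\ is_lim_left f l).
Proof.
intros HF Hc Hf.
assert (P : forall (G : C -> C) (k' : C) (g : C -> R), (forall z, is_Cderive G z (gauss z)) ->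
  (forall z, z ^ 2 - -1 <> 0 ->
     g z = (Cmod (reduced (-1) (fun z => c * G z + k')%C (fun z => c * (- z * gauss z))%C z) / 2)%R) ->
  exists L : C, (Re (G 1) <= Re L)%R /\ is_lim_right g (Cmod (c * L + k') / 2)%R).
{ intros G k' g HG Hg. destruct (gauss_reduced_limit G c k' HG) as (L & HL1 & HL).
  exists L. split; [easy|]. apply is_lim_right_finite. intros alpha eps Ha He.
  destruct (HL alpha eps Ha He) as [M HM].
  exists (Rmax M (Cmod (-1) + 1)). intros z Hz Harg.
  specialize (HM z (Rle_lt_trans _ _ _ (Rmax_l _ _) Hz) Harg).
  rewrite Hg by apply sqr_neq_of_large, (Rle_lt_trans _ _ _ (Rmax_r _ _) Hz).
  match type of HM with (Cmod (?a - ?b) < _)%R => pose proof (Cmod_dist_le a b) as T;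
    replace (Cmod a / 2 - Cmod b / 2)%R with ((Cmod a - Cmod b) * / 2)%R by field end.
  rewrite Rabs_mult, (Rabs_pos_eq (/ 2)) by lra. lra. }
assert (gauss_even : forall z, gauss (- z) = gauss z).
{ intros z. unfold gauss. now replace ((- z) ^ 2) with (z ^ 2) by ring. }
assert (HG : forall z, is_Cderive (fun z => - F (- z)) z (gauss z)).
{ intros z. rewrite <- gauss_even. now apply is_Cderive_flip_primitive. }
destruct (P F k f HF Hf) as (L & HL & Lim).
destruct (P (fun z => - F (- z)) (- k) (fun z => f (- z)) HG) as (L' & HL' & Lim').
{ intros z Hz. rewrite Hf by (now replace ((- z) ^ 2) with (z ^ 2) by ring).
  rewrite <- Cmod_opp. f_equal. f_equal. unfold reduced. rewrite gauss_even.
  replace ((- z) ^ 2) with (z ^ 2) by ring. ring. }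
apply is_lim_left_flip in Lim'.
destruct (Req_dec (Cmod (c * L + k)) 0) as [E|E].
2:{ left. exists (Finite (Cmod (c * L + k) / 2)). split; [|easy]. intros T. injection T. lra. }
destruct (Req_dec (Cmod (c * L' + - k)) 0) as [E'|E'].
2:{ right. exists (Finite (Cmod (c * L' + - k) / 2)). split; [|easy]. intros T. injection T. lra. }
exfalso. apply Cmod_eq_0 in E, E'.
assert (Z : c * (L + L') = 0).
{ replace (c * (L + L')) with ((c * L + k) + (c * L' + - k)) by ring. rewrite E, E'. ring. }
apply (f_equal Cmod) in Z. rewrite Cmod_mult, Cmod_0 in Z.
apply Rmult_integral in Z. destruct Z as [Z|Z]; apply Cmod_eq_0 in Z; [easy|].
(* [L + L'] is the full Gaussian integral; its real part is at least
   [Re (F 1) - Re (F (-1)) > 0]. *)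
apply (f_equal Re) in Z. change (Re (L + L')) with (Re L + Re L')%R in Z. simpl in Z.
pose proof (gauss_primitive_lt F HF) as T.
replace (- (1)) with (-1 : C) in HL' by (rewrite <- RtoC_opp; f_equal; ring).
change (Re (- F (-1))) with (- Re (F (-1)))%R in HL'. lra.
Qed.

(** For [mu = -1] the first Kummer parameter is 0 and the series reduces to 1; here this follows
    from uniqueness, both sides having data (1, 0) at 0. *)
Lemma psi1_gauss (z : C) : psi1 (-1) z = gauss z.
Proof.
destruct (weber_psi1 (-1)) as (dpsi & HW & P0 & P1).
assert (HG : weber (-1) gauss (fun z => - z * gauss z)).
{ intros w. pose proof (is_Cderive_gauss w) as Hg. split; [exact Hg|].
  eapply is_Cderive_eq.
  - apply is_Cderive_mult; [|exact Hg]. apply is_Cderive_opp, is_Cderive_id.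
  - cbv beta. unfold gauss. ring. }
pose proof (weber_plus_scal (-1) 1 (-1) _ _ _ _ HW HG) as HD.
assert (G0 : gauss 0 = 1) by (unfold gauss; replace (- (0 ^ 2 / 2)) with (0 : C) by field; apply Cexp_0).
pose proof (weber_zero _ _ _ z HD) as Z. cbv beta in Z. rewrite P0, P1, G0 in Z.
replace (psi1 (-1) z) with (1 * psi1 (-1) z + -1 * gauss z + gauss z) by ring.
rewrite Z; ring.
Qed.

Lemma is_Cderive_unique (f : C -> C) (z l l' : C) : is_Cderive f z l -> is_Cderive f z l' -> l = l'.
Proof. intros H H'. now rewrite <- (is_Cderive_C_derive f z l H), (is_Cderive_C_derive f z l' H'). Qed.

Local Close Scope C_scope.

Theorem corollary1p7 :
  forall (mu eta_star c0 c1 c2 : C) (gamma1 gamma2 : C -> R -> C),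
    (c1, c2) <> (RtoC 0, RtoC 0) ->
    (forall eta : C, C1_path eta_star eta (gamma1 eta)) ->
    (forall eta : C, C1_path eta_star eta (gamma2 eta)) ->
    ((forall n : nat, mu <> RtoC (2 * INR n - 1)%R) ->
       is_lim_right (ratio mu eta_star c0 c1 c2 gamma1 gamma2) p_infty \/
       is_lim_left (ratio mu eta_star c0 c1 c2 gamma1 gamma2) p_infty) /\
    (mu = RtoC (-1)%R ->
       (exists l : Rbar, l <> Finite 0 /\
          is_lim_right (ratio mu eta_star c0 c1 c2 gamma1 gamma2) l) \/
       (exists l : Rbar, l <> Finite 0 /\
          is_lim_left (ratio mu eta_star c0 c1 c2 gamma1 gamma2) l)).
Proof.
intros mu eta_star c0 c1 c2 gamma1 gamma2 Hc Hg1 Hg2.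
destruct (weber_psi1 mu) as (dpsi1 & W1 & P10 & P11).
destruct (weber_psi2 mu) as (dpsi2 & W2 & P20 & P21).
destruct (weber_primitive _ _ _ W1) as [prim1 E1].
destruct (weber_primitive _ _ _ W2) as [prim2 E2].
pose proof (weber_plus_scal mu c1 c2 _ _ _ _ W1 W2) as HW.
set (psi := fun z => (c1 * psi1 mu z + c2 * psi2 mu z)%C) in *.
set (dpsi := fun z => (c1 * dpsi1 z + c2 * dpsi2 z)%C) in *.
set (k := (c1 * prim1 eta_star + c2 * prim2 eta_star + 2 * c0)%C).
set (prim := fun z => (c1 * prim1 z + c2 * prim2 z - k)%C).
assert (HE : forall z, is_Cderive prim z (psi z)).
{ intros z. eapply is_Cderive_eq.
  - exact (is_Cderive_minus _ _ z _ _
      (is_Cderive_plus _ _ z _ _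
        (is_Cderive_mult _ _ z _ _ (is_Cderive_const c1 z) (E1 z))
        (is_Cderive_mult _ _ z _ _ (is_Cderive_const c2 z) (E2 z)))
      (is_Cderive_const k z)).
  - cbv beta. unfold psi. ring. }
assert (Hratio : forall z, (z ^ 2 - mu)%C <> RtoC 0 ->
  ratio mu eta_star c0 c1 c2 gamma1 gamma2 z = Cmod (reduced mu prim dpsi z) / 2).
{ intros z Hz. now apply ratio_reduced. }
assert (Hc1 : psi (RtoC 0) = c1) by (unfold psi; rewrite P10, P20; ring).
assert (Hc2 : dpsi (RtoC 0) = c2) by (unfold dpsi; rewrite P11, P21; ring).
split.
- intros Hmu. apply (growth_of_not_decays mu prim psi dpsi); try easy.
  intros [D0 D1].
  (* This yields [Re mu <= 2 N - 4], enough for the descent to end below -2. *)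
  destruct (nat_above (Re mu / 2 + 2)) as [N HN].
  assert (Z : forall x : R, psi (RtoC x) = RtoC 0).
  { apply (weber_no_eigenfunction N mu psi dpsi HW); try easy. lra. }
  apply Hc. rewrite <- Hc1, <- Hc2, Z. f_equal.
  apply (is_Cderive_zero_on_R psi 0 _ Z), HW.
- intros ->.
  (* With [c2 = 0] the solution is a pure Gaussian and the limits are finite; otherwise the growth
     argument applies again and one limit is infinite. *)
  destruct (classic (c2 = RtoC 0)) as [Z2|Z2].
  + assert (Z1 : c1 <> RtoC 0) by (intros Z1; now apply Hc; rewrite Z1, Z2).
    apply (gauss_limits prim1 c1 (- k)%C); [|easy|].
    * intros z. rewrite <- psi1_gauss. apply E1.
    * intros z Hz. rewrite (Hratio z Hz). unfold reduced, prim, dpsi.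
      rewrite (is_Cderive_unique (psi1 (RtoC (-1))) z (dpsi1 z) (- z * gauss z)%C).
      -- rewrite Z2. f_equal. f_equal. ring.
      -- apply W1.
      -- apply (is_derive_ext (K := C_AbsRing) (V := AbsRing_NormedModule C_AbsRing) gauss).
         { intros t. symmetry. apply psi1_gauss. }
         apply is_Cderive_gauss.
  + destruct (growth_of_not_decays _ prim psi dpsi _ HW HE Hratio) as [G|G].
    (* [P = psi' + z psi] equals [c2] at 0 and solves Weber's equation for the parameter -3, where
       decaying solutions vanish on the real line. *)
    * intros [D0 D1]. apply Z2.
      destruct (decays_ladder_up (RtoC (-1)) psi dpsi D0 D1) as [U0 U1].
      pose proof (weber_decays_zero _ _ _ (weber_ladder_up _ _ _ HW) ltac:(simpl; lra) U0 U1 0) as Z.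
      unfold ladder_up in Z. rewrite Hc2, Cmult_0_l, Cplus_0_r in Z. exact Z.
    * left. now exists p_infty.
    * right. now exists p_infty.
Qed.
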